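(* For every $\delta>0$ there exists $C>0$ such that the following holds. Let $\rho:\mathbb N\to(0,1)$ be a function with $\rho(m)\ge m^{\delta}/m^{2}$ for all sufficiently large $m$, and let $0<\varepsilon\le \frac12$. Then asymptotically almost surely (as $m\to\infty$) a random group $\Gamma$ in the binomial triangular model $\Gamma(m,\rho)$ has property $FL^p_{(2-2\varepsilon)^{1/(2p)}}$ for every $p\in\left[2,\,C\left(\frac{\log m}{\log\log m}\right)^{1/2}\right]$. In particular, asymptotically almost surely $\Gamma$ has $FL^p$ for all $p$ in this range.
   Context: Binomial triangular model $\Gamma(m,\rho)$: take a set of generators $S$ with $|S|=m$ and the group $\Gamma=\langle S\mid R\rangle$, where $R$ is a random subset of the set of all cyclically reduced words of length 3 in $S\cup S^{-1}$, each such word being included in $R$ independently with probability $\rho(m)$. A property holds asymptotically almost surely (a.a.s.) if the probability that $\Gamma\in\Gamma(m,\rho)$ satisfies it tends to $1$ as $m\to\infty$. Let $p\in(0,\infty)$, $L\ge1$, $n_0\in\mathbb N$. A Banach space has $L$-bi-Lipschitz $L^p$ geometry above dimension $n_0$ if every $n_0$-dimensional subspace of it is contained in a subspace that is $L$-bi-Lipschitz equivalent either to $\ell^p_n$ ($\mathbb R^n$ with the $p$-norm) for some $n\ge n_0$, or to $\ell^p_\infty$ (the space of $p$-summable sequences), or to some space $L^p(X,\mu)$. Here two spaces are $L$-bi-Lipschitz equivalent if there is a bijection $F$ between them with $L^{-1}\|u-v\|\le\|F(u)-F(v)\|\le L\|u-v\|$ for all $u,v$. If this holds for every $n_0$, the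 Banach space has $L$-bi-Lipschitz $L^p$ geometry in finite dimension. A (topological) group $\Gamma$ has property $FL^p_L$ if every affine isometric continuous action of $\Gamma$ on a Banach space with $L$-bi-Lipschitz $L^p$ geometry in finite dimension has a global fixed point (continuity means that all orbit maps $g\mapsto gv$ are continuous; the random groups are discrete). $\Gamma$ has property $FL^p$ if every affine isometric continuous action of $\Gamma$ on a space $L^p(X,\mu)$ has a global fixed point. *)

(* Defs.v *)
From HB Require Import structures.
From mathcomp Require Import all_boot all_order all_algebra.
From mathcomp Require Import all_classical all_reals all_analysis.
From mathcomp Require Import measurable_realfun.

Set Implicit Arguments.
Unset Strict Implicit.
Unset Printing Implicit Defensive.

Import Order.TTheory GRing.Theory Num.Theory.
Import numFieldNormedType.Exports.

Local Open Scope classical_set_scope.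
Local Open Scope ring_scope.
Local Open Scope quotient_scope.

HB.mixin Record isTopologicalGroup G & Group G & Topological G := {
  mulg_continuous : continuous (fun xy : G * G => (xy.1 * xy.2)%g);
  invg_continuous : continuous (fun x : G => (x^-1)%g)
}.

#[short(type="topologicalGroupType")]
HB.structure Definition TopologicalGroup :=
  {G of Group G & Topological G & isTopologicalGroup G}.

(** A letter [(s, b)] stands for [s] if [b] is false and for [s^-1] otherwise;
    a word is a sequence of letters. *)
Definition letter (S : Type) : Type := (S * bool)%type.
Definition letter_inv (S : Type) (x : letter S) : letter S := (x.1, ~~ x.2).
Definition word (S : Type) : Type := seq (letter S).
Definition word_inv (S : Type) (w : word S) : word S :=
  rev (map (@letter_inv S) w).

(** The congruence on words whose classes are the elements of <S | Rel>. *)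
Inductive word_eq (S : Type) (Rel : set (word S)) : word S -> word S -> Prop :=
| word_eq_refl u : word_eq Rel u u
| word_eq_sym u v : word_eq Rel u v -> word_eq Rel v u
| word_eq_trans u v w : word_eq Rel u v -> word_eq Rel v w -> word_eq Rel u w
| word_eq_cat u u' v v' : word_eq Rel u u' -> word_eq Rel v v' ->
    word_eq Rel (u ++ v) (u' ++ v')
| word_eq_cancel x : word_eq Rel [:: x; letter_inv x] [::]
| word_eq_rel r : Rel r -> word_eq Rel r [::].

Lemma letter_invK (S : Type) : involutive (@letter_inv S).
Proof. by case=> s b; rewrite /letter_inv /= negbK. Qed.

Lemma word_invK (S : Type) : involutive (@word_inv S).
Proof.
move=> w; rewrite /word_inv map_rev revK -map_comp -[RHS]map_id.
by apply: eq_map => x; rewrite /= letter_invK.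
Qed.

Section PresentedGroup.
Variables (S : choiceType) (Rel : set (word S)).

Definition word_eqb (u v : seq (S * bool)) : bool := `[< word_eq Rel u v >].

Let word_eqb_refl : reflexive word_eqb.
Proof. by move=> u; apply/asboolP/word_eq_refl. Qed.

Let word_eqb_sym : symmetric word_eqb.
Proof.
by move=> u v; apply/idP/idP => /asboolP h; apply/asboolP/word_eq_sym.
Qed.

Let word_eqb_trans : transitive word_eqb.
Proof.
by move=> v u w /asboolP uv /asboolP vw; apply/asboolP/(word_eq_trans uv vw).
Qed.

Canonical word_eqb_equiv :=
  EquivRel word_eqb word_eqb_refl word_eqb_sym word_eqb_trans.

Definition presented_group : Type := {eq_quot word_eqb}.
HB.instance Definition _ := Choice.on presented_group.
HB.instance Definition _ := EqQuotient.on presented_group.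

Definition pg_class (w : word S) : presented_group :=
  \pi_presented_group (w : seq (S * bool)).

Lemma pg_classP u v : pg_class u = pg_class v <-> word_eq Rel u v.
Proof.
split=> [/eqmodP/asboolP//|uv]; exact/eqmodP/asboolP.
Qed.

Lemma pg_class_repr (x : presented_group) : pg_class (repr x) = x.
Proof. exact: reprK. Qed.

Lemma repr_pg_class w : word_eq Rel (repr (pg_class w)) w.
Proof. by apply/pg_classP; rewrite pg_class_repr. Qed.

Lemma word_eq_mulV w : word_eq Rel (w ++ word_inv w) [::].
Proof.
elim: w => [|x w IH]; first exact: word_eq_refl.
rewrite /word_inv map_cons rev_cons -cats1 catA cat_cons.
rewrite -[x :: _ ++ _]/([:: x] ++ (w ++ word_inv w)).
apply: word_eq_trans (word_eq_cancel Rel x).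
rewrite -[X in word_eq _ _ X]/(([:: x] ++ [::]) ++ [:: letter_inv x]).
by do 2?apply: word_eq_cat => //; exact: word_eq_refl.
Qed.

Lemma word_eq_Vmul w : word_eq Rel (word_inv w ++ w) [::].
Proof. by have := word_eq_mulV (word_inv w); rewrite word_invK. Qed.

Lemma word_eq_inv u v : word_eq Rel u v ->
  word_eq Rel (word_inv u) (word_inv v).
Proof.
move=> uv.
have h1 : word_eq Rel (word_inv u ++ (v ++ word_inv v)) (word_inv u).
  rewrite -[X in word_eq _ _ X]cats0.
  exact: word_eq_cat (word_eq_refl _ _) (word_eq_mulV v).
apply: word_eq_trans (word_eq_sym h1) _.
rewrite catA -[X in word_eq _ _ X]cat0s.
apply: word_eq_cat (word_eq_refl _ _).
apply: word_eq_trans (word_eq_Vmul u).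
by apply: word_eq_cat (word_eq_refl _ _) (word_eq_sym uv).
Qed.

Definition pg_one : presented_group := pg_class [::].
Definition pg_mul (x y : presented_group) : presented_group :=
  pg_class (repr x ++ repr y).
Definition pg_inv (x : presented_group) : presented_group :=
  pg_class (word_inv (repr x)).

Lemma pg_mulE u v : pg_mul (pg_class u) (pg_class v) = pg_class (u ++ v).
Proof. by apply/pg_classP/word_eq_cat; exact: repr_pg_class. Qed.

Lemma pg_invE u : pg_inv (pg_class u) = pg_class (word_inv u).
Proof. exact/pg_classP/word_eq_inv/repr_pg_class. Qed.

Let pg_mulA : associative pg_mul.
Proof.
move=> x y z.
rewrite -(pg_class_repr x) -(pg_class_repr y) -(pg_class_repr z).
by rewrite !pg_mulE catA.
Qed.

Let pg_mul1 : left_id pg_one pg_mul.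
Proof. by move=> x; rewrite -(pg_class_repr x) pg_mulE. Qed.

Let pg_1mul : right_id pg_one pg_mul.
Proof. by move=> x; rewrite -(pg_class_repr x) pg_mulE cats0. Qed.

Let pg_mulV : left_inverse pg_one pg_inv pg_mul.
Proof.
move=> x; rewrite -(pg_class_repr x) pg_invE pg_mulE.
exact/pg_classP/word_eq_Vmul.
Qed.

Let pg_Vmul : right_inverse pg_one pg_inv pg_mul.
Proof.
move=> x; rewrite -(pg_class_repr x) pg_invE pg_mulE.
exact/pg_classP/word_eq_mulV.
Qed.

HB.instance Definition _ := isGroup.Build presented_group
  pg_mulA pg_mul1 pg_1mul pg_mulV pg_Vmul.

(** Presented groups are discrete. *)
HB.instance Definition _ := hasNbhs.Build presented_group principal_filter.
HB.instance Definition _ := Discrete_ofNbhs.Build presented_group erefl.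

Let pg_mul_continuous :
  continuous (fun xy : presented_group * presented_group => (xy.1 * xy.2)%g).
Proof.
move=> [x y] A /principal_filterP Axy.
exists ([set x], [set y]); first by split; exact/principal_filterP.
by move=> [x' y'] [/= -> ->].
Qed.

Let pg_inv_continuous : continuous (fun x : presented_group => (x^-1)%g).
Proof. by move=> x A /principal_filterP Ax; exact/principal_filterP. Qed.

HB.instance Definition _ := isTopologicalGroup.Build presented_group
  pg_mul_continuous pg_inv_continuous.

End PresentedGroup.

Definition cyclically_reduced (S : eqType) (w : seq (S * bool)) : bool :=
  cycle (fun x y => y != letter_inv x) w.

Definition tri_word (m : nat) : Type :=
  {w : 3.-tuple ('I_m * bool) | cyclically_reduced w}.

Definition tri_group (m : nat) (Rel : {set tri_word m}) :
    topologicalGroupType :=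
  presented_group
    [set w : word 'I_m | exists2 r, r \in Rel & w = val (val r)].

(** Probability, in the binomial model with [m] generators and parameter [r],
    that the random group satisfies [P]. *)
Definition tri_prob (R : realType) (m : nat) (r : R)
    (P : topologicalGroupType -> Prop) : R :=
  \sum_(Rel : {set tri_word m} | `[< P (tri_group Rel) >])
     \prod_(w : tri_word m) (if w \in Rel then r else 1 - r).

(** The property may depend on [m]. *)
Definition aas (R : realType) (rho : nat -> R)
    (P : nat -> topologicalGroupType -> Prop) : Prop :=
  tri_prob m (rho m) (P m) @[m --> \oo] --> (1 : R).

(** Real vector spaces of measurable functions modulo equality almost
    everywhere; [L^p] is cut out of it below. *)
Section MeasurableClasses.
Context d (X : measurableType d) (R : realType).
Variable mu : {measure set X -> \bar R}.

Local Notation mclass := {mfun_ mu, X >-> R}.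

Implicit Types (f g h : mclass).

Let cl (f : {mfun X >-> R}) : mclass :=
  \pi_mclass f.

Let clP (f g : {mfun X >-> R}) :
  (f : X -> R) = g %[ae mu] -> cl f = cl g.
Proof. by move=> fg; apply/eqmodP/asboolP. Qed.

Let clK f : cl (repr f) = f.
Proof. exact: reprK. Qed.

Let repr_cl (f : {mfun X >-> R}) : (repr (cl f) : X -> R) = f %[ae mu].
Proof. by have /eqmodP/asboolP := clK (cl f). Qed.

Definition mclass0 : mclass := cl 0.
Definition mclass_opp f : mclass := cl (- (repr f : {mfun X >-> R})).
Definition mclass_add f g : mclass :=
  cl ((repr f : {mfun X >-> R}) + (repr g : {mfun X >-> R})).
Definition mclass_scale (a : R) f : mclass :=
  cl (a *: (repr f : {mfun X >-> R})).

Let addE (f g : {mfun X >-> R}) : mclass_add (cl f) (cl g) = cl (f + g).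
Proof.
apply: clP; move: (repr_cl f) (repr_cl g); apply: filterS2 => x hf hg xX.
exact: congr2 (hf xX) (hg xX).
Qed.

Let scaleE a (f : {mfun X >-> R}) : mclass_scale a (cl f) = cl (a *: f).
Proof.
apply: clP; move: (repr_cl f); apply: filterS => x hf xX.
by rewrite [LHS](_ : _ = a * (repr (cl f) : X -> R) x) // (hf xX).
Qed.

Let oppE (f : {mfun X >-> R}) : mclass_opp (cl f) = cl (- f).
Proof.
apply: clP; move: (repr_cl f); apply: filterS => x hf xX.
by rewrite [LHS](_ : _ = - (repr (cl f) : X -> R) x) // (hf xX).
Qed.

Let addA : associative mclass_add.
Proof.
by move=> f g h; rewrite -(clK f) -(clK g) -(clK h) !addE addrA.
Qed.

Let addC : commutative mclass_add.
Proof. by move=> f g; rewrite -(clK f) -(clK g) !addE addrC. Qed.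

Let add0 : left_id mclass0 mclass_add.
Proof. by move=> f; rewrite -(clK f) addE add0r. Qed.

Let addN : left_inverse mclass0 mclass_opp mclass_add.
Proof. by move=> f; rewrite -(clK f) oppE addE addNr. Qed.

HB.instance Definition _ := GRing.isZmodule.Build mclass addA addC add0 addN.

Let scaleA a b f : mclass_scale a (mclass_scale b f) = mclass_scale (a * b) f.
Proof. by rewrite -(clK f) !scaleE scalerA. Qed.

Let scale1 : left_id 1 mclass_scale.
Proof. by move=> f; rewrite -(clK f) scaleE scale1r. Qed.

Let scaleDr : right_distributive mclass_scale +%R.
Proof.
move=> a f g; rewrite -(clK f) -(clK g).
by rewrite [LHS](congr1 _ (addE _ _)) !scaleE scalerDr -addE.
Qed.

Let scaleDl f : {morph mclass_scale^~ f : a b / a + b}.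
Proof.
by move=> a b; rewrite -(clK f) !scaleE scalerDl -addE.
Qed.

HB.instance Definition _ := GRing.Zmodule_isLmodule.Build R mclass
  scaleA scale1 scaleDr scaleDl.

Definition Lp_set (p : R) : set mclass :=
  [set f : mclass | finite_norm mu p%:E f].

Definition Lp_norm (p : R) (f : mclass) : R := fine ('N[mu]_(p%:E)[EFin \o f])%E.

End MeasurableClasses.

Arguments Lp_set {d X R} mu p.
Arguments Lp_norm {d X R} mu p f.

(** A vector subspace of a real vector space with a "norm" on it.  No norm
    axiom is imposed: this is only a common format for Banach spaces, their
    subspaces, and the spaces [l^p] and [L^p], where [p < 1] is allowed. *)
Record nspace (R : realType) := NSpace {
  ambient : lmodType R;
  points : set ambient;
  nnorm : ambient -> R
}.
Arguments points {R} n.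
Arguments nnorm {R n}.

Section Spaces.
Context (R : realType).
Implicit Types (E : completeNormedModType R) (p L : R).

Definition sub_nspace E (U : set E) : nspace R :=
  @NSpace R E U (fun u => `|u|).

Definition banach_nspace E : nspace R := sub_nspace [set: E].

Definition lp_nspace p (n : nat) : nspace R :=
  @NSpace R 'rV[R]_n setT
    (fun x => (\sum_(i < n) `|x ord0 i| `^ p) `^ p^-1).

Definition lpoo_nspace p : nspace R :=
  @NSpace R (nat -> R)
    [set x : nat -> R | cvgn (series (fun k => `|x k| `^ p))]
    (fun x => (limn (series (fun k => `|x k| `^ p))) `^ p^-1).

(** [measurableType]s are nonempty; nothing is lost, as [L^p] of the empty space
    is also [L^p] of any space with the zero measure. *)
Definition Lp_nspace d (X : measurableType d) (mu : {measure set X -> \bar R})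
    p : nspace R :=
  @NSpace R {mfun_ mu, X >-> R} (Lp_set mu p) (Lp_norm mu p).

Definition bilip_equiv L (V W : nspace R) : Prop :=
  exists2 F : ambient V -> ambient W, set_bij (points V) (points W) F &
    forall u v, points V u -> points V v ->
      L^-1 * nnorm (u - v) <= nnorm (F u - F v) <= L * nnorm (u - v).

Definition is_subspace E (U : set E) : Prop :=
  U 0 /\ forall (a : R) u v, U u -> U v -> U (a *: u + v).

Definition has_dim E (U : set E) (n : nat) : Prop :=
  exists e : 'I_n -> E,
    (forall c : 'I_n -> R, \sum_(i < n) c i *: e i = 0 -> forall i, c i = 0) /\
    U = range (fun c : 'I_n -> R => \sum_(i < n) c i *: e i).

Definition Lp_geometry_above E p L (n0 : nat) : Prop :=
  forall U : set E, has_dim U n0 ->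
    exists V : set E, [/\ is_subspace V, U `<=` V &
      [\/ exists2 n, (n0 <= n)%N & bilip_equiv L (sub_nspace V) (lp_nspace p n),
          bilip_equiv L (sub_nspace V) (lpoo_nspace p) |
          exists d (X : measurableType d) (mu : {measure set X -> \bar R}),
            bilip_equiv L (sub_nspace V) (Lp_nspace mu p)]].

Definition Lp_geometry_fin_dim E p L : Prop :=
  forall n0, Lp_geometry_above E p L n0.

(** Each [a g] is only constrained on [points V]. *)
Record affine_isometric_action (G : topologicalGroupType) (V : nspace R)
    (a : G -> ambient V -> ambient V) : Prop := {
  act_points : forall g v, points V v -> points V (a g v);
  act1 : forall v, points V v -> a 1%g v = v;
  actM : forall g h v, points V v -> a (g * h)%g v = a g (a h v);
  act_affine : forall g u v (t : R), points V u -> points V v ->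
    a g (t *: u + (1 - t) *: v) = t *: a g u + (1 - t) *: a g v;
  act_isometric : forall g u v, points V u -> points V v ->
    nnorm (a g u - a g v) = nnorm (u - v);
  act_continuous : forall v, points V v -> forall g (e : R), 0 < e ->
    \forall h \near g, nnorm (a h v - a g v) < e
}.

Definition fixed_point_property (G : topologicalGroupType) (V : nspace R) :
    Prop :=
  forall a : G -> ambient V -> ambient V, affine_isometric_action a ->
    exists2 v, points V v & forall g, a g v = v.

Definition FLpL p L (G : topologicalGroupType) : Prop :=
  forall E, Lp_geometry_fin_dim E p L ->
    fixed_point_property G (banach_nspace E).

Definition FLp p (G : topologicalGroupType) : Prop :=
  forall d (X : measurableType d) (mu : {measure set X -> \bar R}),
    fixed_point_property G (Lp_nspace mu p).

End Spaces.

(* Main.v *)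
Require Import Defs.
From HB Require Import structures.
From mathcomp Require Import all_boot all_order all_algebra.
From mathcomp Require Import all_classical all_reals all_analysis.
From mathcomp Require Import measurable_realfun ring lra.
Set Implicit Arguments.
Unset Strict Implicit.
Unset Printing Implicit Defensive.
Import Order.TTheory GRing.Theory Num.Theory.
Import numFieldNormedType.Exports.
Local Open Scope classical_set_scope.
Local Open Scope ring_scope.

(** Let a triangular group act by affine isometries on a Banach space [W], let [v]
    be a point, and put [f x = x v] for every letter [x]. A relator [abc] says that
    [b c v = a^-1 v], so that the points [f b] and [f (a^-1)] are exactly as far
    apart as [c] moves [v]. Taking the edge [b -- a^-1] for every relator [abc]
    gives a random graph on the letters, of average degree [D] say, and the
    [p]-energy of [f] over its edges is at most about [D] times the displacement,
    the sum of [|x v - v|^p] over all letters [x]. Suppose that this graph satisfies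
    a Poincare inequality in [W]: some centre [z] makes [D] times the sum of
    [|f x - z|^p] at most [kappa] times the energy, with [kappa < 1]. Then the
    midpoint [w] of [v] and [z] has a displacement smaller by the factor [kappa],
    because [x w - w] is the average of [x v - z] and [x z - v], and
    [|x z - v| = |x^-1 v - z|] ([displacement_midpoint]). Iterating, the midpoints
    converge geometrically to a fixed point ([contraction_fixed_point],
    [fixed_point_of_poincare]).

    It is therefore enough to prove, for real functions, a Poincare inequality with
    [kappa] close to [1 / 2]. Taking for the centre the mean, one can sum it over
    coordinates and integrate it, which gives it in [l^p] and [L^p]; a bi-Lipschitz
    bijection with constant [L] multiplies [kappa] by [L^(2 p)]
    ([poincare_Lp_geometry]). For [L^(2 p) = 2 - 2 eps] the product stays below [1].

    For the complete graph, the inequality says that a function [g] of mean zero on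
    [n] points satisfies [sum_(x, y) |g x - g y|^p >= 2 n sum_x |g x|^p]
    ([complete_graph_poincare]). It is transferred to every graph with nearly
    constant degrees and small discrepancy ([mixing_poincare]). Indeed the energy
    depends on the pairs of values only through
    [|a - b|^p - |a|^p - |b|^p], which is of the order of [|a|^(p - 1) |b|] for
    [|b| <= |a|], and so only pairs of level sets with comparable values matter;
    those are controlled by the discrepancy. To have few level sets, [g] is first
    rounded to a geometric grid. For a graph on [2 m] vertices it has a size
    polynomial in [log m], and the losses, of the form
    [exp (O (p log log m + p^2))], are compensated by a discrepancy that is a
    negative power of [m], for all [p] in the range of the theorem
    ([parameters_exist]).

    Finally the random graph has these properties with high probability
    ([prob_not_pseudorandom]). The number of edges between two sets of letters [S]
    and [T] is the number of random relators in a given set of words, and Chernoff's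
    bound makes a deviation so improbable that the union bound over all pairs
    converges, as long as [S] and [T] do not have too different sizes. If they do,
    the degree of the vertices of the smaller one already bounds the discrepancy. *)

(** * Powers of absolute values *)

(** Convexity of [x `^ p]: the graph lies above its tangent at [a]. By
    homogeneity it is Young's inequality for [b / a] and [1]. *)
Lemma powR_tangent (R : realType) (p a b : R) : 1 <= p -> 0 <= a -> 0 <= b ->
  a `^ p + p * a `^ (p - 1) * (b - a) <= b `^ p.
Proof.
move=> p1 a0 b0; have p0 : 0 < p by lra.
have [->|pn1] := eqVneq p 1.
  rewrite !powRr1 // subrr powRr0; lra.
have p1' : 1 < p by rewrite lt_neqAle eq_sym pn1.
have [a_eq0|an0] := eqVneq a 0.
  rewrite a_eq0 !powR0 ?gt_eqF //; last by lra.
  by rewrite mulr0 mul0r addr0 powR_ge0.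
have a_gt0 : 0 < a by rewrite lt0r an0.
have ap : a `^ p = a * a `^ (p - 1) by rewrite mulr_powRB1.
have qpos : 0 < p / (p - 1) by apply: divr_gt0; lra.
have conj : p^-1 + (p / (p - 1))^-1 = 1.
  by rewrite invf_div; field; lra.
have x0 : 0 <= b / a by apply: divr_ge0.
have := @conjugate_powR R (b / a) 1 p (p / (p - 1)) x0 ler01 p0 qpos conj.
rewrite powR1 mulr1 => h.
have h2 : p * (b / a) <= (b / a) `^ p + (p - 1).
  have -> : p * (b / a) = (b / a) * p by ring.
  have := ler_wpM2r (ltW p0) h; rewrite mulrDl => /le_trans; apply.
  rewrite divfK ?gt_eqF// lerD2l div1r invf_div divfK ?gt_eqF //.
have apg : 0 < a `^ (p - 1) by apply: powR_gt0.
have bE : b `^ p = a `^ p * (b / a) `^ p.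
  by rewrite -powRM // mulrC divfK.
rewrite bE.
have -> : b - a = a * (b / a - 1) by field.
have -> : p * a `^ (p - 1) * (a * (b / a - 1)) = a `^ p * (p * (b / a) - p).
  by rewrite ap; ring.
rewrite -{1}[a `^ p]mulr1 -mulrDr ler_wpM2l ?powR_ge0 //; lra.
Qed.

Lemma powR_bernoulli (R : realType) (p t : R) : 1 <= p -> -1 <= t ->
  1 + p * t <= (1 + t) `^ p.
Proof.
move=> p1 t1; have h : 0 <= 1 + t by lra.
have := @powR_tangent R p 1 (1 + t) p1 ler01 h.
by rewrite !powR1 mulr1 addrAC subrr add0r.
Qed.

(** If [a - b] is small compared with [a], the tangent at [|a|] loses at most a
    fraction [eta]; otherwise [|a|] itself is at most [p / eta] times [|a - b|]. *)
Lemma norm_powR_perturb (R : realType) (p eta a b : R) : 1 <= p -> 0 < eta ->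
  (1 - eta) * `|a| `^ p <= `|b| `^ p + (p / eta) `^ p * `|a - b| `^ p.
Proof.
move=> p1 eta0; have p0 : 0 < p by lra.
have pe0 : 0 < p / eta by apply: divr_gt0.
have [small|large] := leP (p * `|a - b|) (eta * `|a|); last first.
  have le : `|a| <= p / eta * `|a - b|.
    rewrite mulrAC ler_pdivlMr // mulrC; exact: ltW.
  have : `|a| `^ p <= (p / eta) `^ p * `|a - b| `^ p.
    rewrite -powRM //; last exact: ltW.
    apply: ge0_ler_powR => //; rewrite ?nnegrE //; first exact: ltW.
    by rewrite mulr_ge0 // ltW.
  have := powR_ge0 `|a| p; have := powR_ge0 `|b| p.
  move=> ? ? ?; have : 0 <= eta * `|a| `^ p by apply: mulr_ge0 => //; exact: ltW.
  lra.
have tgt := powR_tangent p1 (normr_ge0 a) (normr_ge0 b).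
have apE : `|a| `^ p = `|a| * `|a| `^ (p - 1) by rewrite mulr_powRB1.
have dist : - `|a - b| <= `|b| - `|a|.
  by have := ler_norm (`|a| - `|b|); have := ler_dist_dist a b; lra.
have pw0 := powR_ge0 `|a| (p - 1).
have : - (eta * `|a| `^ p) <= p * `|a| `^ (p - 1) * (`|b| - `|a|).
  rewrite apE.
  have := ler_wpM2r pw0 small.
  have := ler_wpM2l (mulr_ge0 (ltW p0) pw0) dist.
  nra.
have := mulr_ge0 (powR_ge0 (p / eta) p) (powR_ge0 `|a - b| p).
lra.
Qed.

Lemma norm_powR_subr_le (R : realType) (p a b : R) : 0 <= p ->
  `|a - b| `^ p <= 2 `^ p * (`|a| `^ p + `|b| `^ p).
Proof.
move=> p0.
wlog le_ba : a b / `|b| <= `|a|.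
  move=> H; have [/H//|/ltW/H] := leP `|b| `|a|.
  by rewrite distrC [X in _ * X]addrC.
have le2 : `|a - b| <= 2 * `|a|.
  by have := ler_normB a b; lra.
apply: (@le_trans _ _ ((2 * `|a|) `^ p)).
  by apply: ge0_ler_powR; rewrite ?nnegrE // mulr_ge0.
rewrite powRM // ler_wpM2l ?powR_ge0 //.
by have := powR_ge0 `|b| p; lra.
Qed.

(** The part of [|a - b|^p] that involves both entries has the size
    [|a|^(p - 1) |b|], hence is negligible against [|a|^p] unless the two entries
    are comparable. *)
Lemma norm_powR_cross_le (R : realType) (p a b : R) : 2 <= p -> `|b| <= `|a| ->
  `| `|a - b| `^ p - `|a| `^ p - `|b| `^ p |
     <= p * 2 `^ p * (`|a| `^ (p - 1) * `|b|).
Proof.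
move=> p2 le_ba; have p1 : 1 <= p by lra.
have p0 : 0 <= p by lra.
have powE (x : R) : 0 <= x -> x `^ p = x * x `^ (p - 1).
  by move=> x0; rewrite mulr_powRB1 //; lra.
have two1 : 1 <= 2 `^ (p - 1) :> R.
  by rewrite -[X in X <= _](powRr0 2); apply: ler_powR; lra.
have le_ab2 : `|a - b| <= 2 * `|a| by have := ler_normB a b; lra.
have pw_le : `|a - b| `^ (p - 1) <= 2 `^ (p - 1) * `|a| `^ (p - 1).
  rewrite -powRM //; apply: ge0_ler_powR; rewrite ?nnegrE ?mulr_ge0 //; lra.
have b_le : `|b| `^ (p - 1) <= `|a| `^ (p - 1).
  by apply: ge0_ler_powR; rewrite ?nnegrE //; lra.
have Pa0 := powR_ge0 `|a| (p - 1).
have Pb0 := powR_ge0 `|b| (p - 1).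
have Pd0 := powR_ge0 `|a - b| (p - 1).
have b0 := normr_ge0 b; have a0 := normr_ge0 a.
have two : 2 `^ p = 2 * 2 `^ (p - 1) :> R by apply: powE; lra.
have d1 : `|a| - `|a - b| >= - `|b|.
  have : `|a - b| <= `|a| + `|b| by exact: ler_normB.
  lra.
have d2 : `|a - b| - `|a| >= - `|b|.
  have := lerB_dist a b; lra.
have t1 := powR_tangent p1 (normr_ge0 (a - b)) a0.
have t2 := powR_tangent p1 a0 (normr_ge0 (a - b)).
have h1 : `|a - b| `^ p - `|a| `^ p
    <= p * 2 `^ (p - 1) * (`|a| `^ (p - 1) * `|b|).
  have := ler_wpM2l (mulr_ge0 p0 Pd0) d1.
  have := ler_wpM2l p0 (ler_wpM2r b0 pw_le).
  lra.
have h2 : - (p * (`|a| `^ (p - 1) * `|b|)) <= `|a - b| `^ p - `|a| `^ p.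
  have := ler_wpM2l (mulr_ge0 p0 Pa0) d2; lra.
have h3 : `|b| `^ p <= `|a| `^ (p - 1) * `|b|.
  by rewrite powE // mulrC; apply: ler_wpM2r.
have h4 := powR_ge0 `|b| p.
have M0 : 0 <= `|a| `^ (p - 1) * `|b| by apply: mulr_ge0.
set M := `|a| `^ (p - 1) * `|b| in h1 h2 h3 M0 *.
have pM : M <= p * M by rewrite ler_peMl.
have tpM : p * M <= p * 2 `^ (p - 1) * M.
  by rewrite ler_wpM2r // ler_peMr.
have e : p * 2 `^ p * M = 2 * (p * 2 `^ (p - 1) * M) by rewrite two; ring.
rewrite ler_norml e; apply/andP; split; lra.
Qed.

(** The second term on the right has zero double sum over a family of mean zero,
    so that the inequality sums to the Poincare inequality of the complete graph.
    With the larger entry scaled to [1] and the other one equal to [- t], the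
    correction [p t^(p - 1)] has to be absorbed by terms of order [t^2], which
    requires [p - 1 >= 2]; for [2 <= p < 3] the inequality is false. *)
Lemma norm_powR_subr_ge (R : realType) (p a b : R) : 3 <= p ->
  `|a| `^ p + `|b| `^ p
    <= `|a - b| `^ p
       + p * (a * (b * `|b| `^ (p - 2)) + b * (a * `|a| `^ (p - 2))).
Proof.
move=> p3.
wlog le_ba : a b / `|b| <= `|a|.
  move=> H; have [/H//|/ltW/H] := leP `|b| `|a|.
  by rewrite distrC [X in X <= _]addrC [X in p * X]addrC.
have p1 : 1 <= p by lra.
have [a_eq0|an0] := eqVneq a 0.
  move: le_ba; rewrite a_eq0 normr0 normr_le0 => /eqP ->.
  rewrite subr0 normr0 powR0; last by rewrite gt_eqF //; lra.
  by rewrite !mul0r !addr0 mulr0.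
have a_gt0 : 0 < `|a| by rewrite normr_gt0.
have [s bE] : exists s, b = s * a by exists (b / a); rewrite divfK.
have s1 : `|s| <= 1 by move: le_ba; rewrite bE normrM ger_pMl.
have powE (x : R) (q : R) : 1 <= q -> 0 <= x -> x `^ q = x * x `^ (q - 1).
  by move=> q1 x0; rewrite mulr_powRB1 //; lra.
have pm2 : p - 2 = p - 1 - 1 by ring.
have a2 : a * a * `|a| `^ (p - 2) = `|a| `^ p.
  rewrite (powE _ p) // (powE _ (p - 1)); [|lra|lra].
  by rewrite -pm2 mulrA -expr2 -[in RHS]expr2 real_normK // num_real.
have key : 1 + `|s| `^ p <= `|1 - s| `^ p + p * (s * `|s| `^ (p - 2) + s).
  move: s1; rewrite ler_norml => /andP[s1 s2].
  have [s0|s0] := leP 0 s.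
    rewrite (ger0_norm s0) ger0_norm; last by lra.
    have /(powR_bernoulli p1) : -1 <= - s by lra.
    have : s `^ p <= p * (s * s `^ (p - 2)).
      rewrite (powE s p) //.
      have : s `^ (p - 1) <= s `^ (p - 2).
        have [->|sn0] := eqVneq s 0; first by rewrite !powR0 // gt_eqF //; lra.
        by apply: ger_powR; [rewrite lt0r sn0 s0 | lra].
      move=> /(ler_wpM2l s0) le1; apply: (le_trans le1).
      by rewrite ler_peMl // mulr_ge0 // powR_ge0.
    lra.
  have [t sE] : exists t, s = - t by exists (- s); rewrite opprK.
  have t0 : 0 < t by lra.
  have t1 : t <= 1 by lra.
  rewrite sE opprK normrN [`|t|]gtr0_norm // ger0_norm; last by lra.
  have t01 : 0 < t <= 1 by rewrite t0.
  have b1 : 1 + (p - 2) * t <= (1 + t) `^ (p - 2).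
    by apply: powR_bernoulli; lra.
  have tp : t * t `^ (p - 2) <= t * t.
    apply: ler_wpM2l; first lra.
    by apply: ge1r_powR => //; lra.
  have tpp : t `^ p <= t * t * t.
    rewrite (powE t p) //; last by lra.
    rewrite (powE t (p - 1)); [|lra|lra].
    by rewrite -pm2; nra.
  have e : (1 + t) `^ p = (1 + t) * (1 + t) * (1 + t) `^ (p - 2).
    rewrite (powE _ p) // ?(powE _ (p - 1)) //; [|lra..].
    by rewrite -pm2 mulrA.
  rewrite e.
  have e2 : (1 + t) * (1 + t) * (1 + (p - 2) * t)
            <= (1 + t) * (1 + t) * (1 + t) `^ (p - 2).
    by apply: ler_wpM2l => //; nra.
  have t2 : 0 <= t * t by nra.
  have t3 : 0 <= t * t * t by nra.
  nra.
have -> : a - b = a * (1 - s) by rewrite bE; ring.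
have -> : a * (b * `|b| `^ (p - 2)) + b * (a * `|a| `^ (p - 2))
          = `|a| `^ p * (s * `|s| `^ (p - 2) + s).
  rewrite {1 2}bE {1}bE normrM powRM // -a2; ring.
rewrite {1}bE !normrM !powRM // mulrCA -mulrDr.
rewrite [`|s| `^ p * _]mulrC -{1}[`|a| `^ p]mulr1 -mulrDr.
by apply: ler_wpM2l => //; apply: powR_ge0.
Qed.

(** * The function [|x|^p] for [2 < p < 3] as a mixture of cosines *)

(** The elementary function for which the Poincare inequality of the complete
    graph holds by an identity, and of which [|x|^p] is a positive mixture of
    dilates. *)
Definition cos_defect (R : realType) (x : R) : R := x ^+ 2 / 2 - 1 + cos x.

Lemma sin_le_id (R : realType) (x : R) : 0 <= x -> sin x <= x.
Proof.
move=> x0; pose f (y : R) := y - sin y.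
have df (y : R) : is_derive y 1 f (1 - cos y) by rewrite /f; apply: is_deriveB.
have : f 0 <= f x.
  apply: (@ger0_derive1_ndecr _ f 0 x) => //.
  - by move=> y _; rewrite derive1E (@derive_val _ _ _ _ _ _ _ (df y)) subr_ge0 cos_le1.
  - by apply: continuous_subspaceT => y; apply/differentiable_continuous/derivable1_diffP.
by rewrite /f sin0 subr0 subr_ge0.
Qed.

Lemma cos_half (R : realType) (x : R) : cos x = 1 - 2 * sin (x / 2) ^+ 2.
Proof.
have {1}-> : x = (x / 2) *+ 2 by rewrite mulr2n; field.
by rewrite cos_mulr2n cos2sin2; ring.
Qed.

Lemma sub_sin_le (R : realType) (x : R) : 0 <= x -> x - sin x <= x ^+ 2 / 2.
Proof.
move=> x0; pose f (y : R) := y ^+ 2 - 2 *: (y - sin y).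
have df (y : R) : is_derive y 1 f (2 * (y - 1 + cos y)).
  rewrite /f; apply: is_derive_eq.
  by rewrite /GRing.scale /=; ring.
have : f 0 <= f x.
  apply: (@ger0_derive1_ndecr _ f 0 x) => //.
  - move=> y /[!in_itv]/= /andP[y0 _].
    rewrite derive1E (@derive_val _ _ _ _ _ _ _ (df y)) cos_half.
    have h : sin (y / 2) <= y / 2 by apply: sin_le_id; lra.
    have := sin_le1 (y / 2); have := sin_geN1 (y / 2).
    case: (leP 0 (sin (y / 2))) => [s0|s0]; first by nra.
    have : sin (- (y / 2)) <= y / 2.
      rewrite sinN.
      have [|] := leP (y / 2) 1; last by have := sin_geN1 (y / 2); lra.
      move=> y1; have : 0 <= sin (y / 2).
        by apply: sin_ge0_pi; have := pi_ge2 R; lra.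
      lra.
    rewrite sinN; nra.
  - by apply: continuous_subspaceT => y; apply/differentiable_continuous/derivable1_diffP.
rewrite /f sin0 expr0n /= /GRing.scale /=; lra.
Qed.

Lemma norm_sin_le (R : realType) (x : R) : `|sin x| <= `|x|.
Proof.
wlog x0 : x / 0 <= x.
  move=> H; have [/H//|/ltW x0] := leP 0 x.
  by rewrite -normrN -sinN -[leRHS]normrN H // oppr_ge0.
rewrite (ger0_norm x0) ler_norml sin_le_id // andbT.
have [x1|x1] := leP x 1; last by have := sin_geN1 x; lra.
have : 0 <= sin x by apply: sin_ge0_pi; have := pi_ge2 R; lra.
lra.
Qed.

Lemma cos_defect_half (R : realType) (x : R) :
  cos_defect x = 2 * ((x / 2) ^+ 2 - sin (x / 2) ^+ 2).
Proof. by rewrite /cos_defect cos_half; field. Qed.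

Lemma cos_defect_ge0 (R : realType) (x : R) : 0 <= cos_defect x.
Proof.
rewrite cos_defect_half mulr_ge0 // subr_ge0 -[leLHS]real_normK ?num_real //.
rewrite -[leRHS]real_normK ?num_real //; apply: lerXn2r; rewrite ?nnegrE //.
exact: norm_sin_le.
Qed.

Lemma cos_defect_le_sqr (R : realType) (x : R) : cos_defect x <= x ^+ 2 / 2.
Proof. by rewrite /cos_defect; have := cos_le1 x; lra. Qed.

Lemma cos_defect_le_cube (R : realType) (x : R) : 0 <= x -> cos_defect x <= x ^+ 3.
Proof.
move=> x0; rewrite cos_defect_half.
have y0 : 0 <= x / 2 by lra.
have := sub_sin_le y0; have := sin_le_id y0.
have := norm_sin_le (x / 2); rewrite (ger0_norm y0) ler_norml => /andP[].
set y := x / 2 in y0 *; set s := sin y => ? ? ? h.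
have -> : x = 2 * y by rewrite /y; field.
have -> : 2 * (y ^+ 2 - s ^+ 2) = 2 * (y - s) * (y + s) by ring.
have h1 : 2 * (y - s) * (y + s) <= y ^+ 2 * (y + s).
  by apply: ler_wpM2r; lra.
have h2 : y ^+ 2 * (y + s) <= y ^+ 2 * (y + y).
  by apply: ler_wpM2l; [exact: sqr_ge0 | lra].
have h3 : 0 <= y ^+ 3 by apply: exprn_ge0.
have e : y ^+ 2 * (y + y) = 2 * y ^+ 3 by ring.
have e2 : (2 * y) ^+ 3 = 8 * y ^+ 3 by ring.
lra.
Qed.

Lemma cos_defect_ge (R : realType) (x : R) : x ^+ 2 / 2 - 2 <= cos_defect x.
Proof. by rewrite /cos_defect; have := cos_geN1 x; lra. Qed.

(** The Poincare inequality of the complete graph for [cos_defect]. With [C] and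
    [S] the sums of [cos (g x)] and [sin (g x)], the difference of the two sides
    is [(#|V| - C)^2 + S^2]. *)
Lemma cos_defect_sum (R : realType) (V : finType) (g : V -> R) :
  \sum_x g x = 0 ->
  (2 * #|V|%:R) * \sum_x cos_defect (g x)
    <= \sum_x \sum_y cos_defect (g x - g y).
Proof.
move=> g0; set n : R := #|V|%:R.
pose Q := \sum_x (g x) ^+ 2; pose C := \sum_x cos (g x); pose S := \sum_x sin (g x).
have cstE (a : R) : \sum_(x : V) a = n * a.
  by rewrite sumr_const -mulr_natl.
have e1 : \sum_x cos_defect (g x) = Q / 2 - n + C.
  by rewrite /cos_defect !big_split /= -mulr_suml sumrN cstE mulr1.
have e2 : \sum_x \sum_y cos_defect (g x - g y)
   = n * Q - n * n + C * C + S * S.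
  have e x y : cos_defect (g x - g y) = (g x ^+ 2 / 2 + g y ^+ 2 / 2 - 1)
      - g x * g y + cos (g x) * cos (g y) + sin (g x) * sin (g y).
    by rewrite /cos_defect cosB; field.
  transitivity (\sum_x (n / 2 * g x ^+ 2 + (Q / 2 - n)
      + cos (g x) * C + sin (g x) * S)).
    apply: eq_bigr => x _; under eq_bigr do rewrite e.
    rewrite !big_split /= !sumrN -!mulr_sumr g0 mulr0 -mulr_suml !cstE -/Q -/C -/S.
    by field.
  rewrite !big_split /= -mulr_sumr -!mulr_suml sumrN !cstE -/Q -/C -/S; by field.
rewrite e1 e2; have := sqr_ge0 (n - C); have := sqr_ge0 S; nra.
Qed.


Section CosineTransform.
Context (R : realType).
Implicit Types (p x s lam : R).
Local Notation mu := (@lebesgue_measure R).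

Lemma integral_expR_neg lam : 0 < lam ->
  (\int[mu]_(s in `[0%R, +oo[) (expR (- (lam * s)))%:E = (lam^-1)%:E)%E.
Proof.
move=> lam0; pose F s := - (lam^-1 * expR (- (lam * s))).
have dF s : derivable F s 1 by apply: ex_derive.
have cF : continuous F.
  by move=> s; apply: differentiable_continuous; apply/derivable1_diffP.
rewrite (@ge0_continuous_FTC2y R _ F 0 0) /F.
- by rewrite mulr0 oppr0 expR0 mulr1 sub0e EFinN oppeK.
- by move=> s _; apply: expR_ge0.
- apply: continuous_subspaceT => s; apply: differentiable_continuous.
  by apply/derivable1_diffP; apply: ex_derive.
- rewrite -oppr0; apply: cvgN; rewrite -(mulr0 lam^-1).
  apply: cvgM; first exact: cvg_cst.
  apply: (@cvg_comp _ _ _ (fun s => lam * s) (fun u : R => expR (- u)) _ (pinfty_nbhs R)).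
    exact: gt0_cvgMry.
  exact: cvgr_expR.
- by move=> s _; apply: dF.
- exact: cvg_at_right_filter (cF 0).
- move=> s _; rewrite derive1E derive_val /GRing.scale /=.
  by field; rewrite gt_eqF.
Qed.

Local Notation kernel p s := (expR (- (p * s)) * cos_defect (expR s)).

Lemma continuous_cos_kernel p x :
  continuous (fun s => expR (- (p * s)) * cos_defect (expR s * x)).
Proof.
move=> s; apply: differentiable_continuous; apply/derivable1_diffP.
rewrite /cos_defect; under eq_fun do rewrite -mulr_natl. exact: ex_derive.
Qed.

Lemma cos_kernel_ge0 p x s : 0 <= expR (- (p * s)) * cos_defect (expR s * x).
Proof. by rewrite mulr_ge0 ?expR_ge0 ?cos_defect_ge0. Qed.

Lemma measurable_cos_kernel p x : measurable_fun setT
  (fun s => (expR (- (p * s)) * cos_defect (expR s * x))%:E).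
Proof.
apply/measurable_EFinP; exact: (continuous_measurable_fun (@continuous_cos_kernel p x)).
Qed.

(** The kernel decays exponentially at both ends exactly because
    [2 < p < 3]. *)
Lemma cos_kernel_le p s : 2 < p < 3 ->
  kernel p s <= expR (- (Num.min (p - 2) (3 - p) * `|s|)).
Proof.
move=> /andP[p2 p3].
have [s0|/ltW s0] := leP 0 s.
  rewrite (ger0_norm s0); apply: (@le_trans _ _ (expR (- (p * s)) * (expR s ^+ 2))).
    rewrite ler_wpM2l ?expR_ge0 //; apply: le_trans (cos_defect_le_sqr _) _.
    by have := sqr_ge0 (expR s); lra.
  rewrite -expRM_natl -expRD ler_expR.
  have : Num.min (p - 2) (3 - p) * s <= (p - 2) * s.
    by apply: ler_wpM2r => //; rewrite ge_min lexx.
  lra.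
rewrite (ler0_norm s0); apply: (@le_trans _ _ (expR (- (p * s)) * (expR s ^+ 3))).
  by rewrite ler_wpM2l ?expR_ge0 // cos_defect_le_cube ?expR_ge0.
rewrite -expRM_natl -expRD ler_expR.
have : Num.min (p - 2) (3 - p) * - s <= (3 - p) * - s.
  by apply: ler_wpM2r; rewrite ?oppr_ge0 // ge_min lexx orbT.
lra.
Qed.

(** Finiteness makes the representation of [|x|^p] meaningful, positivity makes it
    non-trivial. *)
Lemma integral_cos_kernel p : 2 < p < 3 ->
  exists2 J, 0 < J & (\int[mu]_s (kernel p s)%:E = J%:E)%E.
Proof.
move=> p23; have /andP[p2 p3] := p23.
have k0 s : 0 <= kernel p s by rewrite -[expR s]mulr1 cos_kernel_ge0.
have mk : measurable_fun setT (fun s => (kernel p s)%:E).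
  by have := measurable_cos_kernel p 1; under eq_fun do rewrite mulr1.
set lam := Num.min (p - 2) (3 - p).
have lam0 : 0 < lam by rewrite lt_min; lra.
have fin : (\int[mu]_s (kernel p s)%:E < +oo)%E.
  apply: (@le_lt_trans _ _ (\int[mu]_s (expR (- (lam * `|s|)))%:E)%E).
    apply: ge0_le_integral => //.
    - by move=> s _; rewrite lee_fin.
    - apply/measurable_EFinP; apply: measurableT_comp => //.
      by apply: measurable_funN; exact: measurable_funM.
    - by move=> s _; rewrite lee_fin; exact: cos_kernel_le.
  rewrite (@ge0_symfun_integralT R (fun s => expR (- (lam * `|s|)))).
  - rewrite -set_itvcy.
    rewrite (_ : (\int[mu]_(x in _) _)%E = (lam^-1)%:E) -?EFinM ?ltry //.
    rewrite -integral_expR_neg //; apply: eq_integral => s.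
    by rewrite inE /= in_itv /= andbT => s0; rewrite ger0_norm.
  - by move=> s; apply: expR_ge0.
  - move=> s; apply: continuous_comp; last exact: continuous_expR.
    apply: cvgN; apply: cvgM; first exact: cvg_cst.
    exact: norm_continuous.
  - by move=> s /=; rewrite normrN.
have pos : (0 < \int[mu]_s (kernel p s)%:E)%E.
  (* there [expR s >= 3], where [cos_defect] is at least [9 / 2 - 2] *)
  pose I : set R := `[2, 3]%classic.
  pose c := expR (- (p * 3)).
  apply: (@lt_le_trans _ _ (\int[mu]_(s in I) c%:E)%E).
    have muI := @lebesgue_measure_itv R `[2, 3].
    rewrite /= lte_fin ifT in muI; last lra.
    rewrite /I integral_cst // [X in (_ * X)%E]muI.
    by rewrite -EFinB -EFinM lte_fin mulr_gt0 ?expR_gt0 //; lra.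
  apply: (@le_trans _ _ (\int[mu]_(s in I) (kernel p s)%:E)%E); last first.
    apply: ge0_subset_integral => //; first exact: measurable_itv.
    by move=> s _; rewrite lee_fin.
  apply: ge0_le_integral => //; first exact: measurable_itv.
  - by move=> s _; rewrite lee_fin expR_ge0.
  - exact: measurable_funTS.
  - move=> s; rewrite /I /= in_itv /= => /andP[s2 s3]; rewrite lee_fin.
    apply: (@le_trans _ _ (expR (- (p * s)) * 1)).
      by rewrite mulr1 ler_expR lerN2 ler_wpM2l //; lra.
    rewrite ler_wpM2l ?expR_ge0 //.
    apply: le_trans (cos_defect_ge _).
    by have := expR_ge1Dx s; nra.
have fn : (\int[mu]_s (kernel p s)%:E)%E \is a fin_num.
  by rewrite ge0_fin_numE // ltW.
exists (fine (\int[mu]_s (kernel p s)%:E)%E); last by rewrite fineK.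
by rewrite fine_gt0 // pos fin.
Qed.

Lemma integral_shift (G : R -> R) (c : R) : continuous G -> (forall s, 0 <= G s) ->
  (\int[mu]_s (G (s + c))%:E = \int[mu]_s (G s)%:E)%E.
Proof.
move=> cG G0.
have dF : ((fun s : R => s + c)^`())%classic = cst 1.
  by apply/funext => s; rewrite derive1E derive_val addr0.
rewrite [RHS](@increasing_ge0_integration_by_substitutionT R (fun s => s + c)) //.
- by apply: eq_integral => s _; rewrite dF /= mulr1.
- by move=> x y; rewrite ltrD2r.
- by rewrite dF => s; exact: cst_continuous.
- by rewrite dF; exact: is_cvg_cst.
- by rewrite dF; exact: is_cvg_cst.
- exact: cvg_addrr_Ny.
- exact: cvg_addrr.
Qed.

(** In the variable [u = expR s] the left side is the integral of
    [cos_defect (u x) u^(- p - 1)]. Its value at [x] comes from the one at [1] by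
    dilating [u], that is, by translating [s]. *)
Lemma cos_transform p x J : 2 < p < 3 ->
  (\int[mu]_s (kernel p s)%:E = J%:E)%E ->
  (\int[mu]_s (expR (- (p * s)) * cos_defect (expR s * x))%:E
     = (`|x| `^ p * J)%:E)%E.
Proof.
move=> /andP[p2 p3] JE.
have p0 : p != 0 by rewrite gt_eqF //; lra.
have [->|x0] := eqVneq x 0.
  rewrite normr0 powR0 // mul0r; apply: integral0_eq => s _.
  by rewrite mulr0 /cos_defect expr0n /= mul0r cos0 sub0r addNr mulr0.
have nx : 0 < `|x| by rewrite normr_gt0.
pose c := ln `|x|; have cE : expR c = `|x| by rewrite lnK.
have even y : cos_defect y = cos_defect `|y|.
  have [y0|y0] := leP 0 y; first by rewrite ger0_norm.
  by rewrite ltr0_norm // /cos_defect cosN sqrrN.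
have e s : (expR (- (p * s)) * cos_defect (expR s * x))%:E
    = ((`|x| `^ p)%:E * (kernel p (s + c))%:E)%E.
  rewrite -EFinM; congr EFin; rewrite even normrM (ger0_norm (expR_ge0 s)) -cE.
  rewrite -expRD mulrA; congr (_ * _).
  by rewrite -expRM -expRD; congr expR; ring.
under eq_integral do rewrite e.
have k0 s : 0 <= kernel p s by rewrite -[expR s]mulr1 cos_kernel_ge0.
have ck : continuous (fun s => kernel p s).
  by have := @continuous_cos_kernel p 1; under eq_fun do rewrite mulr1.
rewrite ge0_integralZl_EFin ?powR_ge0 //.
- by rewrite (@integral_shift (fun s => kernel p s)) // JE EFinM.
- by move=> s _; rewrite lee_fin.
- apply/measurable_EFinP; apply: (@continuous_measurable_fun _ (fun s => kernel p (s + c))) => s.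
  apply: (@continuous_comp _ _ _ (fun s : R => s + c) (fun s => kernel p s)).
    by apply: cvgD; [exact: cvg_id | exact: cvg_cst].
  exact: ck.
Qed.

End CosineTransform.

(** * The Poincare inequality of the complete graph *)

(** The constant [2 #|V|] is the exact one for [p = 2], where both sides agree.
    For [p >= 3] a pointwise inequality suffices. For [2 < p < 3] none does, but
    [|x|^p] is an integral of functions [cos_defect (u x)], for each of which the
    inequality is the non-negativity of a sum of two squares. *)
Lemma complete_graph_poincare (R : realType) (V : finType) (p : R) (g : V -> R) :
  2 <= p -> \sum_x g x = 0 ->
  (2 * #|V|%:R) * \sum_x `|g x| `^ p <= \sum_x \sum_y `|g x - g y| `^ p.
Proof.
move=> p2 g0; set n : R := #|V|%:R.
have cstE (a : R) : \sum_(x : V) a = n * a by rewrite sumr_const -mulr_natl.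
have n0 : 0 <= n by apply: ler0n.
have [p3|p3] := leP 3 p.
  pose J (y : R) := y * `|y| `^ (p - 2).
  have key x y : `|g x| `^ p + `|g y| `^ p
      <= `|g x - g y| `^ p + p * (g x * J (g y) + g y * J (g x)).
    exact: norm_powR_subr_ge.
  have main : \sum_x \sum_y (`|g x| `^ p + `|g y| `^ p)
      <= \sum_x \sum_y (`|g x - g y| `^ p + p * (g x * J (g y) + g y * J (g x))).
    by apply: ler_sum => x _; apply: ler_sum => y _; exact: key.
  have cross x : \sum_y p * (g x * J (g y) + g y * J (g x)) = p * (g x * \sum_y J (g y)).
    by rewrite -mulr_sumr big_split /= -mulr_sumr -mulr_suml g0 mul0r addr0.
  have cross0 : \sum_x \sum_y p * (g x * J (g y) + g y * J (g x)) = 0.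
    under eq_bigr do rewrite cross.
    by rewrite -mulr_sumr -mulr_suml g0 mul0r mulr0.
  have splitR : \sum_x \sum_y (`|g x - g y| `^ p + p * (g x * J (g y) + g y * J (g x)))
     = \sum_x \sum_y `|g x - g y| `^ p.
    under eq_bigr do rewrite big_split /=.
    by rewrite big_split /= cross0 addr0.
  have splitL : \sum_x \sum_y (`|g x| `^ p + `|g y| `^ p)
     = n * (\sum_x `|g x| `^ p) + n * (\sum_x `|g x| `^ p).
    under eq_bigr do rewrite big_split /= cstE.
    by rewrite big_split /= cstE -mulr_sumr.
  rewrite splitR splitL in main; apply: le_trans main.
  by rewrite -mulrA mulr_natl mulr2n.
have sqE (x : R) : `|x| `^ 2 = x ^+ 2.
  by rewrite powR_mulrn // real_normK // num_real.
have [p_eq2|p_neq2] := eqVneq p 2.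
  rewrite p_eq2; under eq_bigr do rewrite sqE.
  under [leRHS]eq_bigr do under eq_bigr do rewrite sqE.
  set Q := \sum_x g x ^+ 2.
  have e x : \sum_y (g x - g y) ^+ 2 = n * g x ^+ 2 + Q.
    transitivity (\sum_y (g x ^+ 2 + g y ^+ 2 - (2 * g x) * g y)).
      by apply: eq_bigr => y _; ring.
    by rewrite !big_split /= sumrN cstE -mulr_sumr g0 mulr0 subr0.
  under [leRHS]eq_bigr do rewrite e.
  by rewrite big_split /= -mulr_sumr cstE -/Q; lra.
have p23 : 2 < p < 3 by rewrite lt_neqAle eq_sym p_neq2 p2.
have [J J0 JE] := integral_cos_kernel p23.
have T x := cos_transform x p23 JE.
have mT x := @measurable_cos_kernel R p x.
have T0 x s := @cos_kernel_ge0 R p x s.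
rewrite -(ler_pM2r J0) -lee_fin.
have -> : ((2 * n * (\sum_x `|g x| `^ p) * J)%:E
   = \int[lebesgue_measure]_s ((2 * n)%:E *
      \sum_x (expR (- (p * s)) * cos_defect (expR s * g x))%:E))%E.
  rewrite ge0_integralZl_EFin //; last 3 first.
  - by move=> s _; apply: sume_ge0 => x _; rewrite lee_fin.
  - by apply: emeasurable_sum => x; exact: mT.
  - by rewrite mulr_ge0.
  rewrite ge0_integral_sum //; last 2 first.
  - by move=> x; exact: mT.
  - by move=> x s _; rewrite lee_fin.
  rewrite (eq_bigr (fun x => (`|g x| `^ p * J)%:E)); last by move=> x _; exact: T.
  by rewrite sumEFin -EFinM -mulr_suml mulrA.
have inner x : (\int[lebesgue_measure]_s (\sum_y
    (expR (- (p * s)) * cos_defect (expR s * (g x - g y)))%:E)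
    = ((\sum_y `|g x - g y| `^ p)%R * J)%:E)%E.
  rewrite ge0_integral_sum //; last 2 first.
  - by move=> y; exact: mT.
  - by move=> y s _; rewrite lee_fin.
  rewrite (eq_bigr (fun y => (`|g x - g y| `^ p * J)%:E)); last by move=> y _; exact: T.
  by rewrite sumEFin -mulr_suml.
rewrite [leRHS](_ : _ = \int[lebesgue_measure]_s (\sum_x \sum_y
    (expR (- (p * s)) * cos_defect (expR s * (g x - g y)))%:E))%E; last first.
  rewrite ge0_integral_sum //; last 2 first.
  - by move=> x; apply: emeasurable_sum => y; exact: mT.
  - by move=> x s _; apply: sume_ge0 => y _; rewrite lee_fin.
  by rewrite (eq_bigr _ (fun x _ => inner x)) sumEFin -mulr_suml.
apply: ge0_le_integral => //.
- move=> s _; apply: mule_ge0; first by rewrite lee_fin mulr_ge0.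
  by apply: sume_ge0 => x _; rewrite lee_fin.
- by apply: measurable_funeM; apply: emeasurable_sum => x; exact: mT.
- by apply: emeasurable_sum => x; apply: emeasurable_sum => y; exact: mT.
- move=> s _.
  under [leRHS]eq_bigr do rewrite sumEFin.
  rewrite !sumEFin -EFinM lee_fin.
  under [leRHS]eq_bigr do rewrite -mulr_sumr.
  rewrite -!mulr_sumr mulrCA ler_wpM2l ?expR_ge0 //.
  under [leRHS]eq_bigr do under eq_bigr do rewrite mulrBr.
  by apply: cos_defect_sum; rewrite -mulr_sumr g0 mulr0.
Qed.

(** * The Poincare inequality of a pseudorandom graph *)

Section Mixing.
Context (R : realType) (V : finType).
Implicit Types (B : V -> V -> R) (D alpha beta eta gamma p : R) (g h : V -> R).

Definition p_energy p B g : R := \sum_x \sum_y B x y * `|g x - g y| `^ p.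

(** Degrees close to [D] and small discrepancy. The last clause is the conclusion
    of the expander mixing lemma, for a graph with second eigenvalue [alpha * D];
    unlike an eigenvalue it can be checked set by set. *)
Definition mixing B D alpha : Prop :=
  [/\ forall x y, 0 <= B x y,
      forall x, `|\sum_y B x y - D| <= alpha * D,
      forall y, `|\sum_x B x y - D| <= alpha * D &
      forall S T : {set V},
        `|\sum_(x in S) \sum_(y in T) (B x y - D / #|V|%:R)|
          <= alpha * D * Num.sqrt (#|S|%:R * #|T|%:R)].

(** Edge by edge, [norm_powR_perturb]; the degree bound then collects the errors at
    the vertices. *)
Lemma p_energy_perturb p eta B D g h : 1 <= p -> 0 < eta ->
  (forall x y, 0 <= B x y) ->
  (forall x, \sum_y B x y <= 2 * D) -> (forall y, \sum_x B x y <= 2 * D) ->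
  (1 - eta) * p_energy p B g
    <= p_energy p B h
       + 4 * D * (2 * (p / eta)) `^ p * \sum_x `|g x - h x| `^ p.
Proof.
move=> p1 eta0 B0 rowB colB; have p0 : 0 <= p by lra.
pose d x := g x - h x; pose c := (2 * (p / eta)) `^ p.
have pe0 : 0 <= p / eta by rewrite divr_ge0 // ltW.
have key x y : (1 - eta) * `|g x - g y| `^ p
    <= `|h x - h y| `^ p + c * (`|d x| `^ p + `|d y| `^ p).
  apply: le_trans (norm_powR_perturb (g x - g y) (h x - h y) p1 eta0) _.
  rewrite lerD2l (_ : g x - g y - (h x - h y) = d x - d y); last by rewrite /d; ring.
  rewrite (_ : c = (p / eta) `^ p * 2 `^ p); last by rewrite /c powRM // [LHS]mulrC.
  rewrite -mulrA ler_wpM2l ?powR_ge0 //.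
  exact: norm_powR_subr_le.
have E0 : 0 <= c by apply: powR_ge0.
apply: (@le_trans _ _ (\sum_x \sum_y (B x y * `|h x - h y| `^ p
    + (c * (`|d x| `^ p) * B x y + c * (`|d y| `^ p) * B x y)))).
  rewrite mulr_sumr; apply: ler_sum => x _; rewrite mulr_sumr; apply: ler_sum => y _.
  by have := ler_wpM2l (B0 x y) (key x y); lra.
under eq_bigr do rewrite big_split /=.
rewrite big_split /= lerD2l.
under eq_bigr do rewrite big_split /=.
rewrite big_split /= [X in _ + X]exchange_big /=.
have half (A : V -> V -> R) : (forall x, \sum_y A x y <= 2 * D) ->
    \sum_x \sum_y c * `|d x| `^ p * A x y <= 2 * D * c * \sum_x `|d x| `^ p.
  move=> rA; rewrite mulr_sumr; apply: ler_sum => x _; rewrite -mulr_sumr.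
  have := ler_wpM2l (mulr_ge0 E0 (powR_ge0 `|d x| p)) (rA x); lra.
have h1 := half B rowB; have h2 := half (fun y x => B x y) colB.
rewrite -/c; have -> : 4 * D * c = 2 * D * c + 2 * D * c by ring.
by rewrite mulrDl; apply: lerD.
Qed.

(** Here [s] and [t] are the sizes of the level sets of two values [a] and [b], and
    [m] is their discrepancy. If [b <= beta * a] the degree bound suffices; otherwise
    [Num.sqrt (s * t)] times [a^p] is at most [beta^(- p / 2) N], and the factor
    [alpha <= beta^p] more than compensates. *)
Lemma level_pair_le p D alpha beta (m s t a b N : R) : 2 <= p ->
  0 <= D -> 0 < beta <= 1 -> 0 <= alpha <= beta `^ p ->
  0 <= s -> 0 <= t -> 0 <= b <= a -> s * a `^ p <= N -> t * b `^ p <= N ->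
  0 <= m -> m <= 3 * D * s -> m <= alpha * D * Num.sqrt (s * t) ->
  m * (a `^ (p - 1) * b) <= 3 * beta * D * N.
Proof.
move=> p2 D0 /andP[b0 b1] /andP[al0 al] s0 t0 /andP[b_ge0 ba] sN tN m0 m1 m2.
have a0 : 0 <= a by lra.
have N0 : 0 <= N by apply: le_trans sN; rewrite mulr_ge0 ?powR_ge0.
have apE : a `^ p = a * a `^ (p - 1) by rewrite mulr_powRB1 //; lra.
have Pa := powR_ge0 a (p - 1).
have [small|large] := leP b (beta * a).
  apply: (@le_trans _ _ (3 * D * s * (a `^ (p - 1) * (beta * a)))).
    apply: ler_pM => //; first by rewrite mulr_ge0.
    by rewrite ler_wpM2l.
  have -> : 3 * D * s * (a `^ (p - 1) * (beta * a)) = 3 * beta * D * (s * a `^ p).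
    by rewrite apE; ring.
  by rewrite ler_wpM2l // !mulr_ge0 //; exact: ltW.
have step : m * (a `^ (p - 1) * b) <= m * a `^ p.
  by rewrite ler_wpM2l // apE mulrC ler_wpM2r.
apply: (le_trans step).
have bp0 : 0 < beta `^ p by apply: powR_gt0.
have ab : beta `^ p * a `^ p <= b `^ p.
  rewrite -powRM ?(ltW b0) //.
  by apply: ge0_ler_powR; rewrite ?nnegrE ?mulr_ge0 ?(ltW b0) ?(ltW large) //; lra.
have bpb : beta `^ p <= beta ^+ 2.
  rewrite -powR_mulrn ?(ltW b0) //; apply: ger_powR => //; by rewrite b0.
have sq : (m * a `^ p) ^+ 2 <= (beta * D * N) ^+ 2.
  have ap0 := powR_ge0 a p.
  have m22 : m ^+ 2 <= (alpha * D) ^+ 2 * (s * t).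
    rewrite -[X in _ * X]sqr_sqrtr ?mulr_ge0 // -exprMn.
    by apply: lerXn2r; rewrite ?nnegrE ?mulr_ge0 ?sqrtr_ge0.
  have al2 : (alpha * D) ^+ 2 * (s * t) <= (beta `^ p * D) ^+ 2 * (s * t).
    rewrite ler_wpM2r ?mulr_ge0 //; apply: lerXn2r; rewrite ?nnegrE ?mulr_ge0 ?powR_ge0 //.
    by rewrite ler_wpM2r.
  have h1 : (m * a `^ p) ^+ 2 <= (beta `^ p * D) ^+ 2 * (s * t) * (a `^ p) ^+ 2.
    by rewrite exprMn ler_wpM2r ?sqr_ge0 //; apply: le_trans m22 al2.
  apply: (le_trans h1).
  have -> : (beta `^ p * D) ^+ 2 * (s * t) * (a `^ p) ^+ 2
     = beta `^ p * D ^+ 2 * ((s * a `^ p) * (t * (beta `^ p * a `^ p))) by ring.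
  have h2 : (s * a `^ p) * (t * (beta `^ p * a `^ p)) <= N * N.
    apply: ler_pM => //; rewrite ?mulr_ge0 ?powR_ge0 //.
    by apply: le_trans tN; rewrite ler_wpM2l.
  have -> : (beta * D * N) ^+ 2 = beta ^+ 2 * D ^+ 2 * (N * N) by ring.
  apply: ler_pM => //; rewrite ?mulr_ge0 ?powR_ge0 ?sqr_ge0 //.
  by rewrite ler_wpM2r ?sqr_ge0.
have r0 : 0 <= beta * D * N by rewrite !mulr_ge0 // ltW.
have l0 : 0 <= m * a `^ p by rewrite mulr_ge0 ?powR_ge0.
have : m * a `^ p <= beta * D * N by rewrite -ler_sqr ?nnegrE.
lra.
Qed.

End Mixing.

(** The index type records the sign and the exponent, and [None] is the value [0];
    its cardinal [2 K + 3] is what the number of pairs of level sets depends on. *)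
Definition grid_value (R : realType) (A q : R) (K : nat)
    (i : option (bool * 'I_K.+1)) : R :=
  if i is Some (b, j) then (-1) ^+ b * (A / q ^+ j) else 0.

(** Rounding towards [0] keeps the norm from growing. The error is relative above
    the cut-off [A / (1 + gamma) ^+ K] and absolute below it. *)
Lemma grid_approx (R : realType) (A gamma a : R) (K : nat) :
  0 <= A -> 0 < gamma -> `|a| <= A ->
  exists i : option (bool * 'I_K.+1),
    let v := grid_value A (1 + gamma) i in
    `|v| <= `|a| /\
    (`|a - v| <= gamma * `|a| \/ `|a - v| <= A / (1 + gamma) ^+ K).
Proof.
move=> A0 gam0 aA; set q := 1 + gamma.
have q0 : 0 < q by rewrite /q; lra.
have qn0 j : 0 < q ^+ j by apply: exprn_gt0.
have [tiny|big] := ltP `|a| (A / q ^+ K).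
  exists None; rewrite /= normr0 subr0; split => //; right; exact: ltW.
have exj : exists j, A / q ^+ j <= `|a| by exists K.
case: (ex_minnP exj) => j jle jmin.
have jK : (j < K.+1)%N by rewrite ltnS; apply: jmin.
have close : `|a| - A / q ^+ j <= gamma * `|a|.
  case: j jle jmin {jK} => [|j] jle jmin.
    rewrite expr0 divr1; have := mulr_ge0 (ltW gam0) (normr_ge0 a); lra.
  have : `|a| < A / q ^+ j.
    by rewrite ltNge; apply/negP => /jmin; rewrite ltnn.
  have -> : A / q ^+ j = q * (A / q ^+ j.+1).
    by rewrite exprS; field; rewrite (gt_eqF q0) (gt_eqF (qn0 j)).
  have v0 : 0 <= A / q ^+ j.+1 by rewrite divr_ge0 // ltW.
  have := ler_wpM2l (ltW gam0) jle; rewrite /q; lra.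
have v0 : 0 <= A / q ^+ j by rewrite divr_ge0 // ltW.
exists (Some (a < 0, Ordinal jK)) => /=.
rewrite normrM normrX normrN1 expr1n mul1r (ger0_norm v0); split => //; left.
have [a0|a0] := ltP a 0; rewrite ?expr1 ?expr0 ?mul1r ?mulN1r.
  rewrite opprK; move: close jle; rewrite (ltr0_norm a0) => close jle.
  by rewrite ler0_norm; lra.
move: close jle; rewrite (ger0_norm a0) => close jle.
by rewrite ger0_norm; lra.
Qed.

Section Discretisation.
Context (R : realType) (V : finType).
Implicit Types (p alpha beta eta gamma A N : R) (g h : V -> R) (K : nat).

(** Taking for [A] the [p]-norm of [g] puts all values within the grid; [K] is
    so large that the absolute errors together amount to no more than the relative
    ones may. *)
Lemma grid_round p gamma K g : 1 <= p -> 0 < gamma ->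
  #|V|%:R <= gamma * (1 + gamma) ^+ K ->
  exists (A : R) (lev : V -> option (bool * 'I_K.+1)),
    let h x := grid_value A (1 + gamma) (lev x) in
    (forall x, `|h x| <= `|g x|) /\
    \sum_x `|g x - h x| `^ p <= 2 * gamma `^ p * \sum_x `|g x| `^ p.
Proof.
move=> p1 gam0 Kbig; have p0 : 0 < p by lra.
set N := \sum_x `|g x| `^ p; pose A := N `^ p^-1.
have N0 : 0 <= N by apply: sumr_ge0 => x _; apply: powR_ge0.
have A0 : 0 <= A by apply: powR_ge0.
have AN : A `^ p = N by rewrite /A -powRrM mulVf ?gt_eqF // powRr1.
have gA x : `|g x| <= A.
  have : `|g x| `^ p <= A `^ p.
    by rewrite AN /N (bigD1 x) //= lerDl; apply: sumr_ge0 => y _; apply: powR_ge0.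
  rewrite !leNgt; apply: contra => lt.
  by apply: gt0_ltr_powR; rewrite ?nnegrE.
have [lev levP] := choice (fun x => @grid_approx R A gamma (g x) K A0 gam0 (gA x)).
exists A, lev; split => [x|]; first by case: (levP x).
have n0 : 0 <= #|V|%:R :> R by [].
pose t := A / (1 + gamma) ^+ K.
have q0 : 0 < (1 + gamma) ^+ K by rewrite exprn_gt0 //; lra.
have t0 : 0 <= t by rewrite divr_ge0 // ltW.
have tbound : #|V|%:R * t `^ p <= gamma `^ p * N.
  have [->|n_neq0] := eqVneq (#|V|%:R : R) 0.
    by rewrite mul0r mulr_ge0 ?powR_ge0.
  have n1 : 1 <= #|V|%:R :> R.
    by rewrite ler1n lt0n; move: n_neq0; rewrite pnatr_eq0.
  have tle : #|V|%:R * t <= gamma * A.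
    rewrite /t mulrA ler_pdivrMr // mulrAC.
    by rewrite ler_wpM2r.
  apply: (@le_trans _ _ ((#|V|%:R * t) `^ p)).
    by rewrite powRM // ler_wpM2r ?powR_ge0 // le1r_powR.
  rewrite -AN -powRM ?(ltW gam0) //.
  by apply: ge0_ler_powR; rewrite ?nnegrE ?(ltW p0) //; apply: mulr_ge0 => //; exact: ltW.
apply: (@le_trans _ _ (\sum_x (gamma `^ p * `|g x| `^ p + t `^ p))).
  apply: ler_sum => x _; have [_ [hx|hx]] := levP x.
    apply: (@le_trans _ _ (gamma `^ p * `|g x| `^ p)); last by rewrite lerDl powR_ge0.
    rewrite -powRM ?(ltW gam0) //.
    by apply: ge0_ler_powR; rewrite ?nnegrE ?mulr_ge0 ?(ltW gam0) ?(ltW p0).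
  apply: (@le_trans _ _ (t `^ p)); last by rewrite lerDr mulr_ge0 ?powR_ge0.
  by apply: ge0_ler_powR; rewrite ?nnegrE ?(ltW p0).
rewrite big_split /= -mulr_sumr sumr_const -[_ *+ _]mulr_natl -/N.
by rewrite -mulrA mulr2n mulrDl !mul1r lerD2l.
Qed.

(** Grouping vertices by grid value turns the cross terms of the energy into
    discrepancies between level sets. *)
Lemma level_sum_le p D alpha beta N (B : V -> V -> R) (I : finType)
    (lev : V -> I) (v : I -> R) :
  2 <= p -> 0 <= D -> 0 < beta <= 1 -> 0 <= alpha <= beta `^ p ->
  mixing B D alpha -> \sum_x `|v (lev x)| `^ p <= N ->
  `|\sum_x \sum_y (B x y - D / #|V|%:R) *
      (`|v (lev x) - v (lev y)| `^ p - `|v (lev x)| `^ p - `|v (lev y)| `^ p)|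
    <= #|I|%:R ^+ 2 * (p * 2 `^ p * (3 * beta * D * N)).
Proof.
move=> p2 D0 beta01 al [B0 rowB colB disc] hN.
have al1 : alpha <= 1.
  case/andP: al => _ /le_trans; apply; case/andP: beta01 => b0 b1.
  rewrite [leRHS](_ : 1 = 1 `^ p); last by rewrite powR1.
  by apply: ge0_ler_powR; rewrite ?nnegrE ?(ltW b0) //; lra.
have p0 : 0 <= p by lra.
pose M x y := B x y - D / #|V|%:R.
pose L i := [set x | lev x == i]%SET.
pose m i j := \sum_(x in L i) \sum_(y in L j) M x y.
pose psi i j := `|v i - v j| `^ p - `|v i| `^ p - `|v j| `^ p.
have -> : \sum_x \sum_y (B x y - D / #|V|%:R) *
      (`|v (lev x) - v (lev y)| `^ p - `|v (lev x)| `^ p - `|v (lev y)| `^ p)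
    = \sum_i \sum_j m i j * psi i j.
  transitivity (\sum_i \sum_(x | lev x == i) \sum_j \sum_(y | lev y == j)
      M x y * psi i j).
    rewrite (partition_big lev predT) //=; apply: eq_bigr => i _.
    apply: eq_bigr => x /eqP xi.
    rewrite (partition_big lev predT) //=; apply: eq_bigr => j _.
    by apply: eq_bigr => y /eqP yj; rewrite xi yj.
  apply: eq_bigr => i _; rewrite exchange_big /=; apply: eq_bigr => j _.
  rewrite /m mulr_suml; apply: eq_big => [x|x _]; first by rewrite /L inE.
  by rewrite mulr_suml; apply: eq_big => [y|//]; rewrite /L inE.
have mass i : #|L i|%:R * `|v i| `^ p <= N.
  apply: le_trans hN; rewrite mulr_natl -sumr_const.
  rewrite [leRHS](bigID (fun x => x \in L i)) /=.
  apply: ler_wpDr; first by apply: sumr_ge0 => x _; apply: powR_ge0.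
  by apply: ler_sum => x; rewrite /L inE => /eqP ->.
have n0 : 0 <= D / #|V|%:R by rewrite divr_ge0.
have absM x y : `|M x y| <= B x y + D / #|V|%:R.
  by apply: le_trans (ler_normB _ _) _; rewrite (ger0_norm (B0 x y)) (ger0_norm n0).
have Dn : (#|V|%:R * (D / #|V|%:R) <= D).
  have [->|nn] := eqVneq (#|V|%:R : R) 0; first by rewrite mul0r.
  by rewrite mulrC divfK.
have alD : alpha * D <= D by rewrite ler_piMl.
have rowM x : \sum_y `|M x y| <= 3 * D.
  apply: (@le_trans _ _ (\sum_y (B x y + D / #|V|%:R))); first exact: ler_sum.
  rewrite big_split /= sumr_const -[_ *+ _]mulr_natl.
  have := rowB x; rewrite ler_norml; lra.
have colM y : \sum_x `|M x y| <= 3 * D.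
  apply: (@le_trans _ _ (\sum_x (B x y + D / #|V|%:R))); first exact: ler_sum.
  rewrite big_split /= sumr_const -[_ *+ _]mulr_natl.
  have := colB y; rewrite ler_norml; lra.
have subsum (F : V -> R) (S : {set V}) : (forall x, 0 <= F x) ->
    \sum_(x in S) F x <= \sum_x F x.
  move=> F0; rewrite [leRHS](bigID (fun x => x \in S)) /= lerDl.
  exact: sumr_ge0.
have m_row i j : `|m i j| <= 3 * D * #|L i|%:R.
  apply: le_trans (ler_norm_sum _ _ _) _.
  rewrite mulr_natr -sumr_const; apply: ler_sum => x _.
  apply: le_trans (ler_norm_sum _ _ _) _.
  by apply: le_trans (rowM x); apply: subsum.
have m_col i j : `|m i j| <= 3 * D * #|L j|%:R.
  rewrite /m exchange_big /=.
  apply: le_trans (ler_norm_sum _ _ _) _.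
  rewrite mulr_natr -sumr_const; apply: ler_sum => y _.
  apply: le_trans (ler_norm_sum _ _ _) _.
  by apply: le_trans (colM y); apply: (subsum (fun x => `|M x y|)).
have c0 : 0 <= p * 2 `^ p by rewrite mulr_ge0 ?powR_ge0.
have term i j : `|m i j * psi i j| <= p * 2 `^ p * (3 * beta * D * N).
  rewrite normrM; have [ba|ab] := leP `|v j| `|v i|.
    apply: (@le_trans _ _ (`|m i j| * (p * 2 `^ p * (`|v i| `^ (p - 1) * `|v j|)))).
      by rewrite ler_wpM2l // norm_powR_cross_le.
    rewrite mulrCA ler_wpM2l //.
    apply: (level_pair_le p2 D0 beta01 al) (mass i) (mass j) _ _ _ => //.
    - by rewrite normr_ge0.
    - exact: disc.
  apply: (@le_trans _ _ (`|m i j| * (p * 2 `^ p * (`|v j| `^ (p - 1) * `|v i|)))).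
    have -> : psi i j = psi j i by rewrite /psi [`|v j - _|]distrC addrAC.
    by rewrite ler_wpM2l // norm_powR_cross_le // ltW.
  rewrite mulrCA ler_wpM2l //.
  apply: (level_pair_le p2 D0 beta01 al) (mass j) (mass i) _ _ _ => //.
  - by rewrite normr_ge0 ltW.
  - by rewrite [_%:R * _]mulrC; exact: disc.
apply: le_trans (ler_norm_sum _ _ _) _.
apply: (@le_trans _ _ (\sum_(i : I) \sum_(j : I) p * 2 `^ p * (3 * beta * D * N))).
  apply: ler_sum => i _; apply: le_trans (ler_norm_sum _ _ _) _.
  by apply: ler_sum => j _; exact: term.
by rewrite !sumr_const -mulrnA -[_ *+ _]mulr_natl natrM expr2.
Qed.

End Discretisation.

Section MixingPoincare.
Context (R : realType) (V : finType).

(** The energies of [g] in the given graph and in the complete graph of degree [D]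
    are compared through the rounding [h] of [g] to a grid. Each rounding costs a
    fraction [eta] of the energy and an error [eta D N], with [N] the sum of
    [|g x|^p]. For [h] the difference of the energies splits into degree terms and
    cross terms; the latter are sums over pairs of level sets, controlled by the
    discrepancy. The Poincare inequality of the complete graph then passes to the
    given one. *)
Theorem mixing_poincare (p eta alpha beta gamma D : R) (K : nat)
    (B : V -> V -> R) (g : V -> R) :
  2 <= p -> 0 < eta <= 1 -> 0 <= D ->
  0 < beta <= 1 -> 0 <= alpha <= beta `^ p -> alpha <= eta ->
  0 < gamma -> 16 * p * gamma <= eta ^+ 2 ->
  #|V|%:R <= gamma * (1 + gamma) ^+ K ->
  (2 * K%:R + 3) ^+ 2 * (p * 2 `^ p * (3 * beta)) <= eta ->
  mixing B D alpha -> \sum_x g x = 0 ->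
  (2 - 9 * eta) * (D * \sum_x `|g x| `^ p) <= p_energy p B g.
Proof.
move=> p2 /andP[eta0 eta1] D0 beta01 al al_eta gam0 gam_le Kbig bet_le mixB g0.
have [B0 rowB colB disc] := mixB.
have p1 : 1 <= p by lra.
have p0 : 0 < p by lra.
set N := \sum_x `|g x| `^ p.
have N0 : 0 <= N by apply: sumr_ge0 => x _; apply: powR_ge0.
have DN0 : 0 <= D * N by rewrite mulr_ge0.
have [A [lev [h_le h_close]]] := grid_round g p1 gam0 Kbig.
set v := @grid_value R A (1 + gamma) K in h_le h_close.
pose h x := v (lev x).
have hN : \sum_x `|h x| `^ p <= N.
  apply: ler_sum => x _; apply: ge0_ler_powR; rewrite ?nnegrE ?(ltW p0) //.
  exact: h_le.
have hN0 : 0 <= \sum_x `|h x| `^ p by apply: sumr_ge0 => x _; apply: powR_ge0.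
have rounding : 4 * D * (2 * (p / eta)) `^ p * (\sum_x `|g x - h x| `^ p) <= eta * (D * N).
  have c0 : 0 <= 4 * D * (2 * (p / eta)) `^ p by rewrite !mulr_ge0 ?powR_ge0.
  apply: le_trans (ler_wpM2l c0 h_close) _; rewrite -/N.
  have pe0 : 0 <= 2 * (p / eta) by rewrite mulr_ge0 // divr_ge0 // ltW.
  have -> : 4 * D * (2 * (p / eta)) `^ p * (2 * gamma `^ p * N)
      = 8 * (2 * (p / eta) * gamma) `^ p * (D * N).
    by rewrite [in RHS]powRM ?(ltW gam0) //; ring.
  rewrite ler_wpM2r //.
  have small : 2 * (p / eta) * gamma <= eta / 8.
    have -> : 2 * (p / eta) * gamma = (16 * p * gamma) / (8 * eta).
      by field; rewrite gt_eqF.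
    have -> : eta / 8 = eta ^+ 2 / (8 * eta) by field; rewrite gt_eqF.
    by rewrite ler_wpM2r // invr_ge0; lra.
  have : (2 * (p / eta) * gamma) `^ p <= 2 * (p / eta) * gamma.
    apply: ge1r_powR => //; rewrite !mulr_gt0 ?divr_gt0 ?invr_gt0 //=; lra.
  lra.
have alD : alpha * D <= eta * D by rewrite ler_wpM2r.
have etaD : eta * D <= D by rewrite ler_piMl.
have rowB2 x : \sum_y B x y <= 2 * D by have := rowB x; rewrite ler_norml; lra.
have colB2 y : \sum_x B x y <= 2 * D by have := colB y; rewrite ler_norml; lra.
pose J := fun _ _ : V => D / #|V|%:R.
have J0 x y : 0 <= J x y by rewrite divr_ge0.
have rowJ x : \sum_y J x y = D.
  rewrite sumr_const -[_ *+ _]mulr_natl mulrC divfK // pnatr_eq0 -lt0n.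
  by apply/card_gt0P; exists x.
have rowJ2 x : \sum_y J x y <= 2 * D by rewrite rowJ; lra.
have stepB := p_energy_perturb h g p1 eta0 B0 rowB2 colB2.
rewrite (eq_bigr (fun x => `|g x - h x| `^ p)) in stepB; last by move=> x _; rewrite distrC.
have stepJ := p_energy_perturb g h p1 eta0 J0 rowJ2 rowJ2.
have complete : 2 * (D * N) <= p_energy p J g.
  rewrite /p_energy; under eq_bigr do rewrite -mulr_sumr.
  rewrite -mulr_sumr.
  have := complete_graph_poincare p2 g0; rewrite -/N.
  have n0 : 0 <= D / #|V|%:R by rewrite divr_ge0.
  move=> /(ler_wpM2l n0); apply: le_trans.
  have [x _|V0] := pickP (fun _ : V => true).
    have nn : #|V|%:R != 0 :> R by rewrite pnatr_eq0 -lt0n; apply/card_gt0P; exists x.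
    by rewrite (_ : D / _ * _ = 2 * (D * N)) //; field.
  by rewrite /N (eq_bigl _ _ V0) big_pred0_eq !mulr0.
have compare : p_energy p J h - 3 * (eta * (D * N)) <= p_energy p B h.
  pose M x y := B x y - D / #|V|%:R.
  pose psi x y := `|h x - h y| `^ p - `|h x| `^ p - `|h y| `^ p.
  have split : p_energy p B h - p_energy p J h = \sum_x \sum_y M x y * psi x y
       + \sum_x `|h x| `^ p * (\sum_y M x y) + \sum_y `|h y| `^ p * (\sum_x M x y).
    rewrite /p_energy -sumrB.
    under [X in _ = _ + X]eq_bigr do rewrite mulr_sumr.
    rewrite [X in _ = _ + X]exchange_big /= -!big_split /=.
    apply: eq_bigr => x _; rewrite -sumrB mulr_sumr -!big_split /=.
    by apply: eq_bigr => y _; rewrite /M /J /psi; ring.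
  have rowM x : - (alpha * D) <= \sum_y M x y.
    by rewrite sumrB (rowJ x); have := rowB x; rewrite ler_norml => /andP[].
  have colM y : - (alpha * D) <= \sum_x M x y.
    by rewrite sumrB (rowJ y); have := colB y; rewrite ler_norml => /andP[].
  have lower (F : V -> R) : (forall x, - (alpha * D) <= F x) ->
      - (eta * (D * N)) <= \sum_x `|h x| `^ p * F x.
    move=> F_ge; apply: (@le_trans _ _ (\sum_x `|h x| `^ p * - (alpha * D))); last first.
      by apply: ler_sum => x _; rewrite ler_wpM2l ?powR_ge0.
    rewrite -mulr_suml mulrN lerN2 mulrC mulrA.
    by apply: ler_pM => //; rewrite mulr_ge0 //; case/andP: al.
  have cross : `|\sum_x \sum_y M x y * psi x y| <= eta * (D * N).
    apply: le_trans (@level_sum_le _ _ _ _ _ _ _ _ _ lev v p2 D0 beta01 al mixB hN) _.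
    rewrite (_ : #|_|%:R = 2 * K%:R + 3); last first.
      by rewrite card_option card_prod card_bool card_ord -natr1 natrM -natr1; ring.
    have -> : (2 * K%:R + 3) ^+ 2 * (p * 2 `^ p * (3 * beta * D * N))
      = (2 * K%:R + 3) ^+ 2 * (p * 2 `^ p * (3 * beta)) * (D * N) by ring.
    by rewrite ler_wpM2r.
  have := lower _ rowM; have := lower _ colM.
  move: cross; rewrite ler_norml; lra.
have e1 : (1 - eta) * (p_energy p J h - 3 * (eta * (D * N)))
    <= (1 - eta) * p_energy p B h.
  by rewrite ler_wpM2l //; lra.
have e2 : (1 - eta) * ((1 - eta) * (2 * (D * N)) - eta * (D * N))
    <= (1 - eta) * p_energy p J h.
  rewrite ler_wpM2l //; first lra.
  have : (1 - eta) * (2 * (D * N)) <= (1 - eta) * p_energy p J g.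
    by rewrite ler_wpM2l //; lra.
  lra.
have e3 : 0 <= eta ^+ 2 * (D * N) by rewrite mulr_ge0 // exprn_ge0 // ltW.
have : (2 - 9 * eta) * (D * N) <= (1 - eta) * ((1 - eta) * (2 * (D * N)) - eta * (D * N))
    - (1 - eta) * (3 * (eta * (D * N))) - eta * (D * N).
  have -> : (1 - eta) * ((1 - eta) * (2 * (D * N)) - eta * (D * N))
    - (1 - eta) * (3 * (eta * (D * N))) - eta * (D * N)
    = (2 - 9 * eta) * (D * N) + 6 * (eta ^+ 2 * (D * N)) by ring.
  lra.
lra.
Qed.

End MixingPoincare.

(** * The spaces [L^p] *)

Section LpBasics.
Context d (X : measurableType d) (R : realType) (mu : {measure set X -> \bar R}).
Context (p : R) (p1 : 1 <= p).
Local Notation mclass := {mfun_ mu, X >-> R}.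
Local Notation fn w := (aqEqMfun_to_fun (w : mclass)).
Implicit Types (u v : mclass) (f g : {mfun X >-> R}).

Let p0 : 0 < p. Proof. exact: lt_le_trans p1. Qed.
Let pn0 : p != 0. Proof. by rewrite gt_eqF. Qed.

Definition mclass_of f : mclass := (\pi_mclass f)%qT.

Lemma repr_mclass_of f : (mclass_of f : X -> R) = f %[ae mu].
Proof.
have : mclass_of (repr (mclass_of f)) = mclass_of f by exact: reprK.
by move=> /eqmodP/asboolP.
Qed.

Lemma mclass_eqP u v : (u : X -> R) = v %[ae mu] -> u = v.
Proof.
move=> uv; rewrite -[u]reprK -[v]reprK.
by apply/eqmodP/asboolP.
Qed.

Lemma mclassD u v : fn (u + v) = (fun x => u x + v x) %[ae mu].
Proof. exact: (repr_mclass_of (repr u + repr v)). Qed.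

Lemma mclassZ (a : R) u : fn (a *: u) = (fun x => a * u x) %[ae mu].
Proof. exact: (repr_mclass_of (a *: repr u)). Qed.

Lemma mclassN u : fn (- u) = (fun x => - u x) %[ae mu].
Proof. exact: (repr_mclass_of (- repr u)). Qed.

Lemma mclass0E : fn 0 = (fun=> 0) %[ae mu].
Proof. exact: (repr_mclass_of 0). Qed.

Lemma mclassB u v : fn (u - v) = (fun x => u x - v x) %[ae mu].
Proof.
move: (mclassD u (- v)) (mclassN v); apply: filterS2 => x h1 h2 xX.
by rewrite h1 // h2.
Qed.

Lemma mclass_sum (I : Type) (r : seq I) (F : I -> mclass) :
  fn (\sum_(i <- r) F i) = (fun x => \sum_(i <- r) F i x) %[ae mu].
Proof.
elim: r => [|i r IH].
  rewrite big_nil; move: mclass0E; apply: filterS => x h xX.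
  by rewrite h // big_nil.
rewrite big_cons; move: (mclassD (F i) (\sum_(i <- r) F i)) IH.
by apply: filterS2 => x h1 h2 xX; rewrite h1 // h2 // big_cons.
Qed.

Lemma measurable_mclass u : measurable_fun setT (u : X -> R).
Proof. exact: measurable_funPT. Qed.

Lemma measurable_norm_powR (h : X -> R) : measurable_fun setT h ->
  measurable_fun setT (fun x => (`|h x| `^ p)%:E).
Proof.
move=> mh; apply/measurable_EFinP.
by apply: (measurableT_comp (measurable_powR p)); apply: measurableT_comp.
Qed.

Definition p_integral (h : X -> R) : \bar R := (\int[mu]_x (`|h x| `^ p)%:E)%E.

Lemma p_integral_ge0 h : (0 <= p_integral h)%E.
Proof. by apply: integral_ge0 => x _; rewrite lee_fin powR_ge0. Qed.

Lemma ae_eq_p_integral (h k : X -> R) : measurable_fun setT h ->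
  measurable_fun setT k -> h = k %[ae mu] -> p_integral h = p_integral k.
Proof.
move=> mh mk hk; apply: ae_eq_integral => //; try exact: measurable_norm_powR.
by move: hk; apply: filterS => x hx xX; rewrite hx.
Qed.

Lemma LnormE (h : X -> R) : ('N[mu]_(p%:E)[EFin \o h] = p_integral h `^ p^-1)%E.
Proof.
by rewrite unlock; congr (_ `^ _)%E; apply: eq_integral => x _ /=; rewrite poweR_EFin.
Qed.

Lemma Lp_setP u : Lp_set mu p u <-> (p_integral u < +oo)%E.
Proof.
rewrite /Lp_set /finite_norm /= LnormE; split => h; last exact: poweR_lty.
by apply: lty_poweRy h; rewrite invr_eq0.
Qed.

Lemma Lp_norm_ge0 u : 0 <= Lp_norm mu p u.
Proof. by apply: fine_ge0; apply: Lnorm_ge0. Qed.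

Lemma Lp_normE u : Lp_norm mu p u = fine (p_integral u) `^ p^-1.
Proof. by rewrite /Lp_norm LnormE fine_poweR. Qed.

Lemma Lp_norm_powE u : Lp_norm mu p u `^ p = fine (p_integral u).
Proof.
rewrite Lp_normE -powRrM mulVf // powRr1 //.
by apply: fine_ge0; apply: p_integral_ge0.
Qed.

Lemma Lp_norm_pow_EFin u : Lp_set mu p u ->
  (Lp_norm mu p u `^ p)%:E = p_integral u.
Proof.
move=> /Lp_setP h; rewrite Lp_norm_powE fineK // ge0_fin_numE //.
exact: p_integral_ge0.
Qed.

Lemma p_integral_add_le (h k : X -> R) :
  measurable_fun setT h -> measurable_fun setT k ->
  (p_integral (fun x => (h x + k x)%R) <= (2 `^ p)%:E * (p_integral h + p_integral k))%E.
Proof.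
move=> mh mk; rewrite /p_integral -ge0_integralD //; try exact: measurable_norm_powR.
rewrite -ge0_integralZl_EFin ?powR_ge0 //; last 2 first.
- by move=> x _; rewrite adde_ge0 // lee_fin powR_ge0.
- by apply: emeasurable_funD; exact: measurable_norm_powR.
apply: ge0_le_integral => //.
- by apply: measurable_norm_powR; apply: measurable_funD.
- apply: measurable_funeM; apply: emeasurable_funD; exact: measurable_norm_powR.
- move=> x _; rewrite lee_fin.
  have := @norm_powR_subr_le R p (h x) (- k x) (ltW p0).
  by rewrite opprK normrN.
Qed.

Lemma p_integralZ (a : R) (h : X -> R) : measurable_fun setT h ->
  p_integral (fun x => a * h x) = ((`|a| `^ p)%:E * p_integral h)%E.
Proof.
move=> mh; rewrite /p_integral -ge0_integralZl_EFin ?powR_ge0 //.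
- by apply: eq_integral => x _; rewrite normrM powRM // EFinM.
- exact: measurable_norm_powR.
Qed.

Lemma Lp_set0 : Lp_set mu p 0.
Proof.
apply/Lp_setP; rewrite (@ae_eq_p_integral _ (fun=> 0)) //; last exact: mclass0E.
  rewrite /p_integral; under eq_integral do rewrite normr0 powR0 //.
  by rewrite integral0 ltry.
Qed.

Lemma Lp_setZD (a : R) u v : Lp_set mu p u -> Lp_set mu p v -> Lp_set mu p (a *: u + v).
Proof.
move=> /Lp_setP hu /Lp_setP hv; apply/Lp_setP.
have mu_ := measurable_mclass u; have mv := measurable_mclass v.
have mau : measurable_fun setT (fun x => a * u x) by apply: measurable_funM.
rewrite (@ae_eq_p_integral _ (fun x => a * u x + v x)).
- apply: le_lt_trans (p_integral_add_le mau mv) _.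
  have c0 (r : R) : (0 <= (r `^ p)%:E)%E by rewrite lee_fin powR_ge0.
  have finau : (p_integral (fun x => (a * u x)%R) < +oo)%E.
    by rewrite (p_integralZ a mu_); exact: lte_mul_pinfty (c0 _) isT hu.
  exact: lte_mul_pinfty (c0 _) isT (lte_add_pinfty finau hv).
- exact: measurable_mclass.
- exact: measurable_funD.
- move: (mclassD (a *: u) v) (mclassZ a u); apply: filterS2 => x h1 h2 xX.
  by rewrite h1 // h2.
Qed.

Lemma Lp_normD u v : Lp_set mu p u -> Lp_set mu p v ->
  Lp_norm mu p (u + v) <= Lp_norm mu p u + Lp_norm mu p v.
Proof.
move=> hu hv.
have mu_ := measurable_mclass u; have mv := measurable_mclass v.
have fin w : Lp_set mu p w -> ('N[mu]_(p%:E)[EFin \o w])%E \is a fin_num.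
  by move=> hw; rewrite ge0_fin_numE ?Lnorm_ge0.
have e : ('N[mu]_(p%:E)[EFin \o fn (u + v)%R]
      = 'N[mu]_(p%:E)[EFin \o (fun x => u x + v x)%R])%E.
  rewrite !LnormE (@ae_eq_p_integral _ (fun x => u x + v x)) //.
  - exact: measurable_funD.
  - exact: mclassD.
have huv : Lp_set mu p (u + v) by rewrite -[u]scale1r; apply: Lp_setZD.
rewrite -lee_fin EFinD /Lp_norm !fineK ?fin // e.
exact: minkowski_EFin.
Qed.

Lemma Lp_normZ (a : R) u : Lp_set mu p u ->
  Lp_norm mu p (a *: u) = `|a| * Lp_norm mu p u.
Proof.
move=> hu; rewrite !Lp_normE.
rewrite (@ae_eq_p_integral _ (fun x => a * u x)).
- rewrite p_integralZ; last exact: measurable_mclass.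
  rewrite fineM // ?powRM ?powR_ge0 ?fine_ge0 ?p_integral_ge0 //.
    by rewrite /= -powRrM mulfV // powRr1.
  by rewrite ge0_fin_numE ?p_integral_ge0 //; apply/Lp_setP.
- exact: measurable_mclass.
- by apply: measurable_funM => //; exact: measurable_mclass.
- exact: mclassZ.
Qed.

Lemma Lp_norm_eq0 u : Lp_set mu p u -> Lp_norm mu p u = 0 -> u = 0.
Proof.
move=> hu nu0.
have N0 : ('N[mu]_(p%:E)[EFin \o u] = 0)%E.
  rewrite -[LHS]fineK; last by rewrite ge0_fin_numE ?Lnorm_ge0.
  by move: nu0; rewrite /Lp_norm => ->.
have := @Lnorm_eq0_eq0 _ _ _ mu (EFin \o u) p%:E.
move=> /(_ _ _ N0) h; apply: mclass_eqP.
have hu0 : (EFin \o u) = \0%E %[ae mu].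
  by apply: h; [apply/measurable_EFinP; exact: measurable_mclass | rewrite lte_fin].
move: hu0 mclass0E; apply: filterS2 => x h1 h2 xX.
by have [ux] := h1 xX; rewrite h2 // ux.
Qed.

End LpBasics.

Lemma geometric_sum_le (R : realType) (C r : R) (N : nat) : 0 <= C -> 0 < r < 1 ->
  \sum_(0 <= k < N) C * r ^+ k <= C / (1 - r).
Proof.
move=> C0 /andP[r0 r1].
have r10 : 0 < 1 - r by lra.
rewrite ler_pdivlMr // -mulr_sumr -mulrA ler_piMr //.
have -> : (\sum_(0 <= k < N) r ^+ k) * (1 - r) = 1 - r ^+ N.
  elim: N => [|N IH]; first by rewrite big_nil mul0r expr0 subrr.
  by rewrite big_nat_recr //= mulrDl IH exprS; ring.
by rewrite gerBl exprn_ge0 // ltW.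
Qed.

Lemma cvg_norm_powR (R : realType) (p : R) (u : nat -> R) (l : R) : 1 <= p ->
  u @ \oo --> l -> (fun k => `|u k| `^ p) @ \oo --> `|l| `^ p.
Proof.
move=> p1 ul; have p0 : 0 < p by lra.
pose c := p * (`|l| + 1) `^ (p - 1).
have c0 : 0 < c + 1.
  have : 0 <= c by rewrite mulr_ge0 ?powR_ge0 ?(ltW p0).
  lra.
have lip (a b : R) : `|a| <= `|l| + 1 -> `|a| `^ p - `|b| `^ p <= c * `|a - b|.
  move=> al; have := powR_tangent p1 (normr_ge0 a) (normr_ge0 b).
  have d : `|a| - `|b| <= `|a - b| by exact: lerB_dist.
  have ca : p * `|a| `^ (p - 1) <= c.
    rewrite ler_wpM2l ?(ltW p0) //; apply: ge0_ler_powR; rewrite ?subr_ge0 ?nnegrE //.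
  have pa0 : 0 <= p * `|a| `^ (p - 1) by rewrite mulr_ge0 ?powR_ge0 ?(ltW p0).
  have := ler_wpM2l pa0 d; have := ler_wpM2r (normr_ge0 (a - b)) ca.
  lra.
apply/cvgrPdist_lt => e e0.
have m0 : 0 < Num.min 1 (e / (c + 1)) by rewrite lt_min ltr01 divr_gt0.
move/cvgrPdist_lt: ul => /(_ _ m0); apply: filterS => k; rewrite lt_min => /andP[h1 h2].
have l1 : `|u k| <= `|l| + 1.
  by have := lerB_dist (u k) l; rewrite distrC; lra.
have b1 := lip (u k) l l1.
rewrite ltr_norml; move: h2; rewrite ltr_pdivlMr // => h2.
have d0 := normr_ge0 (l - u k).
rewrite distrC in b1.
have : `|l| `^ p - `|u k| `^ p <= c * `|l - u k| by apply: lip; rewrite lerDl.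
move: b1 h2; nra.
Qed.

Section LpComplete.
Context d (X : measurableType d) (R : realType) (mu : {measure set X -> \bar R}).
Context (p : R) (p1 : 1 <= p).
Local Notation mclass := {mfun_ mu, X >-> R}.
Local Notation fn w := (aqEqMfun_to_fun (w : mclass)).

Lemma mfun_of_measurable (f : X -> R) : measurable_fun setT f ->
  exists g : {mfun X >-> R}, g = f :> (X -> R).
Proof.
move=> mf.
pose g : {mfun X >-> R} := HB.pack f (isMeasurableFun.Build _ _ _ _ f mf).
by exists g.
Qed.

Lemma Lp_norm_telescope (C r : R) (u : nat -> mclass) (k j : nat) :
  0 <= C -> 0 < r < 1 -> (forall k, Lp_set mu p (u k)) ->
  (forall k, Lp_norm mu p (u k.+1 - u k) <= C * r ^+ k) ->
  Lp_norm mu p (u (k + j)%N - u k) <= C * r ^+ k / (1 - r).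
Proof.
move=> C0 r01 hu du.
have r0 : 0 <= r by case/andP: r01 => /ltW.
have hB i l : Lp_set mu p (u i - u l).
  by rewrite addrC -scaleN1r; apply: Lp_setZD.
apply: le_trans (@geometric_sum_le R (C * r ^+ k) r j _ r01); last first.
  by rewrite mulr_ge0 ?exprn_ge0.
elim: j => [|j IH].
  rewrite addn0 subrr big_nil -[0 : mclass](scale0r 0) Lp_normZ //; last exact: Lp_set0.
  by rewrite normr0 mul0r.
rewrite big_nat_recr //= addnS.
have -> : u (k + j).+1 - u k = (u (k + j)%N - u k) + (u (k + j).+1 - u (k + j)%N).
  by rewrite [RHS]addrC addrA subrK.
apply: le_trans (Lp_normD p1 (hB _ _) (hB _ _)) _.
by apply: lerD => //; rewrite -mulrA -exprD.
Qed.

(** Where the increments are summable the representatives converge. The partial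
    sums [G N] of the absolute increments have bounded norm by Minkowski's
    inequality, so monotone convergence makes the supremum of their [p]-th powers
    integrable, hence almost everywhere finite. *)
Lemma Lp_ae_limit (C r : R) (u : nat -> mclass) :
  0 <= C -> 0 < r < 1 -> (forall k, Lp_set mu p (u k)) ->
  (forall k, Lp_norm mu p (u k.+1 - u k) <= C * r ^+ k) ->
  exists f : {mfun X >-> R}, {ae mu, forall x, (fun k => fn (u k) x) @ \oo --> f x}.
Proof.
move=> C0 r01 hu du.
have p0 : 0 < p := lt_le_trans ltr01 p1.
pose D k x := `|fn (u k.+1) x - fn (u k) x|.
pose G N x := \sum_(0 <= k < N) D k x.
have D0 k x : 0 <= D k x by exact: normr_ge0.
have G0 N x : 0 <= G N x by apply: sumr_ge0 => k _; exact: D0.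
have mD k : measurable_fun setT (D k).
  apply: measurableT_comp => //.
  by apply: measurable_funB; exact: measurable_mclass.
have mG N : measurable_fun setT (G N) by apply: measurable_sum => k; exact: mD.
have hB i l : Lp_set mu p (u i - u l).
  by rewrite addrC -scaleN1r; apply: Lp_setZD.
pose M := C / (1 - r).
have M0 : 0 <= M by rewrite divr_ge0 // subr_ge0; case/andP: r01 => _ /ltW.
have normD k : ('N[mu]_(p%:E)[EFin \o D k] <= (C * r ^+ k)%:E)%E.
  have -> : ('N[mu]_(p%:E)[EFin \o D k] = 'N[mu]_(p%:E)[EFin \o fn (u k.+1 - u k)%R])%E.
    rewrite !LnormE; congr (_ `^ _)%E.
    transitivity (p_integral mu p (fun x => fn (u k.+1) x - fn (u k) x)).
      by apply: eq_integral => x _; rewrite /D normr_id.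
    apply: ae_eq_p_integral => //.
    - by apply: measurable_funB; exact: measurable_mclass.
    - by move: (mclassB (u k.+1) (u k)); apply: filterS => x h xX; rewrite h.
  rewrite -[leLHS]fineK ?lee_fin; first exact: du.
  by rewrite ge0_fin_numE ?Lnorm_ge0 //; exact: hB.
have normG N : ('N[mu]_(p%:E)[EFin \o G N] <= M%:E)%E.
  apply: (@le_trans _ _ (\sum_(0 <= k < N) C * r ^+ k)%:E); last first.
    by rewrite lee_fin; exact: geometric_sum_le.
  elim: N => [|N IH].
    rewrite big_nil (@eq_Lnorm _ _ _ _ _ _ (cst 0%E)); first by rewrite Lnorm0 // eqe gt_eqF.
    by move=> x; rewrite /G /= big_nil.
  rewrite big_nat_recr //= EFinD.
  rewrite (@eq_Lnorm _ _ _ _ _ _ (EFin \o (G N \+ D N)%R)); last first.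
    by move=> x; rewrite /G /= big_nat_recr.
  apply: le_trans (minkowski_EFin mu (mG N) (mD N) p1) _.
  exact: leeD.
pose g N x := (`|G N x| `^ p)%:E.
have mg N : measurable_fun setT (g N) by apply: measurable_norm_powR.
have g0 N x : setT x -> (0 <= g N x)%E by rewrite lee_fin powR_ge0.
have ndg x : setT x -> nondecreasing_seq (g^~ x).
  move=> _ i j ij; rewrite lee_fin; apply: ge0_ler_powR; rewrite ?nnegrE ?(ltW p0) //.
  rewrite !ger0_norm // /G (@big_cat_nat _ _ _ i 0 j) //= lerDl.
  by apply: sumr_ge0 => k _; exact: D0.
have intg N : (\int[mu]_x g N x <= (M `^ p)%:E)%E.
  have := normG N; rewrite LnormE => h.
  have -> : (\int[mu]_x g N x)%E = ((p_integral mu p (G N) `^ p^-1) `^ p)%E.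
    by rewrite -poweRrM mulVf ?gt_eqF // poweRe1 // p_integral_ge0.
  rewrite -poweR_EFin; apply: gt0_ler_poweR; rewrite ?(ltW p0) //.
  - by rewrite in_itv /= poweR_ge0 leey.
  - by rewrite in_itv /= lee_fin M0 leey.
pose H x := limn (g^~ x).
have cvgg x : cvgn (g^~ x) by apply: ereal_nondecreasing_is_cvgn; exact: ndg.
have mH : measurable_fun setT H by apply: (emeasurable_fun_cvg g) => // x _; exact: cvgg.
have H0 x : (0 <= H x)%E by apply: lime_ge => //; apply: nearW => N; exact: g0.
have intH : (\int[mu]_x H x <= (M `^ p)%:E)%E.
  rewrite monotone_convergence //; apply: lime_le; last exact: nearW.
  apply: ereal_nondecreasing_is_cvgn => i j ij.
  by apply: ge0_le_integral => // x xX; [exact: g0|exact: ndg].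
have iH : mu.-integrable setT H.
  apply/integrableP; split => //.
  under eq_integral do rewrite gee0_abs //.
  by apply: le_lt_trans intH _; rewrite ltry.
pose A := [set x | (H x < +oo)%E].
have mA : measurable A.
  by have := emeasurable_fun_infty_o measurableT mH +oo%E; rewrite setTI.
have aeA : {ae mu, forall x, A x}.
  have := integrable_ae measurableT iH; apply: filterS => x /(_ I) hx.
  by rewrite /A /= -ge0_fin_numE.
have cvgA x : A x -> cvgn (fun k => fn (u k) x).
  move=> Ax.
  have bd N : G N x <= 1 + fine (H x).
    have gH : (g N x <= H x)%E.
      by apply: lime_ge; [exact: cvgg | exists N => // j /= Nj; exact: ndg].
    have : G N x `^ p <= fine (H x).
      by rewrite -lee_fin fineK ?ge0_fin_numE // -[G N x]ger0_norm.
    have [|/ltW G1] := leP (G N x) 1; first by have := fine_ge0 (H0 x); lra.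
    by have := le1r_powR G1 p1; lra.
  have cs : cvgn (series (fun k => fn (u k.+1) x - fn (u k) x)).
    apply: normed_cvg; apply: nondecreasing_is_cvgn.
      by apply: nondecreasing_series => k _ _; exact: D0.
    by exists (1 + fine (H x)) => _ [N _ <-]; exact: bd.
  have -> : (fun k => fn (u k) x)
     = (fun k => fn (u 0%N) x + series (fun k => fn (u k.+1) x - fn (u k) x) k).
    apply/funext => k; rewrite /series /= telescope_sumr //; ring.
  exact: is_cvgD (is_cvg_cst _) cs.
pose F k x := fn (u k) x * \1_A x.
have mF k : measurable_fun setT (F k).
  apply: measurable_funM; first exact: measurable_mclass.
  exact: measurable_indic.
pose l x := limn (F^~ x).
have cvgF x : F^~ x @ \oo --> l x.
  have [Ax|nAx] := pselect (A x).
    rewrite /l (_ : F^~ x = fun k => fn (u k) x); first exact: cvgA.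
    by apply/funext => k; rewrite /F indicE mem_set // mulr1.
  rewrite /l (_ : F^~ x = fun=> 0); first exact: is_cvg_cst.
  by apply/funext => k; rewrite /F indicE memNset // mulr0.
have ml : measurable_fun setT l by apply: (measurable_fun_cvg mF) => x _; exact: cvgF.
have [f fE] := mfun_of_measurable ml.
exists f; move: aeA; apply: filterS => x Ax; rewrite fE.
have := cvgF x; rewrite (_ : F^~ x = fun k => fn (u k) x) //.
by apply/funext => k; rewrite /F indicE mem_set // mulr1.
Qed.

(** The pointwise limit is a limit in norm by Fatou's lemma. *)
Lemma Lp_complete (C r : R) (u : nat -> mclass) :
  0 <= C -> 0 < r < 1 -> (forall k, Lp_set mu p (u k)) ->
  (forall k, Lp_norm mu p (u k.+1 - u k) <= C * r ^+ k) ->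
  exists2 v, Lp_set mu p v & forall k, Lp_norm mu p (u k - v) <= C * r ^+ k / (1 - r).
Proof.
move=> C0 r01 hu du.
have p0 : 0 < p := lt_le_trans ltr01 p1.
have [f fcvg] := Lp_ae_limit C0 r01 hu du.
pose v := mclass_of mu f.
have hB i l : Lp_set mu p (u i - u l).
  by rewrite addrC -scaleN1r; apply: Lp_setZD.
have bound k : (p_integral mu p (fn (u k - v)%R) <= ((C * r ^+ k / (1 - r)) `^ p)%:E)%E.
  pose h j x := (`|fn (u (k + j)%N) x - fn (u k) x| `^ p)%:E.
  have mh j : measurable_fun setT (h j).
    by apply: measurable_norm_powR; apply: measurable_funB; exact: measurable_mclass.
  have h0 j x : setT x -> (0 <= h j x)%E by rewrite lee_fin powR_ge0.
  have hint j : (\int[mu]_x h j x <= ((C * r ^+ k / (1 - r)) `^ p)%:E)%E.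
    have -> : (\int[mu]_x h j x)%E = p_integral mu p (fn (u (k + j)%N - u k)%R).
      apply: ae_eq_p_integral.
      - by apply: measurable_funB; exact: measurable_mclass.
      - exact: measurable_mclass.
      - by move: (mclassB (u (k + j)%N) (u k)); apply: filterS => x hx xX; rewrite hx.
    rewrite -(Lp_norm_pow_EFin p1) // lee_fin.
    apply: ge0_ler_powR; rewrite ?nnegrE ?(ltW p0) ?Lp_norm_ge0 //.
      by rewrite divr_ge0 ?mulr_ge0 ?exprn_ge0 //; lra.
    exact: Lp_norm_telescope.
  have -> : p_integral mu p (fn (u k - v)%R) = (\int[mu]_x limn_einf (h^~ x))%E.
    apply: ae_eq_integral => //.
    - by apply: measurable_norm_powR; exact: measurable_mclass.
    - rewrite (_ : (fun x => _) = (fun x => - limn_esup (fun j => - h j x))%E).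
        apply: measurableT_comp => //; apply: measurable_fun_limn_esup => j.
        exact: measurableT_comp.
      apply/funext => x; rewrite -limn_einfN; congr limn_einf.
      by apply/funext => j; rewrite /comp oppeK.
    - move: (mclassB (u k) v) (repr_mclass_of mu f) fcvg; apply: filterS3 => x e1 e2 cx xX.
      rewrite e1 // e2 //; symmetry; apply: (cvg_limn_einf_sup _).1.
      apply: cvg_EFin; first exact: nearW.
      rewrite distrC; apply: (cvg_norm_powR p1); apply: cvgB; last exact: cvg_cst.
      by have := cx; rewrite -(cvg_shiftn k); under eq_fun do rewrite addnC.
  apply: le_trans (fatou mu measurableT mh h0) _.
  rewrite limn_einf_lim; apply: lime_le; first exact: is_cvg_einfs.
  apply: nearW => j; apply: le_trans (hint j); apply: ereal_inf_lbound => /=.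
  by exists j => //=.
have bound0 k : 0 <= C * r ^+ k / (1 - r).
  by case/andP: r01 => ? ?; rewrite divr_ge0 ?mulr_ge0 ?exprn_ge0 //; lra.
have uv k : Lp_set mu p (u k - v).
  by apply/(Lp_setP p1); apply: le_lt_trans (bound k) _; rewrite ltry.
exists v.
  have -> : v = (-1) *: (u 0%N - v) + u 0%N by rewrite scaleN1r opprB subrK.
  exact: Lp_setZD.
move=> k; rewrite -(@ler_pXn2r _ 1) ?nnegrE ?Lp_norm_ge0 // !expr1.
have h : Lp_norm mu p (u k - v) `^ p <= (C * r ^+ k / (1 - r)) `^ p.
  by rewrite -lee_fin Lp_norm_pow_EFin.
rewrite leNgt; apply/negP => lt; move: h; rewrite leNgt => /negP; apply.
by apply: gt0_ltr_powR; rewrite ?nnegrE ?Lp_norm_ge0.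
Qed.

End LpComplete.

(** * Poincare inequalities for vector-valued functions *)

Lemma cvg_sum_seq (R : realType) (I : Type) (r : seq I) (F : I -> nat -> R)
    (l : I -> R) : (forall i, F i @ \oo --> l i) ->
  (fun N => \sum_(i <- r) F i N) @ \oo --> \sum_(i <- r) l i.
Proof.
move=> Fl; elim: r => [|i r IH].
  by rewrite big_nil; under eq_fun do rewrite big_nil; exact: cvg_cst.
by rewrite big_cons; under eq_fun do rewrite big_cons; exact: cvgD.
Qed.

Section VectorPoincare.
Context (R : realType) (V : finType) (B : V -> V -> R) (D kappa p : R).
Context (B0 : forall x y, 0 <= B x y) (D0 : 0 <= D) (kappa0 : 0 <= kappa) (p1 : 1 <= p).

Let p0 : 0 < p := lt_le_trans ltr01 p1.

Definition mean (W : lmodType R) (f : V -> W) : W := #|V|%:R^-1 *: \sum_y f y.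

(** The centre is the mean rather than an arbitrary constant: means of coordinates
    are coordinates of the mean, so that the inequality can be summed over
    coordinates or integrated over a measure space. *)
Definition scalar_poincare : Prop := forall f : V -> R,
  D * \sum_x `|f x - mean (f : V -> R^o)| `^ p <= kappa * p_energy p B f.

Definition poincare_in (W : nspace R) (kap : R) : Prop :=
  forall f : V -> ambient W, (forall x, points W (f x)) ->
  exists2 c, points W c &
    D * \sum_x nnorm (f x - c) `^ p
      <= kap * \sum_x \sum_y B x y * nnorm (f x - f y) `^ p.

Hypothesis sp : scalar_poincare.

Lemma poincare_lp (n : nat) : poincare_in (lp_nspace p n) kappa.
Proof.
move=> f _; exists (mean f) => //=.
have powE (u : 'rV[R]_n) :
    ((\sum_(i < n) `|u ord0 i| `^ p) `^ p^-1) `^ p = \sum_(i < n) `|u ord0 i| `^ p.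
  rewrite -powRrM mulVf ?gt_eqF // powRr1 //.
  by apply: sumr_ge0 => i _; apply: powR_ge0.
under eq_bigr do rewrite powE.
under [X in _ <= _ * X]eq_bigr do under eq_bigr do rewrite powE mulr_sumr.
rewrite exchange_big mulr_sumr /=.
under [X in _ <= _ * X]eq_bigr do rewrite exchange_big.
rewrite [X in _ <= _ * X]exchange_big mulr_sumr /=.
apply: ler_sum => i _; have := sp (fun x => f x ord0 i).
rewrite /p_energy /mean; congr (_ <= _).
  congr (_ * _); apply: eq_bigr => x _.
  by rewrite !mxE summxE.
congr (_ * _); apply: eq_bigr => x _; apply: eq_bigr => y _.
by rewrite !mxE.
Qed.

(** The inequality holds for every partial sum over the coordinates, and passes to
    the limit. *)
Lemma poincare_lpoo : poincare_in (lpoo_nspace p) kappa.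
Proof.
have zd (a : R) (u v : nat -> R) :
    cvgn (series (fun k => `|u k| `^ p)) -> cvgn (series (fun k => `|v k| `^ p)) ->
    cvgn (series (fun k => `|a * u k + v k| `^ p)).
  move=> cu cv.
  apply: (@series_le_cvg _ _ (fun k => 2 `^ p * (`|a| `^ p * `|u k| `^ p + `|v k| `^ p))).
  - by move=> k; apply: powR_ge0.
  - by move=> k; rewrite mulr_ge0 ?addr_ge0 ?mulr_ge0 ?powR_ge0.
  - move=> k; have := @norm_powR_subr_le R p (a * u k) (- v k) (ltW p0).
    by rewrite opprK normrN normrM powRM.
  - apply: is_cvg_seriesZ; apply: is_cvg_seriesD; last exact: cv.
    by apply: is_cvg_seriesZ; exact: cu.
have cvg0 : cvgn (series (fun _ : nat => `|0 : R| `^ p)).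
  rewrite (_ : series _ = fun=> 0); first exact: is_cvg_cst.
  apply/funext => N; rewrite /series /= big1 // => k _.
  by rewrite normr0 powR0 // gt_eqF.
have sumE (s : seq V) (g : V -> (nat -> R)) k : (\sum_(y <- s) g y) k = \sum_(y <- s) g y k.
  by rewrite fct_sumE.
move=> f hf.
have cs (s : seq V) : cvgn (series (fun k => `|\sum_(y <- s) f y k| `^ p)).
  elim: s => [|y s IH]; first by under eq_fun do rewrite big_nil.
  suff -> : (fun k => `|\sum_(j <- y :: s) f j k| `^ p)
      = (fun k => `|1 * f y k + \sum_(j <- s) f j k| `^ p).
    exact: (zd 1 (f y) (fun k => \sum_(j <- s) f j k) (hf y) IH).
  by apply/funext => k; rewrite mul1r big_cons.
pose c : nat -> R := mean f.
have cE k : c k = mean (fun x => f x k : R^o).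
  by rewrite /c /mean; congr (_ * _); rewrite fct_sumE.
have hc : cvgn (series (fun k => `|c k| `^ p)).
  suff -> : (fun k => `|c k| `^ p)
      = (fun k => `|#|V|%:R^-1 * (\sum_y f y k) + 0| `^ p).
    exact: (zd _ (fun k => \sum_y f y k) (fun=> 0) (cs _) cvg0).
  by apply/funext => k; rewrite addr0 cE.
have hB (u v : nat -> R) : cvgn (series (fun k => `|u k| `^ p)) ->
    cvgn (series (fun k => `|v k| `^ p)) ->
    cvgn (series (fun k => `|u k - v k| `^ p)).
  move=> hu hv; suff -> : (fun k => `|u k - v k| `^ p)
      = (fun k => `|-1 * v k + u k| `^ p).
    exact: (zd (-1) v u hv hu).
  by apply/funext => k; rewrite mulN1r addrC.
exists c => //.
have normE (u : nat -> R) : cvgn (series (fun k => `|u k| `^ p)) ->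
    series (fun k => `|u k| `^ p) @ \oo --> @nnorm _ (lpoo_nspace p) u `^ p.
  move=> hu; rewrite /= -powRrM mulVf ?gt_eqF // powRr1 //.
  apply: limr_ge => //; apply: nearW => N; apply: sumr_ge0 => k _; exact: powR_ge0.
have cvgL : (fun N => D * \sum_x series (fun k => `|f x k - c k| `^ p) N) @ \oo -->
    D * \sum_x @nnorm _ (lpoo_nspace p) (f x - c) `^ p.
  apply: cvgM; first exact: cvg_cst.
  by apply: cvg_sum_seq => x; apply: normE; exact: hB (hf x) hc.
have cvgR : (fun N => kappa * \sum_x \sum_y B x y * series (fun k => `|f x k - f y k| `^ p) N)
    @ \oo --> kappa * \sum_x \sum_y B x y * @nnorm _ (lpoo_nspace p) (f x - f y) `^ p.
  apply: cvgM; first exact: cvg_cst.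
  apply: cvg_sum_seq => x; apply: cvg_sum_seq => y; apply: cvgM; first exact: cvg_cst.
  by apply: normE; exact: hB (hf x) (hf y).
apply: (ler_cvg_to cvgL cvgR); apply: nearW => N.
rewrite /series /= exchange_big mulr_sumr /=.
under [X in _ <= _ * X]eq_bigr do under eq_bigr do rewrite mulr_sumr.
under [X in _ <= _ * X]eq_bigr do rewrite exchange_big.
rewrite [X in _ <= _ * X]exchange_big mulr_sumr /=.
apply: ler_sum => k _; have := sp (fun x => f x k).
by rewrite cE.
Qed.

End VectorPoincare.

(** The scalar inequality holds at every point, for the values of the chosen
    representatives; integrated, it is the inequality for the norms. *)
Lemma poincare_Lp (R : realType) (V : finType) (B : V -> V -> R) (D kappa p : R)
    d (X : measurableType d) (mu : {measure set X -> \bar R}) :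
  (forall x y, 0 <= B x y) -> 0 <= D -> 0 <= kappa -> 1 <= p ->
  scalar_poincare B D kappa p -> poincare_in B D p (Lp_nspace mu p) kappa.
Proof.
move=> B0 D0 kappa0 p1 sp f0 hf0.
pose f : V -> {mfun_ mu, X >-> R} := f0.
have hf : forall x, Lp_set mu p (f x) := hf0.
rewrite -[f0]/f {hf0}.
have p0 : 0 < p by lra.
have hsum (s : seq V) : Lp_set mu p (\sum_(y <- s) f y).
  elim: s => [|y s IH]; first by rewrite big_nil; exact: Lp_set0.
  by rewrite big_cons -[f y]scale1r; apply: Lp_setZD => //; exact: hf.
pose c := mean f.
have hc : Lp_set mu p c.
  by rewrite -[c]addr0; apply: Lp_setZD => //; exact: Lp_set0.
have hB u v : Lp_set mu p u -> Lp_set mu p v -> Lp_set mu p (u - v).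
  by move=> hu hv; rewrite addrC -scaleN1r; apply: Lp_setZD.
exists c => //.
pose fx x t : R := f x t.
have mf x : measurable_fun setT (fx x) by exact: measurable_mclass.
pose cx t : R := mean (fun x => fx x t : R^o).
have mc : measurable_fun setT cx.
  apply: measurable_funM => //; apply: measurable_sum => x; exact: mf.
have normB x : (@nnorm _ (Lp_nspace mu p) (f x - c) `^ p)%:E
    = p_integral mu p (fun t => fx x t - cx t).
  rewrite [LHS](Lp_norm_pow_EFin p1 (hB _ _ (hf x) hc)).
  apply: ae_eq_p_integral => //; first exact: measurable_funB.
  move: (mclassB (f x) c) (mclassZ #|V|%:R^-1 (\sum_y f y)) (mclass_sum (index_enum V) f).
  by apply: filterS3 => t h1 h2 h3 tX; rewrite h1 // h2 // h3.
have normE x y : (@nnorm _ (Lp_nspace mu p) (f x - f y) `^ p)%:E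
    = p_integral mu p (fun t => fx x t - fx y t).
  rewrite [LHS](Lp_norm_pow_EFin p1 (hB _ _ (hf x) (hf y))).
  apply: ae_eq_p_integral => //; first exact: measurable_funB.
  by move: (mclassB (f x) (f y)); apply: filterS => t h1 tX; rewrite h1.
have mB x : measurable_fun setT (fun t => (`|fx x t - cx t| `^ p)%:E).
  by apply: measurable_norm_powR; apply: measurable_funB.
have mE x y : measurable_fun setT (fun t => (`|fx x t - fx y t| `^ p)%:E).
  by apply: measurable_norm_powR; apply: measurable_funB.
have mBE x y : measurable_fun setT (fun t => ((B x y)%:E * (`|fx x t - fx y t| `^ p)%:E)%E).
  by apply: measurable_funeM.
have pw0 (a : R) : (0 <= (`|a| `^ p)%:E)%E by rewrite lee_fin powR_ge0.
have L : ((D * \sum_x @nnorm _ (Lp_nspace mu p) (f x - c) `^ p)%:E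
    = \int[mu]_t (D%:E * \sum_x (`|fx x t - cx t| `^ p)%:E))%E.
  rewrite ge0_integralZl_EFin //; last 2 first.
  - by move=> t _; apply: sume_ge0.
  - by apply: emeasurable_sum.
  rewrite ge0_integral_sum // EFinM -sumEFin; congr (_ * _)%E.
  by apply: eq_bigr => x _; rewrite normB.
have inner x : ((\sum_y B x y * @nnorm _ (Lp_nspace mu p) (f x - f y) `^ p)%:E
    = \int[mu]_t (\sum_y (B x y)%:E * (`|fx x t - fx y t| `^ p)%:E))%E.
  rewrite ge0_integral_sum //; last by move=> y t _; rewrite mule_ge0 // lee_fin.
  rewrite -sumEFin; apply: eq_bigr => y _.
  by rewrite EFinM normE ge0_integralZl_EFin.
have Rr : ((kappa * \sum_x \sum_y B x y * @nnorm _ (Lp_nspace mu p) (f x - f y) `^ p)%:E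
    = \int[mu]_t (kappa%:E * \sum_x \sum_y (B x y)%:E * (`|fx x t - fx y t| `^ p)%:E))%E.
  have s0 x t : (0 <= \sum_y (B x y)%:E * (`|fx x t - fx y t| `^ p)%:E)%E.
    by apply: sume_ge0 => y _; rewrite mule_ge0 // lee_fin.
  have ms x : measurable_fun setT (fun t => \sum_y (B x y)%:E * (`|fx x t - fx y t| `^ p)%:E)%E.
    by apply: emeasurable_sum.
  rewrite ge0_integralZl_EFin //; last 2 first.
  - by move=> t _; apply: sume_ge0.
  - by apply: emeasurable_sum.
  rewrite ge0_integral_sum // EFinM -sumEFin; congr (_ * _)%E.
  by apply: eq_bigr => x _; rewrite inner.
rewrite -lee_fin L Rr; apply: ge0_le_integral => //.
- by move=> t _; apply: mule_ge0; [rewrite lee_fin | apply: sume_ge0].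
- by apply: measurable_funeM; apply: emeasurable_sum.
- by apply: measurable_funeM; apply: emeasurable_sum => x; apply: emeasurable_sum.
- move=> t _; rewrite sumEFin -EFinM.
  under [X in (_ <= _ * X)%E]eq_bigr do under eq_bigr do rewrite -EFinM.
  under [X in (_ <= _ * X)%E]eq_bigr do rewrite sumEFin.
  rewrite sumEFin -EFinM lee_fin.
  exact: sp (fun x => fx x t).
Qed.

(** Bi-Lipschitz [L^p] geometry speaks of subspaces of an exact dimension, so the
    span of a finite family has to be presented by independent vectors. *)
Lemma finite_family_has_dim (R : realType) (E : completeNormedModType R) (s : seq E) :
  exists n (U : set E), has_dim U n /\ forall y, y \in s -> U y.
Proof.
elim: s => [|y s [n [U [[e [free ->]] sU]]]].
  exists 0%N, [set 0]; split=> //; exists (fun=> 0); split; first by move=> c _ [].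
  apply/seteqP; split=> [x ->|x [c _ <-]]; last by rewrite big_ord0.
  by exists (fun=> 0) => //; rewrite big_ord0.
have [yU|nyU] := pselect (range (fun c : 'I_n -> R => \sum_(i < n) c i *: e i) y).
  exists n, (range (fun c : 'I_n -> R => \sum_(i < n) c i *: e i)); split; first by exists e.
  by move=> z; rewrite inE => /predU1P[->//|]; exact: sU.
pose e' (i : 'I_n.+1) := if unlift ord0 i is Some j then e j else y.
have sumE (c : 'I_n.+1 -> R) :
    \sum_(i < n.+1) c i *: e' i = c ord0 *: y + \sum_(i < n) c (lift ord0 i) *: e i.
  rewrite big_ord_recl /e' unlift_none; congr (_ + _).
  by apply: eq_bigr => i _; rewrite liftK.
exists n.+1, (range (fun c : 'I_n.+1 -> R => \sum_(i < n.+1) c i *: e' i)); split.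
  exists e'; split=> // c; rewrite sumE => c0.
  have c00 : c ord0 = 0.
    apply: contra_notP nyU => /eqP cn0.
    exists (fun i => - (c ord0)^-1 * c (lift ord0 i)) => //.
    rewrite (eq_bigr (fun i => - (c ord0)^-1 *: (c (lift ord0 i) *: e i))); last first.
      by move=> i _; rewrite scalerA.
    rewrite -scaler_sumr; move/eqP: c0; rewrite addrC addr_eq0 => /eqP ->.
    by rewrite scalerN scaleNr opprK scalerA mulVf // scale1r.
  move: c0; rewrite c00 scale0r add0r => /free c0 i.
  by case: (unliftP ord0 i) => [j|] ->.
move=> z; rewrite inE => /predU1P[->|/sU [c _ <-]].
  exists (fun i => (i == ord0)%:R) => //; rewrite sumE eqxx scale1r big1 ?addr0 // => i _.
  by rewrite -[X in (X == _)]/(lift ord0 i) eq_sym (negPf (neq_lift _ _)) scale0r.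
exists (fun i => if unlift ord0 i is Some j then c j else 0) => //.
rewrite sumE unlift_none scale0r add0r.
by apply: eq_bigr => i _; rewrite liftK.
Qed.

Section Transfer.
Context (R : realType) (V : finType) (B : V -> V -> R) (D kappa p L : R).
Context (B0 : forall x y, 0 <= B x y) (D0 : 0 <= D) (kappa0 : 0 <= kappa).
Context (p1 : 1 <= p) (L0 : 0 < L) (sp : scalar_poincare B D kappa p).

(** The inequality involves nothing but distances between the points [f x] and one
    centre, so a non-linear bi-Lipschitz bijection transfers it, at the cost of a
    factor [L^p] on either side. *)
Lemma poincare_bilip (E : completeNormedModType R) (U : set E) (W : nspace R) (f : V -> E) :
  (forall u v, points W u -> points W v -> 0 <= nnorm (u - v)) ->
  bilip_equiv L (sub_nspace U) W -> poincare_in B D p W kappa ->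
  (forall x, U (f x)) ->
  exists c : E, D * \sum_x `|f x - c| `^ p
     <= kappa * L `^ (2 * p) * \sum_x \sum_y B x y * `|f x - f y| `^ p.
Proof.
move=> nn0 [F [Ffun _ Fsurj] FL] poinW fU.
have p0 : 0 < p := lt_le_trans ltr01 p1.
have FP x : points W (F (f x)) by apply: Ffun; exact: fU.
have [c' c'W c'P] := poinW (fun x => F (f x)) FP.
have [c /= cU cE] := Fsurj c' c'W; exists c.
have Lp0 : 0 <= L `^ p by apply: powR_ge0.
have le1 x : `|f x - c| `^ p <= L `^ p * nnorm (F (f x) - c') `^ p.
  have /andP[lo _] := FL (f x) c (fU x) cU.
  have n0 : 0 <= nnorm (F (f x) - c') by apply: nn0.
  rewrite -powRM ?(ltW L0) //.
  apply: ge0_ler_powR; rewrite ?nnegrE ?(ltW p0) ?mulr_ge0 ?(ltW L0) //.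
  by move: lo; rewrite cE /= mulrC ler_pdivrMr // mulrC.
have le2 x y : nnorm (F (f x) - F (f y)) `^ p <= L `^ p * `|f x - f y| `^ p.
  have /andP[_ hi] := FL (f x) (f y) (fU x) (fU y).
  rewrite -powRM ?(ltW L0) //.
  apply: ge0_ler_powR; rewrite ?nnegrE ?(ltW p0) ?mulr_ge0 ?(ltW L0) //.
  exact: nn0.
apply: (@le_trans _ _ (D * \sum_x L `^ p * nnorm (F (f x) - c') `^ p)).
  by rewrite ler_wpM2l //; apply: ler_sum => x _; exact: le1.
rewrite -mulr_sumr mulrCA.
apply: le_trans (ler_wpM2l Lp0 c'P) _.
have L2 : L `^ (2 * p) = L `^ p * L `^ p.
  by rewrite -powRD ?(gt_eqF L0) ?implybT //; congr (_ `^ _); ring.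
have -> : kappa * L `^ (2 * p) * \sum_x \sum_y B x y * `|f x - f y| `^ p
    = L `^ p * (kappa * \sum_x \sum_y B x y * (L `^ p * `|f x - f y| `^ p)).
  under [in RHS]eq_bigr do under eq_bigr do rewrite mulrCA.
  under [in RHS]eq_bigr do rewrite -mulr_sumr.
  by rewrite -mulr_sumr L2; ring.
rewrite ler_wpM2l // ler_wpM2l //; apply: ler_sum => x _; apply: ler_sum => y _.
by rewrite ler_wpM2l.
Qed.

(** The values of [f] span a finite-dimensional subspace, hence lie in one that is
    bi-Lipschitz equivalent to a model space. *)
Lemma poincare_Lp_geometry (E : completeNormedModType R) : Lp_geometry_fin_dim E p L ->
  poincare_in B D p (banach_nspace E) (kappa * L `^ (2 * p)).
Proof.
move=> geo f _.
have [n [U [Udim Uf]]] := finite_family_has_dim [seq f x | x <- enum V].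
have fU x : U (f x) by apply: Uf; apply: map_f; rewrite mem_enum.
have [U' [_ UU' cases]] := geo n U Udim.
have fU' x : U' (f x) by apply: UU'.
suff [c cP] : exists c : E, D * \sum_x `|f x - c| `^ p
     <= kappa * L `^ (2 * p) * \sum_x \sum_y B x y * `|f x - f y| `^ p by exists c.
case: cases => [[k _ bi]|bi|[d [X [mu bi]]]].
- apply: poincare_bilip bi _ fU'; first by move=> u v _ _; apply: powR_ge0.
  exact: poincare_lp.
- apply: poincare_bilip bi _ fU'; first by move=> u v _ _; apply: powR_ge0.
  exact: poincare_lpoo.
- apply: poincare_bilip bi _ fU'; first by move=> u v _ _; apply: Lp_norm_ge0.
  exact: poincare_Lp.
Qed.

End Transfer.

(** * Fixed points from contracting displacements *)

(** A common format for Banach spaces and the spaces [L^p]. Completeness is asked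
    for in the form in which the iteration of midpoints meets it, for sequences with
    geometrically decreasing increments. *)
Record banach_axioms (R : realType) (W : nspace R) : Prop := {
  points_0 : points W 0;
  points_lin : forall (a : R) u v, points W u -> points W v -> points W (a *: u + v);
  nnorm_ge0 : forall u, points W u -> 0 <= nnorm u;
  nnorm_triangle : forall u v, points W u -> points W v ->
    nnorm (u + v) <= nnorm u + nnorm v;
  nnorm_scale : forall (a : R) u, points W u -> nnorm (a *: u) = `|a| * nnorm u;
  nnorm_0_inj : forall u, points W u -> nnorm u = 0 -> u = 0;
  geometric_complete : forall (C r : R) (u : nat -> ambient W),
    0 <= C -> 0 < r < 1 -> (forall k, points W (u k)) ->
    (forall k, nnorm (u k.+1 - u k) <= C * r ^+ k) ->
    exists2 v, points W v & (fun k => nnorm (u k - v)) @ \oo --> (0 : R)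
}.

Lemma banach_axioms_banach (R : realType) (E : completeNormedModType R) :
  banach_axioms (banach_nspace E).
Proof.
split=> //=.
- by move=> u v _ _; apply: ler_normD.
- by move=> a u _; apply: normrZ.
- by move=> u _ /normr0_eq0.
move=> C r u C0 /andP[r0 r1] _ du.
have cs : cvgn (series (fun k => u k.+1 - u k)).
  apply: normed_cvg; apply: (@series_le_cvg _ _ (fun k => C * r ^+ k)).
  - by move=> k; apply: normr_ge0.
  - by move=> k; apply: mulr_ge0 => //; apply: exprn_ge0; exact: ltW.
  - exact: du.
  - by apply: is_cvg_geometric_series; rewrite ger0_norm // ltW.
have cu : cvgn u.
  have -> : u = (fun k => u 0%N + series (fun k => u k.+1 - u k) k).
    by apply/funext => k; rewrite /series /= telescope_sumr // addrC subrK.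
  by apply: is_cvgD => //; apply: is_cvg_cst.
exists (limn u) => //.
rewrite -(@normr0 _ E) -(subrr (limn u)); apply: cvg_norm; apply: cvgB => //.
exact: cvg_cst.
Qed.

Lemma banach_axioms_Lp (R : realType) d (X : measurableType d)
    (mu : {measure set X -> \bar R}) (p : R) : 1 <= p ->
  banach_axioms (Lp_nspace mu p).
Proof.
move=> p1; split=> /=.
- exact: Lp_set0.
- by move=> a u v; apply: Lp_setZD.
- by move=> u _; apply: Lp_norm_ge0.
- by move=> u v; apply: Lp_normD.
- by move=> a u; apply: Lp_normZ.
- by move=> u; apply: Lp_norm_eq0.
move=> C r u C0 r01 hu du.
have [v hv uv] := Lp_complete p1 C0 r01 hu du.
exists v => //.
apply: (@squeeze_cvgr _ _ _ _ (fun=> 0) (fun k => C / (1 - r) * r ^+ k)).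
- apply: nearW => k; rewrite Lp_norm_ge0 /=.
  by apply: le_trans (uv k) _; rewrite mulrAC.
- exact: cvg_cst.
- apply: cvg_geometric; case/andP: r01 => r0 r1.
  by rewrite ger0_norm // ltW.
Qed.

Lemma powR_midpoint_le (R : realType) (p s t : R) : 1 <= p -> 0 <= s -> 0 <= t ->
  (2^-1 * (s + t)) `^ p <= 2^-1 * (s `^ p + t `^ p).
Proof.
move=> p1 s0 t0; set a := 2^-1 * (s + t).
have a0 : 0 <= a by rewrite mulr_ge0 // addr_ge0.
have := powR_tangent p1 a0 s0; have := powR_tangent p1 a0 t0.
have -> : t - a = 2^-1 * (t - s) by rewrite /a; field.
have -> : s - a = - (2^-1 * (t - s)) by rewrite /a; field.
lra.
Qed.

Lemma points_sub (R : realType) (W : nspace R) u v : banach_axioms W ->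
  points W u -> points W v -> points W (u - v).
Proof. by move=> axW hu hv; rewrite addrC -scaleN1r; apply: (points_lin axW). Qed.

Lemma nnorm_distC (R : realType) (W : nspace R) u v : banach_axioms W ->
  points W u -> points W v -> nnorm (u - v) = nnorm (v - u).
Proof.
move=> axW hu hv; rewrite -[u - v]opprB -[- (v - u)]scaleN1r (nnorm_scale axW).
  by rewrite normrN1 mul1r.
exact: points_sub.
Qed.

Section Contraction.
Context (R : realType) (W : nspace R) (axW : banach_axioms W).
Context (V : finType) (inv : V -> V) (T : V -> ambient W -> ambient W) (p : R).
Context (p1 : 1 <= p).
Hypothesis invK : involutive inv.
Hypothesis T_points : forall x v, points W v -> points W (T x v).
Hypothesis T_isometric : forall x u v, points W u -> points W v ->
  nnorm (T x u - T x v) = nnorm (u - v).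
Hypothesis T_affine : forall x u v (t : R), points W u -> points W v ->
  T x (t *: u + (1 - t) *: v) = t *: T x u + (1 - t) *: T x v.
Hypothesis T_inv : forall x v, points W v -> T x (T (inv x) v) = v.

(** [T] stands for the generators of a group acting by affine isometries, and
    [inv] for their inversion. *)
Definition displacement (v : ambient W) : R := \sum_x nnorm (T x v - v) `^ p.

Let p0 : 0 < p := lt_le_trans ltr01 p1.

Let pointsB u v : points W u -> points W v -> points W (u - v) :=
  points_sub axW (u := u) (v := v).

Let pointsZ (a : R) u : points W u -> points W (a *: u).
Proof.
by move=> hu; rewrite -[_ *: _]addr0; apply: (points_lin axW) => //; exact: (points_0 axW).
Qed.

Let pointsD u v : points W u -> points W v -> points W (u + v).
Proof. by move=> hu hv; rewrite -[u]scale1r; apply: (points_lin axW). Qed.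

Let nnormC u v : points W u -> points W v -> nnorm (u - v) = nnorm (v - u) :=
  nnorm_distC axW (u := u) (v := v).

(** For the midpoint [m] of [v] and [c], [T x m - m] is the average of [T x v - c]
    and [T x c - v], and the second vector has the same norm as
    [T (inv x) v - c]. The set of generators being symmetric, the sum over [x] does
    not see the difference. *)
Lemma displacement_midpoint v c : points W v -> points W c ->
  displacement (2^-1 *: v + (1 - 2^-1) *: c) <= \sum_x nnorm (T x v - c) `^ p.
Proof.
move=> hv hc; rewrite /displacement.
have half : 1 - 2^-1 = 2^-1 :> R by field.
apply: (@le_trans _ _
  (\sum_x 2^-1 * (nnorm (T x v - c) `^ p + nnorm (T (inv x) v - c) `^ p))).
  apply: ler_sum => x _.
  have hx : points W (T x v - c) by apply: pointsB => //; exact: T_points.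
  have hix : points W (T (inv x) v - c) by apply: pointsB => //; exact: T_points.
  have hTc : points W (T x c - v) by apply: pointsB => //; exact: T_points.
  apply: le_trans (powR_midpoint_le p1 (nnorm_ge0 axW hx) (nnorm_ge0 axW hix)).
  apply: ge0_ler_powR; rewrite ?nnegrE ?(ltW p0) //.
  - apply: (nnorm_ge0 axW); apply: pointsB; last by apply: pointsD; apply: pointsZ.
    by apply: T_points; apply: pointsD; apply: pointsZ.
  - by rewrite mulr_ge0 // addr_ge0 //; apply: (nnorm_ge0 axW).
  have -> : T x (2^-1 *: v + (1 - 2^-1) *: c) - (2^-1 *: v + (1 - 2^-1) *: c)
      = 2^-1 *: ((T x v - c) + (T x c - v)).
    rewrite T_affine // half -!scalerDr -scalerBr; congr (_ *: _).
    by rewrite opprD [- v - c]addrC addrACA.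
  rewrite (nnorm_scale axW) //; last exact: pointsD.
  rewrite ger0_norm ?invr_ge0 // ler_wpM2l ?invr_ge0 //.
  apply: le_trans (nnorm_triangle axW hx hTc) _; rewrite lerD2l.
  rewrite -[v in leLHS](T_inv x hv) T_isometric //; last exact: T_points.
  by rewrite nnormC //; exact: T_points.
rewrite -mulr_sumr big_split /=.
have -> : \sum_x nnorm (T (inv x) v - c) `^ p = \sum_x nnorm (T x v - c) `^ p.
  by rewrite [RHS](reindex_inj (inv_inj invK)).
by set S := \sum_x _; lra.
Qed.

Hypothesis contract : exists kappa : R, 0 < kappa < 1 /\
  forall v, points W v -> exists2 c, points W c &
    \sum_x nnorm (T x v - c) `^ p <= kappa * displacement v.

Lemma displacement_ge0 v : 0 <= displacement v.
Proof. by apply: sumr_ge0 => x _; apply: powR_ge0. Qed.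

Lemma powR_rootK (s : R) : 0 <= s -> (s `^ p) `^ p^-1 = s.
Proof. by move=> s0; rewrite -powRrM mulfV ?gt_eqF // powRr1. Qed.

Lemma displacement_step (x0 : V) kappa v c : 0 < kappa < 1 ->
  points W v -> points W c ->
  \sum_x nnorm (T x v - c) `^ p <= kappa * displacement v ->
  nnorm (2^-1 *: v + (1 - 2^-1) *: c - v) <= displacement v `^ p^-1.
Proof.
move=> /andP[k0 k1] hv hc hk.
have half : 1 - 2^-1 = 2^-1 :> R by field.
have hx : points W (T x0 v) by apply: T_points.
have root (s : R) : 0 <= s -> s `^ p <= displacement v -> s <= displacement v `^ p^-1.
  move=> s0 h; rewrite -[leLHS]powR_rootK //; apply: ge0_ler_powR => //.
  - by rewrite invr_ge0 ltW.
  - by rewrite nnegrE powR_ge0.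
  - by rewrite nnegrE displacement_ge0.
have b1 : nnorm (T x0 v - c) <= displacement v `^ p^-1.
  apply: root; first by apply: (nnorm_ge0 axW); apply: pointsB.
  apply: (@le_trans _ _ (kappa * displacement v)).
    apply: le_trans hk; rewrite (bigD1 x0) //= lerDl.
    by apply: sumr_ge0 => x _; apply: powR_ge0.
  by rewrite ler_piMl ?displacement_ge0 // ltW.
have b2 : nnorm (T x0 v - v) <= displacement v `^ p^-1.
  apply: root; first by apply: (nnorm_ge0 axW); apply: pointsB.
  rewrite /displacement (bigD1 x0) //= lerDl.
  by apply: sumr_ge0 => x _; apply: powR_ge0.
have -> : 2^-1 *: v + (1 - 2^-1) *: c - v = 2^-1 *: (c - v).
  have e : v = 2^-1 *: v + 2^-1 *: v.
    by rewrite -scalerDl (_ : 2^-1 + 2^-1 = 1 :> R) ?scale1r //; field.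
  rewrite half scalerBr; move: e; set w := 2^-1 *: v => ->.
  by rewrite opprD addrA [w + _]addrC addrK.
rewrite (nnorm_scale axW) //; last exact: pointsB.
rewrite ger0_norm ?invr_ge0 //.
have : nnorm (c - v) <= nnorm (c - T x0 v) + nnorm (T x0 v - v).
  by rewrite -[X in nnorm X <= _](subrKA (T x0 v)); apply: (nnorm_triangle axW); apply: pointsB.
rewrite (nnormC hc hx); lra.
Qed.

(** Replacing [v] by its midpoint with the centre [c] multiplies the displacement by
    [kappa] and moves [v] by at most the [p]-th root of the displacement. The
    iterates thus converge geometrically, to a point of displacement zero. *)
Theorem contraction_fixed_point : exists2 v, points W v & forall x, T x v = v.
Proof.
have [x0 _|V0] := pickP (fun _ : V => true); last first.
  by exists 0 => [|x]; [exact: (points_0 axW) | have := V0 x].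
have [kappa [k01 /= hc]] := contract.
have /andP[k0 k1] := k01.
have /choice[cen cenP] : forall v, exists c, points W v -> points W c /\
    \sum_x nnorm (T x v - c) `^ p <= kappa * displacement v.
  move=> v; have [hv|nv] := pselect (points W v); last by exists v.
  by have [c h1 h2] := hc v hv; exists c.
pose step v := 2^-1 *: v + (1 - 2^-1) *: cen v.
pose u k := iter k step 0.
have hu k : points W (u k).
  elim: k => [|k IH] /=; first exact: (points_0 axW).
  by rewrite /step; apply: pointsD; apply: pointsZ => //; case: (cenP _ IH).
pose E0 := displacement 0.
have decay k : displacement (u k) <= kappa ^+ k * E0.
  elim: k => [|k IH]; first by rewrite expr0 mul1r.
  have [h1 h2] := cenP _ (hu k).
  apply: le_trans (displacement_midpoint (hu k) h1) _; apply: le_trans h2 _.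
  by rewrite exprS -mulrA ler_wpM2l // ltW.
pose C := E0 `^ p^-1; pose r := kappa `^ p^-1.
have E00 : 0 <= E0 by apply: displacement_ge0.
have C0 : 0 <= C by apply: powR_ge0.
have r0 : 0 < r by apply: powR_gt0.
have pinv : 0 < p^-1 by rewrite invr_gt0.
have r1 : r < 1.
  have : kappa `^ p^-1 < 1 `^ p^-1 by apply: gt0_ltr_powR; rewrite ?nnegrE // ltW.
  by rewrite powR1.
have rootE k : (kappa ^+ k * E0) `^ p^-1 = C * r ^+ k.
  rewrite powRM ?exprn_ge0 ?(ltW k0) // mulrC /C /r; congr (_ * _).
  elim: k => [|k IH]; first by rewrite !expr0 powR1.
  by rewrite !exprS powRM ?exprn_ge0 ?(ltW k0) // IH.
have dr k : displacement (u k) `^ p^-1 <= C * r ^+ k.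
  rewrite -rootE; apply: ge0_ler_powR; rewrite ?nnegrE ?displacement_ge0 ?(ltW pinv) //.
  by rewrite mulr_ge0 // exprn_ge0 // ltW.
have du k : nnorm (u k.+1 - u k) <= C * r ^+ k.
  have [h1 h2] := cenP _ (hu k).
  exact: le_trans (displacement_step x0 k01 (hu k) h1 h2) (dr k).
have r01 : 0 < r < 1 by rewrite r0.
have [v hv uv] := geometric_complete axW C0 r01 hu du.
exists v => // x; apply/eqP; rewrite -subr_eq0; apply/eqP.
have hTv : points W (T x v) by apply: T_points.
apply: (nnorm_0_inj axW); first exact: pointsB.
apply/eqP; rewrite eq_le; apply/andP; split; last by apply: (nnorm_ge0 axW); apply: pointsB.
have lim0 : (fun k => 2 * nnorm (u k - v) + C * r ^+ k) @ \oo --> (0 : R).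
  rewrite -[X in _ --> X](_ : 2 * 0 + 0 = 0); last by rewrite mulr0 addr0.
  apply: cvgD; first by apply: cvgM => //; exact: cvg_cst.
  by apply: cvg_geometric; rewrite ger0_norm // ltW.
apply: (ler_cvg_to (cvg_cst (nnorm (T x v - v))) lim0); apply: nearW => k.
have hTu : points W (T x (u k)) by apply: T_points.
have t1 : nnorm (T x v - v) <= nnorm (T x v - T x (u k)) + nnorm (T x (u k) - v).
  by rewrite -[X in nnorm X <= _](subrKA (T x (u k))); apply: (nnorm_triangle axW); apply: pointsB.
have t2 : nnorm (T x (u k) - v) <= nnorm (T x (u k) - u k) + nnorm (u k - v).
  by rewrite -[X in nnorm X <= _](subrKA (u k)); apply: (nnorm_triangle axW); apply: pointsB.
have t3 : nnorm (T x (u k) - u k) <= C * r ^+ k.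
  apply: le_trans (dr k); rewrite -[leLHS]powR_rootK; last first.
    by apply: (nnorm_ge0 axW); apply: pointsB.
  apply: ge0_ler_powR; rewrite ?nnegrE ?powR_ge0 ?displacement_ge0 ?(ltW pinv) //.
  rewrite /displacement (bigD1 x) //= lerDl.
  by apply: sumr_ge0 => y _; apply: powR_ge0.
have t4 : nnorm (T x v - T x (u k)) = nnorm (u k - v).
  by rewrite T_isometric // nnormC.
lra.
Qed.

End Contraction.

(** * Actions of triangular groups *)

Section TriangularAction.
Context (R : realType) (m : nat) (Rel : {set tri_word m}).

Local Notation V := ('I_m * bool)%type.
Local Notation G := (tri_group Rel).

Definition letter_at (i : 'I_3) (w : tri_word m) : V := tnth (val w) i.

Local Notation i0 := (@Ordinal 3 0 isT).
Local Notation i1 := (@Ordinal 3 1 isT).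
Local Notation i2 := (@Ordinal 3 2 isT).

(** A relator [abc] contributes the edge [b -- a^-1], one of its three edges in the
    link of the identity. In an action the orbit points of [b] and of [a^-1] are
    exactly as far apart as [c] moves the base point. *)
Definition edge_weight (x y : V) : R :=
  \sum_(w in Rel) ((letter_at i1 w == x) && (letter_at i0 w == letter_inv y))%:R.

Lemma edge_weight_ge0 x y : 0 <= edge_weight x y.
Proof. by apply: sumr_ge0 => w _; apply: ler0n. Qed.

Lemma edge_weight_sum (F : V -> V -> R) :
  \sum_x \sum_y edge_weight x y * F x y
    = \sum_(w in Rel) F (letter_at i1 w) (letter_inv (letter_at i0 w)).
Proof.
transitivity (\sum_x \sum_(w in Rel) \sum_y
    ((letter_at i1 w == x) && (letter_at i0 w == letter_inv y))%:R * F x y).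
  by apply: eq_bigr => x _; rewrite exchange_big; apply: eq_bigr => y _; rewrite mulr_suml.
rewrite exchange_big; apply: eq_bigr => w _.
rewrite (bigD1 (letter_at i1 w)) //= [X in _ + X]big1 ?addr0; last first.
  by move=> x /negPf xn; apply: big1 => y _; rewrite eq_sym xn mul0r.
rewrite (bigD1 (letter_inv (letter_at i0 w))) //= big1 ?addr0; last first.
  move=> y yn; rewrite (_ : (_ == letter_inv y) = false) ?andbF ?mul0r //.
  apply/negbTE; apply: contra yn => /eqP ->; by rewrite letter_invK.
by rewrite letter_invK !eqxx mul1r.
Qed.

Definition gen (x : V) : G := pg_class _ [:: x].

Lemma gen_inv x : (gen x * gen (letter_inv x))%g = 1%g.
Proof.
rewrite /gen [LHS]pg_mulE; apply/pg_classP; exact: word_eq_cancel.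
Qed.

Lemma gen_rel w : w \in Rel ->
  (gen (letter_at i0 w) * (gen (letter_at i1 w) * gen (letter_at i2 w)))%g = 1%g.
Proof.
move=> wR; rewrite /gen [X in (_ * X)%g]pg_mulE [LHS]pg_mulE; apply/pg_classP.
apply: word_eq_rel; exists w => //.
by rewrite /letter_at; case: (val w) => [[|a [|b [|c []]]]] //= sz; rewrite !(tnth_nth a).
Qed.

Lemma gen_generate (P : G -> Prop) : P 1%g ->
  (forall x g, P g -> P (gen x * g)%g) -> forall g, P g.
Proof.
move=> P1 PM g; rewrite -(pg_class_repr g); elim: (repr g) => [//|x w IH].
by rewrite -[x :: w]/([:: x] ++ w) -pg_mulE; exact: PM.
Qed.

(** For [f x = x v] the energy over the edges is the sum of [|c v - v|^p] over the
    relators [abc], hence at most [(1 + al) D] times the displacement of [v]. The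
    Poincare inequality therefore provides a centre as the midpoint argument needs
    it, with contraction factor [kap (1 + al)]. *)
Theorem fixed_point_of_poincare (W : nspace R) (p D al kap : R) :
  banach_axioms W -> 1 <= p -> 0 < D ->
  (forall c, \sum_(w in Rel) (letter_at i2 w == c)%:R <= (1 + al) * D) ->
  0 <= kap -> kap * (1 + al) < 1 ->
  poincare_in edge_weight D p W kap -> fixed_point_property G W.
Proof.
move=> axW p1 D0 deg kap0 kap1 poin a act.
pose T x v := a (gen x) v.
have T_points x v : points W v -> points W (T x v).
  exact: (act_points act).
have T_iso x u v : points W u -> points W v -> nnorm (T x u - T x v) = nnorm (u - v).
  exact: (act_isometric act).
have T_aff x u v (t : R) : points W u -> points W v ->
    T x (t *: u + (1 - t) *: v) = t *: T x u + (1 - t) *: T x v.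
  exact: (act_affine act).
have T_inv x v : points W v -> T x (T (@letter_inv _ x) v) = v.
  by move=> hv; rewrite /T -(actM act _ _ hv) gen_inv; exact: (act1 act hv).
have edge w v : w \in Rel -> points W v ->
    nnorm (T (letter_at i1 w) v - T (letter_inv (letter_at i0 w)) v)
      = nnorm (T (letter_at i2 w) v - v).
  move=> wR hv.
  have -> : T (letter_inv (letter_at i0 w)) v = T (letter_at i1 w) (T (letter_at i2 w) v).
    have h : T (letter_at i0 w) (T (letter_at i1 w) (T (letter_at i2 w) v)) = v.
      rewrite /T -(actM act _ _ hv) -(actM act _ _ hv) gen_rel //.
      exact: (act1 act hv).
    have := T_inv (letter_inv (letter_at i0 w)) (T (letter_at i1 w) (T (letter_at i2 w) v)).
    rewrite letter_invK h; apply.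
    by apply: (T_points _ _ (T_points _ _ hv)).
  rewrite T_iso //; last exact: T_points.
  by apply: (nnorm_distC axW) => //; apply: T_points.
have [v hv fixv] : exists2 v, points W v & forall x, T x v = v.
  apply: (contraction_fixed_point axW p1 (@letter_invK _) T_points T_iso T_aff T_inv).
  exists (Num.max 2^-1 (kap * (1 + al))); split.
    by rewrite lt_max invr_gt0 ltr0n /= gt_max kap1 andbT; lra.
  move=> v hv; have [c hc cP] := poin (fun x => T x v) (fun x => T_points x v hv).
  exists c => //.
  have e : \sum_x \sum_y edge_weight x y * nnorm (T x v - T y v) `^ p
      <= (1 + al) * D * displacement T p v.
    rewrite edge_weight_sum (eq_bigr (fun w => nnorm (T (letter_at i2 w) v - v) `^ p)); last first.
      by move=> w wR; rewrite edge.
    have -> : \sum_(w in Rel) nnorm (T (letter_at i2 w) v - v) `^ p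
      = \sum_c (\sum_(w in Rel) (letter_at i2 w == c)%:R) * nnorm (T c v - v) `^ p.
      under [RHS]eq_bigr do rewrite mulr_suml.
      rewrite exchange_big; apply: eq_bigr => w _ /=.
      rewrite (bigD1 (letter_at i2 w)) //= eqxx mul1r big1 ?addr0 // => x xn.
      by rewrite eq_sym (negPf xn) mul0r.
    rewrite /displacement mulr_sumr; apply: ler_sum => x _.
    by rewrite ler_wpM2r ?powR_ge0.
  have d0 : 0 <= displacement T p v by apply: displacement_ge0.
  rewrite -(ler_pM2l D0); apply: le_trans cP _.
  apply: le_trans (ler_wpM2l kap0 e) _.
  have -> : kap * ((1 + al) * D * displacement T p v)
      = D * (kap * (1 + al) * displacement T p v) by ring.
  rewrite ler_wpM2l ?(ltW D0) // ler_wpM2r // le_max lexx orbT //.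
exists v => //; apply: gen_generate; first exact: (act1 act hv).
by move=> x g IH; rewrite (actM act _ _ hv) IH; exact: fixv.
Qed.

End TriangularAction.

(** * Deviations of random subsets *)

Section RandomSubset.
Context (R : realType) (W : finType) (r : R) (r01 : 0 <= r <= 1).

Let r0 : 0 <= r. Proof. by case/andP: r01. Qed.
Let r1 : 0 <= 1 - r. Proof. by rewrite subr_ge0; case/andP: r01. Qed.

Definition subset_weight (Rel : {set W}) : R :=
  \prod_(w : W) (if w \in Rel then r else 1 - r).

Definition subset_prob (P : pred {set W}) : R := \sum_(Rel | P Rel) subset_weight Rel.

Lemma subset_weight_ge0 Rel : 0 <= subset_weight Rel.
Proof. by apply: prodr_ge0 => w _; case: ifP. Qed.

Lemma subset_prob_total : subset_prob predT = 1.
Proof.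
have := bigA_distr 1 +%R (fun _ : W => r) (fun _ => 1 - r).
rewrite [in RHS]/= -[RHS]/(subset_prob predT) => <-.
by rewrite big1 // => i _; rewrite -[LHS]/(r + (1 - r)); ring.
Qed.

Lemma le_subset_prob (P Q : pred {set W}) :
  (forall Rel, P Rel -> Q Rel) -> subset_prob P <= subset_prob Q.
Proof.
move=> PQ; rewrite /subset_prob [leLHS]big_mkcond [leRHS]big_mkcond /=.
apply: ler_sum => Rel _; case: ifP => [/PQ -> //|_].
by case: ifP => _ //; apply: subset_weight_ge0.
Qed.

Lemma subset_prob_le1 P : subset_prob P <= 1.
Proof. by rewrite -subset_prob_total; apply: le_subset_prob. Qed.

Lemma subset_prob_compl (P : pred {set W}) : subset_prob P = 1 - subset_prob (predC P).
Proof.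
rewrite -subset_prob_total /subset_prob [X in X - _](bigID P) /=.
by rewrite addrK.
Qed.

Lemma subset_prob_union (I : finType) (Q : pred I) (P : I -> pred {set W}) :
  subset_prob (fun Rel => [exists i, Q i && P i Rel]) <= \sum_(i | Q i) subset_prob (P i).
Proof.
rewrite /subset_prob.
under [leRHS]eq_bigr do rewrite big_mkcond /=.
rewrite exchange_big [leLHS]big_mkcond /=; apply: ler_sum => Rel _.
have nn (i : I) : 0 <= (if P i Rel then subset_weight Rel else 0).
  by case: ifP => _ //; apply: subset_weight_ge0.
case: ifP => [/existsP[i /andP[Qi Pi]]|_]; last by apply: sumr_ge0.
by rewrite (bigD1 i) //= Pi lerDl; apply: sumr_ge0.
Qed.

Lemma subset_prob_setU (P Q : pred {set W}) :
  subset_prob (fun Rel => P Rel || Q Rel) <= subset_prob P + subset_prob Q.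
Proof.
rewrite /subset_prob [leLHS]big_mkcond [X in X + _]big_mkcond [X in _ + X]big_mkcond /=.
rewrite -big_split /=; apply: ler_sum => Rel _.
have := subset_weight_ge0 Rel; case: (P Rel) => /=; case: (Q Rel); lra.
Qed.

Lemma subset_mgf (A : {set W}) (t : R) :
  \sum_Rel subset_weight Rel * expR (t * #|Rel :&: A|%:R) <= expR (r * #|A|%:R * (expR t - 1)).
Proof.
have -> : \sum_Rel subset_weight Rel * expR (t * #|Rel :&: A|%:R)
    = \prod_(w : W) ((if w \in A then r * expR t else r) + (1 - r)).
  rewrite bigA_distr; apply: eq_bigr => Rel _.
  have -> : expR (t * #|Rel :&: A|%:R)
      = \prod_(w : W) (if (w \in Rel) && (w \in A) then expR t else 1).
    rewrite -big_mkcond /= mulrC expRM_natl -prodr_const.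
    by apply: eq_bigl => w; rewrite inE.
  rewrite -big_split /=; apply: eq_bigr => w _.
  by case: (w \in Rel); case: (w \in A); rewrite ?mulr1.
have -> : expR (r * #|A|%:R * (expR t - 1))
    = \prod_(w : W) (if w \in A then expR (r * (expR t - 1)) else 1).
  by rewrite -big_mkcond /= prodr_const -expRM_natl; congr expR; ring.
apply: ler_prod => w _; case: ifP => _; last by rewrite addrC subrK ler01 lexx.
have rt : 0 <= r * expR t by rewrite mulr_ge0 ?expR_ge0.
rewrite addr_ge0 //=.
by apply: le_trans (expR_ge1Dx _); lra.
Qed.

Lemma expR_le_quadratic (t : R) : t <= 2^-1 -> expR t <= 1 + t + 2 * t ^+ 2.
Proof.
move=> t1.
have := expR_ge1Dx (- t); rewrite expRN => h.
have e0 := expR_gt0 t.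
have h1 : (1 - t) * expR t <= 1 by rewrite -ler_pdivlMr // div1r.
have h2 : 1 <= (1 - t) * (1 + t + 2 * t ^+ 2).
  have -> : (1 - t) * (1 + t + 2 * t ^+ 2) = 1 + t ^+ 2 * (1 - 2 * t) by ring.
  by rewrite lerDl mulr_ge0 ?sqr_ge0 //; lra.
have p : 0 < 1 - t by lra.
by rewrite -(ler_pM2l p); apply: le_trans h1 h2.
Qed.

(** Markov's inequality for the exponential moment at [t]. The sign of [t] selects
    the upper or the lower tail. *)
Lemma subset_tail (A : {set W}) (t mu lam : R) : `|t| <= 2^-1 -> r * #|A|%:R <= mu ->
  subset_prob (fun Rel => `|t| * lam < t * (#|Rel :&: A|%:R - r * #|A|%:R))
    <= expR (2 * mu * t ^+ 2 - `|t| * lam).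
Proof.
move=> t1 Amu; set a := r * #|A|%:R in Amu *.
have t12 : t <= 2^-1 by apply: le_trans t1; exact: ler_norm.
pose K := expR (- (`|t| * lam + t * a)).
apply: (@le_trans _ _ (K * \sum_Rel subset_weight Rel * expR (t * #|Rel :&: A|%:R))).
  rewrite mulr_sumr /subset_prob big_mkcond /=; apply: ler_sum => Rel _.
  have w0 := subset_weight_ge0 Rel.
  case: ifP => [h|_]; last by rewrite mulrCA mulr_ge0 // mulr_ge0 ?expR_ge0.
  rewrite mulrCA ler_peMr // /K -expRD -[X in X <= _]expR0 ler_expR.
  by move: h; rewrite mulrBr; lra.
apply: le_trans (ler_wpM2l (expR_ge0 _) (subset_mgf A t)) _.
rewrite -/a /K -expRD ler_expR.
have a0 : 0 <= a by rewrite mulr_ge0.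
have q := expR_le_quadratic t12.
have : a * (expR t - 1) <= a * (t + 2 * t ^+ 2) by rewrite ler_wpM2l //; lra.
have : a * t ^+ 2 <= mu * t ^+ 2 by rewrite ler_wpM2r // sqr_ge0.
lra.
Qed.

Lemma subset_chernoff (A : {set W}) (t mu lam : R) : 0 < t <= 2^-1 -> r * #|A|%:R <= mu ->
  subset_prob (fun Rel => lam < `| #|Rel :&: A|%:R - r * #|A|%:R |)
    <= 2 * expR (2 * mu * t ^+ 2 - t * lam).
Proof.
move=> /andP[t0 t1] Amu.
have nt : `|t| = t by rewrite gtr0_norm.
have nt1 : `|t| <= 2^-1 by rewrite nt.
have nt1' : `|- t| <= 2^-1 by rewrite normrN.
have h1 := subset_tail lam nt1 Amu; have h2 := subset_tail lam nt1' Amu.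
rewrite sqrrN normrN in h2; rewrite !nt in h1 h2.
rewrite mulr_natl mulr2n; apply: le_trans (lerD h1 h2).
apply: le_trans (subset_prob_setU _ _); apply: le_subset_prob => Rel.
rewrite lter_normr mulNr -mulrN !ltr_pM2l //.
Qed.

(** The generating function of subsets by cardinal, for union bounds in which a set
    [S] carries the weight [q ^+ #|S|]. *)
Lemma sum_set_expn (q : R) : \sum_(S : {set W}) q ^+ #|S| = (1 + q) ^+ #|W|.
Proof.
rewrite -prodr_const [RHS](_ : _ = \prod_(w : W) (q + 1)); last first.
  by apply: eq_bigr => w _; rewrite addrC.
rewrite bigA_distr; apply: eq_bigr => S _.
by rewrite -prodr_const big_mkcond.
Qed.

End RandomSubset.

(** * The edges of a random triangular group *)

Section WordCounting.
Context (m : nat).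
Local Notation V := ('I_m * bool)%type.
Local Notation i0 := (@Ordinal 3 0 isT).
Local Notation i1 := (@Ordinal 3 1 isT).
Local Notation i2 := (@Ordinal 3 2 isT).

(** The relators whose edge goes from [S] to [T]. *)
Definition pair_words (S T : {set V}) : {set tri_word m} :=
  [set w | (letter_at i1 w \in S) && (letter_inv (letter_at i0 w) \in T)]%SET.

Definition label_words (c : V) : {set tri_word m} :=
  [set w | letter_at i2 w == c]%SET.

(** The edge of a relator together with its label; these are free coordinates, up to
    three excluded coincidences. *)
Definition word_triple (w : tri_word m) : V * V * V :=
  (letter_at i1 w, letter_inv (letter_at i0 w), letter_at i2 w).

Lemma word_triple_inj : injective word_triple.
Proof.
move=> w w' e; have {}e : ((letter_at i1 w, letter_inv (letter_at i0 w)), letter_at i2 w)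
    = ((letter_at i1 w', letter_inv (letter_at i0 w')), letter_at i2 w') := e.
case/pair_equal_spec: e => /pair_equal_spec[e1 e0] e2.
apply: val_inj; apply: eq_from_tnth => i.
have {}e0 := inv_inj (@letter_invK _) e0.
case: i => [[|[|[|i]]] hi] //.
- by rewrite (_ : Ordinal hi = i0) //; apply: val_inj.
- by rewrite (_ : Ordinal hi = i1) //; apply: val_inj.
- by rewrite (_ : Ordinal hi = i2) //; apply: val_inj.
Qed.

Lemma word_triple_onto (x y c : V) : x != y -> c != letter_inv x -> c != y ->
  exists w, word_triple w = (x, y, c).
Proof.
move=> xy cx cy.
have red : cyclically_reduced [tuple letter_inv y; x; c].
  rewrite /cyclically_reduced /= letter_invK xy cx /= andbT.
  by rewrite (inv_eq (@letter_invK _)) letter_invK eq_sym.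
exists (exist _ [tuple letter_inv y; x; c] red).
by rewrite /word_triple /letter_at /= !(tnth_nth x) /= letter_invK.
Qed.

Lemma card_pair_words_le (S T : {set V}) :
  (#|pair_words S T| <= #|S| * #|T| * #|{: V}|)%N.
Proof.
rewrite -cardsT -!cardsX -(card_imset _ word_triple_inj).
apply: subset_leq_card; apply/fintype.subsetP.
by move=> _ /imsetP[w + ->]; rewrite !inE andbT.
Qed.

Lemma card_label_words_le (c : V) : (#|label_words c| <= #|{: V}| * #|{: V}|)%N.
Proof.
rewrite -cardsT -cardsX.
have inj : {in label_words c &, injective (fun w => (word_triple w).1)}.
  move=> w w'; rewrite !inE => /eqP e /eqP e' h; apply: word_triple_inj.
  by rewrite [LHS]surjective_pairing [RHS]surjective_pairing h /= e e'.
rewrite -(card_in_imset inj); apply: subset_leq_card; apply/fintype.subsetP.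
by move=> *; rewrite !inE.
Qed.

(** A triple [(x, y, c)] in [S * T * V] fails to come from a cyclically reduced word
    only if [x = y], [c = x^-1] or [c = y]. *)
Lemma card_pair_words_ge (S T : {set V}) :
  (#|S| * #|T| * #|{: V}|
    <= #|pair_words S T| + 2 * (#|S| * #|T|) + #|S :&: T| * #|{: V}|)%N.
Proof.
pose Q : {set V * V * V} := finset.setX (finset.setX S T) [set: V]%SET.
pose D1 := [set ((u.1, u.1), u.2) | u in finset.setX (S :&: T) [set: V]%SET]%SET.
pose D2 := [set (u, letter_inv u.1) | u in finset.setX S T]%SET.
pose D3 := [set (u, u.2) | u in finset.setX S T]%SET.
have sub : Q \subset (word_triple @: pair_words S T) :|: D2 :|: D3 :|: D1.
  apply/fintype.subsetP => -[[x y] c]; rewrite !inE /= andbT => /andP[xS yT].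
  have [xy|xy] := eqVneq x y.
    apply/orP; right; apply/imsetP; exists (y, c); last by rewrite xy.
    by rewrite !inE /= -{1}xy xS yT.
  have [cx|cx] := eqVneq c (letter_inv x).
    apply/orP; left; apply/orP; left; apply/orP; right; apply/imsetP.
    by exists (x, y); rewrite ?inE /= ?xS ?yT // cx.
  have [cy|cy] := eqVneq c y.
    apply/orP; left; apply/orP; right; apply/imsetP.
    by exists (x, y); rewrite ?inE /= ?xS ?yT // cy.
  have [w wE] := word_triple_onto xy cx cy.
  do 3!(apply/orP; left); apply/imsetP; exists w; last by rewrite wE.
  have w1 : letter_at i1 w = x by rewrite -[LHS]/(word_triple w).1.1 wE.
  have w0 : letter_inv (letter_at i0 w) = y by rewrite -[LHS]/(word_triple w).1.2 wE.
  by rewrite inE w1 w0 xS.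
rewrite -cardsT -!cardsX -/Q; apply: leq_trans (subset_leq_card sub) _.
have cU (A C : {set V * V * V}) : (#|A :|: C| <= #|A| + #|C|)%N := leq_card_setU A C.
apply: leq_trans (cU _ _) _; apply: leq_add; last exact: leq_imset_card.
apply: leq_trans (cU _ _) _; rewrite mul2n -addnn addnA.
apply: leq_add; last exact: leq_imset_card.
apply: leq_trans (cU _ _) _; apply: leq_add; exact: leq_imset_card.
Qed.

End WordCounting.

Section Pseudorandomness.
Context (R : realType) (m : nat) (r al : R).
Local Notation V := ('I_m * bool)%type.
Local Notation i0 := (@Ordinal 3 0 isT).
Local Notation i1 := (@Ordinal 3 1 isT).
Local Notation i2 := (@Ordinal 3 2 isT).
Local Notation n := (#|{: V}|%:R : R).

(** Up to the words that are not cyclically reduced, the expected degree of a vertex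
    and the expected number of edges with a given label. *)
Definition mean_degree : R := r * n ^+ 2.
Local Notation D := mean_degree.

Definition pseudorandom (Rel : {set tri_word m}) : Prop :=
  mixing (edge_weight R Rel) D al /\
  forall c, \sum_(w in Rel) (letter_at i2 w == c)%:R <= (1 + al) * D.

Definition deviates (A : {set tri_word m}) (lam : R) (Rel : {set tri_word m}) : bool :=
  lam < `| #|Rel :&: A|%:R - r * #|A|%:R |.

(** For the remaining pairs the smaller set has at most [al / 4] times the geometric
    mean of the two cardinals, and the degree bounds alone control the discrepancy. *)
Definition balanced (S T : {set V}) : bool :=
  [&& (0 < #|S|)%N, (0 < #|T|)%N &
    al / 4 * Num.max #|S|%:R #|T|%:R <= Num.sqrt (#|S|%:R * #|T|%:R)].

Lemma edge_weight_block (Rel : {set tri_word m}) (S T : {set V}) :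
  \sum_(x in S) \sum_(y in T) edge_weight R Rel x y = #|Rel :&: pair_words S T|%:R.
Proof.
transitivity (\sum_x \sum_y edge_weight R Rel x y * ((x \in S) && (y \in T))%:R).
  rewrite [LHS]big_mkcond; apply: eq_bigr => x _; case: ifP => _ /=; last first.
    by rewrite big1 // => y _; rewrite mulr0.
  by rewrite [LHS]big_mkcond; apply: eq_bigr => y _; case: ifP => _; rewrite ?mulr1 ?mulr0.
rewrite (edge_weight_sum Rel (fun x y => ((x \in S) && (y \in T))%:R)).
rewrite -sumr_const [LHS]big_mkcond [RHS]big_mkcond; apply: eq_bigr => w _.
by rewrite finset.in_setI /pair_words !inE; case: (w \in Rel) => //=; case: (_ && _).
Qed.

Lemma label_count (Rel : {set tri_word m}) (c : V) :
  \sum_(w in Rel) (letter_at i2 w == c)%:R = #|Rel :&: label_words c|%:R :> R.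
Proof.
rewrite -sumr_const [LHS]big_mkcond [RHS]big_mkcond; apply: eq_bigr => w _.
by rewrite finset.in_setI /label_words !inE; case: (w \in Rel) => //=; case: (_ == _).
Qed.

Context (r0 : 0 < r) (r1 : r < 1) (n_gt0 : 0 < n) (al0 : 0 < al) (al1 : al <= 1).
Hypothesis al_big : 6 <= al * Num.sqrt n.

Local Notation k S T := (Num.sqrt (#|S|%:R * #|T|%:R) : R).

Lemma mean_degree_gt0 : 0 < D.
Proof. by rewrite mulr_gt0 // exprn_gt0. Qed.

Lemma card_le_n (S : {set V}) : #|S|%:R <= n.
Proof. by rewrite ler_nat; exact: max_card. Qed.

Lemma sqrt_le_n (S T : {set V}) : k S T <= n.
Proof.
rewrite -(ger0_norm (ltW n_gt0)) -sqrtr_sqr ler_sqrt ?sqr_ge0 // expr2.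
by apply: ler_pM => //; exact: card_le_n.
Qed.

Lemma sqr_sqrt_card (S T : {set V}) : k S T * k S T = #|S|%:R * #|T|%:R.
Proof. by rewrite -expr2 sqr_sqrtr // mulr_ge0. Qed.

(** The excluded words cost at most a term of order [D / n] times the geometric mean
    of the cardinals, negligible against the allowed discrepancy. *)
Lemma mean_pair_words (S T : {set V}) :
  r * #|pair_words S T|%:R <= D / n * (#|S|%:R * #|T|%:R)
    <= r * #|pair_words S T|%:R + 3 * (D / n) * k S T.
Proof.
have Dn : D / n = r * n by rewrite /D; field; rewrite gt_eqF.
have up := card_pair_words_le S T; have lo := card_pair_words_ge S T.
rewrite -(ler_nat R) !natrM in up; rewrite -(ler_nat R) !natrD !natrM in lo.
have inter : #|S :&: T|%:R <= k S T.
  rewrite -[leLHS](ger0_norm (ler0n _ _)) -sqrtr_sqr ler_sqrt ?mulr_ge0 // expr2.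
  by apply: ler_pM; rewrite ?ler0n // ler_nat subset_leq_card // ?finset.subsetIl ?finset.subsetIr.
have k0 : 0 <= k S T by apply: sqrtr_ge0.
have st : #|S|%:R * #|T|%:R <= n * k S T.
  by rewrite -[leLHS]sqr_sqrt_card ler_wpM2r // sqrt_le_n.
rewrite Dn; apply/andP; split.
  by have := ler_wpM2l (ltW r0) up; lra.
have := ler_wpM2l (ltW r0) lo; have := ler_wpM2l (ltW r0) st.
have := ler_wpM2l (ltW r0) (ler_wpM2r (ltW n_gt0) inter).
lra.
Qed.

Lemma small_error : 3 * (D / n) * Num.sqrt n <= al / 2 * D /\ 3 * (D / n) <= al / 2 * D.
Proof.
have s0 : 0 < Num.sqrt n by rewrite sqrtr_gt0.
have sn : Num.sqrt n * Num.sqrt n = n by rewrite -expr2 sqr_sqrtr // ltW.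
have D0 := mean_degree_gt0.
have n1 : 1 <= n by move: n_gt0; rewrite ltr0n ler1n.
have s1 : 1 <= Num.sqrt n by rewrite -[X in X <= _]sqrtr1 ler_sqrt.
have e : 3 * (D / n) * Num.sqrt n <= al / 2 * D.
  have -> : 3 * (D / n) * Num.sqrt n = D * (6 / Num.sqrt n) / 2.
    rewrite (_ : D / n = D / (Num.sqrt n * Num.sqrt n)); last by rewrite sn.
    by field; rewrite gt_eqF.
  have : 6 / Num.sqrt n <= al by rewrite ler_pdivrMr.
  move=> h; have := ler_wpM2l (ltW D0) h; lra.
split=> //; apply: le_trans e; rewrite ler_peMr //.
by rewrite mulr_ge0 // divr_ge0 // ltW.
Qed.

Lemma degree_close (Rel : {set tri_word m}) (S T : {set V}) : #|S|%:R * #|T|%:R = n ->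
  ~~ deviates (pair_words S T) (al / 2 * D) Rel ->
  `| #|Rel :&: pair_words S T|%:R - D | <= al * D.
Proof.
move=> stn; rewrite /deviates -leNgt => dev.
have /andP[up lo] := mean_pair_words S T; have [e _] := small_error.
have Dn : D / n * n = D by rewrite divfK // gt_eqF.
rewrite stn Dn in up lo.
by move: dev; rewrite !ler_norml; lra.
Qed.

Lemma pseudorandom_of_no_deviation (Rel : {set tri_word m}) :
  (forall x, ~~ deviates (pair_words [set x]%SET [set: V]%SET) (al / 2 * D) Rel) ->
  (forall y, ~~ deviates (pair_words [set: V]%SET [set y]%SET) (al / 2 * D) Rel) ->
  (forall c, ~~ deviates (label_words c) (al / 2 * D) Rel) ->
  (forall S T, balanced S T ->
    ~~ deviates (pair_words S T) (al / 2 * D * k S T) Rel) ->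
  pseudorandom Rel.
Proof.
move=> devr devc devl devp.
have D0 := mean_degree_gt0.
have D0' := ltW D0.
have rowE x : \sum_y edge_weight R Rel x y = #|Rel :&: pair_words [set x]%SET [set: V]%SET|%:R.
  rewrite -edge_weight_block big_set1; apply: eq_bigl => y; by rewrite finset.in_setT.
have colE y : \sum_x edge_weight R Rel x y = #|Rel :&: pair_words [set: V]%SET [set y]%SET|%:R.
  rewrite -edge_weight_block; apply: eq_big => [x|x _]; first by rewrite finset.in_setT.
  by rewrite big_set1.
have row x : `|\sum_y edge_weight R Rel x y - D| <= al * D.
  by rewrite rowE; apply: degree_close => //; rewrite cards1 cardsT mul1r.
have col y : `|\sum_x edge_weight R Rel x y - D| <= al * D.
  by rewrite colE; apply: degree_close => //; rewrite cards1 cardsT mulr1.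
have B0 x y : 0 <= edge_weight R Rel x y by apply: edge_weight_ge0.
have alD : al * D <= D by rewrite ler_piMl.
split; last first.
  move=> c; rewrite label_count; have := devl c; rewrite /deviates -leNgt ler_norml.
  have := card_label_words_le c; rewrite -(ler_nat R) natrM => h.
  have := ler_wpM2l (ltW r0) h; rewrite -expr2 -/D.
  have : 0 <= al * D by rewrite mulr_ge0 // ltW.
  lra.
split=> // S T.
have cstE : \sum_(x in S) \sum_(y in T) D / n = D / n * (#|S|%:R * #|T|%:R).
  by rewrite !sumr_const -mulrnA -[LHS]mulr_natr natrM mulrC [_ * #|S|%:R]mulrC mulrC.
have -> : \sum_(x in S) \sum_(y in T) (edge_weight R Rel x y - D / n)
    = #|Rel :&: pair_words S T|%:R - D / n * (#|S|%:R * #|T|%:R).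
  rewrite -edge_weight_block -cstE -sumrB; apply: eq_bigr => x _; by rewrite sumrB.
have [bal|unbal] := boolP (balanced S T).
  have := devp _ _ bal; rewrite /deviates -leNgt.
  have /andP[up lo] := mean_pair_words S T; have [_ e] := small_error.
  have := ler_wpM2r (sqrtr_ge0 (#|S|%:R * #|T|%:R)) e.
  rewrite !ler_norml; lra.
have n0 := ltW n_gt0.
have X0 : 0 <= #|Rel :&: pair_words S T|%:R :> R by apply: ler0n.
have Dn0 : 0 <= D / n by rewrite divr_ge0.
have k0 : 0 <= k S T by apply: sqrtr_ge0.
have Y0 : 0 <= D / n * (#|S|%:R * #|T|%:R) by do 2!apply: mulr_ge0 => //.
have XS : #|Rel :&: pair_words S T|%:R <= 2 * D * #|S|%:R.
  rewrite -edge_weight_block mulr_natr -sumr_const; apply: ler_sum => x _.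
  apply: (@le_trans _ _ (\sum_y edge_weight R Rel x y)).
    by rewrite [leRHS](bigID (mem T)) /= lerDl; apply: sumr_ge0 => y _.
  by have := row x; rewrite ler_norml; lra.
have XT : #|Rel :&: pair_words S T|%:R <= 2 * D * #|T|%:R.
  rewrite -edge_weight_block exchange_big mulr_natr -sumr_const; apply: ler_sum => y _.
  apply: (@le_trans _ _ (\sum_x edge_weight R Rel x y)).
    by rewrite [leRHS](bigID (mem S)) /= lerDl; apply: sumr_ge0 => x _.
  by have := col y; rewrite ler_norml; lra.
have DnS (S' : {set V}) : D / n * #|S'|%:R <= D.
  by rewrite mulrAC ler_pdivrMr // ler_wpM2l // card_le_n.
have YS : D / n * (#|S|%:R * #|T|%:R) <= 2 * D * #|S|%:R.
  have := ler_wpM2l (ler0n R #|S|) (DnS T).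
  have : 0 <= D * #|S|%:R by rewrite mulr_ge0.
  lra.
have YT : D / n * (#|S|%:R * #|T|%:R) <= 2 * D * #|T|%:R.
  have := ler_wpM2l (ler0n R #|T|) (DnS S).
  have : 0 <= D * #|T|%:R by rewrite mulr_ge0.
  lra.
(* the product of the two cardinals is [k^2] and the larger one exceeds [4k / al] *)
have small : Num.min #|S|%:R #|T|%:R <= al / 4 * k S T.
  move: unbal; rewrite /balanced !negb_and -!leqNgt !leqn0 -ltNge => /or3P[/eqP->|/eqP->|lt].
  - by rewrite ge_min mulr_ge0 // divr_ge0 // ltW.
  - by rewrite ge_min mulr_ge0 ?orbT // divr_ge0 // ltW.
  have mm : Num.min #|S|%:R #|T|%:R * Num.max #|S|%:R #|T|%:R = k S T * k S T :> R.
    rewrite sqr_sqrt_card; case: (leP (#|S|%:R : R) #|T|%:R) => _ //; exact: mulrC.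
  have mx0 : 0 < Num.max #|S|%:R #|T|%:R :> R.
    have := le_lt_trans k0 lt; rewrite pmulr_rgt0 //; exact: divr_gt0.
  rewrite -(ler_pM2r mx0) mm mulrAC; apply: ler_wpM2r => //; exact: ltW.
have Dmin : 2 * D * Num.min #|S|%:R #|T|%:R <= al / 2 * D * k S T.
  have := ler_wpM2l D0' small; lra.
have Xm : #|Rel :&: pair_words S T|%:R <= 2 * D * Num.min #|S|%:R #|T|%:R.
  by case: (leP (#|S|%:R : R) #|T|%:R).
have Ym : D / n * (#|S|%:R * #|T|%:R) <= 2 * D * Num.min #|S|%:R #|T|%:R.
  by case: (leP (#|S|%:R : R) #|T|%:R).
have : 0 <= al * D * k S T by rewrite !mulr_ge0 // ltW.
rewrite ler_norml; lra.
Qed.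

End Pseudorandomness.

Section UnionBound.
Context (R : realType) (m : nat).
Local Notation V := ('I_m * bool)%type.
Local Notation n := (#|{: V}|%:R : R).

(** A balanced pair deviates with probability at most twice this bound raised to
    [#|S| + #|T|], which is what makes a union bound over all pairs converge. *)
Definition tail_bound (r al : R) : R := expR (- (al ^+ 3 * mean_degree m r / 256)).

Lemma prob_degree_deviates (r al : R) (A : {set tri_word m}) :
  0 < r -> r < 1 -> 0 < n -> 0 < al -> al <= 1 ->
  r * #|A|%:R <= mean_degree m r ->
  subset_prob r (deviates r A (al / 2 * mean_degree m r)) <= 2 * tail_bound r al.
Proof.
move=> r0 r1 n0 al0 al1 Amu; set D := mean_degree m r in Amu *.
have D0 : 0 < D by apply: mean_degree_gt0.
have r01 : 0 <= r <= 1 by rewrite !ltW.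
(* [t = al / 8] minimises [2 mu t^2 - t al mu / 2] *)
have t01 : 0 < al / 8 <= 2^-1 by apply/andP; split; lra.
apply: le_trans (subset_chernoff r01 (al / 2 * D) t01 Amu) _.
rewrite ler_wpM2l // ler_expR -/D.
have a2 : al ^+ 3 <= al ^+ 2 by rewrite exprS ler_piMl // exprn_ge0 // ltW.
have := ler_wpM2r (ltW D0) a2; have : 0 <= al ^+ 2 * D by rewrite mulr_ge0 ?exprn_ge0 // ltW.
have -> : 2 * D * (al / 8) ^+ 2 - al / 8 * (al / 2 * D) = - (al ^+ 2 * D / 32) by field.
lra.
Qed.

(** Chernoff's bound gives [expR (- al^2 D k / 32)], with [k] the geometric mean of
    the cardinals; balance bounds [k] below by [al / 8] times their sum. *)
Lemma prob_pair_deviates (r al : R) (S T : {set V}) :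
  0 < r -> r < 1 -> 0 < n -> 0 < al -> al <= 1 -> balanced al S T ->
  subset_prob r (deviates r (pair_words S T)
      (al / 2 * mean_degree m r * Num.sqrt (#|S|%:R * #|T|%:R)))
    <= 2 * (tail_bound r al ^+ #|S| * tail_bound r al ^+ #|T|).
Proof.
move=> r0 r1 n0 al0 al1 /and3P[_ _ bal]; set D := mean_degree m r.
set k := Num.sqrt _ in bal *.
have D0 : 0 < D by apply: mean_degree_gt0.
have r01 : 0 <= r <= 1 by rewrite !ltW.
(* [t = al / 8] minimises [2 mu t^2 - t al mu / 2] *)
have t01 : 0 < al / 8 <= 2^-1 by apply/andP; split; lra.
have mu : r * #|pair_words S T|%:R <= D * k.
  have /andP[up _] := mean_pair_words r0 n0 S T.
  apply: le_trans up _; rewrite -mulrA ler_wpM2l ?(ltW D0) //.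
  rewrite ler_pdivrMl // -[leLHS](sqr_sqrt_card R S T) ler_wpM2r ?sqrtr_ge0 //.
  exact: sqrt_le_n.
apply: le_trans (subset_chernoff r01 (al / 2 * D * k) t01 mu) _.
rewrite ler_wpM2l // -exprD -expRM_natl ler_expR natrD -/D.
have -> : 2 * (D * k) * (al / 8) ^+ 2 - al / 8 * (al / 2 * D * k) = - (al ^+ 2 * D * k / 32).
  by field.
have c0 : 0 <= al ^+ 2 * D by rewrite mulr_ge0 ?exprn_ge0 // ltW.
have := ler_wpM2l c0 bal.
have mS : #|S|%:R <= Num.max #|S|%:R #|T|%:R :> R by rewrite le_max lexx.
have mT : #|T|%:R <= Num.max #|S|%:R #|T|%:R :> R by rewrite le_max lexx orbT.
have c1 : 0 <= al ^+ 3 * D by rewrite mulr_ge0 ?exprn_ge0 // ltW.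
have := ler_wpM2l c1 mS; have := ler_wpM2l c1 mT.
have -> : al ^+ 2 * D * (al / 4 * Num.max #|S|%:R #|T|%:R)
   = al ^+ 3 * D * Num.max #|S|%:R #|T|%:R / 4 by field.
lra.
Qed.

(** A union bound over the [3 n] degrees and over all balanced pairs. The sum of
    [q^(#|S| + #|T|)] over pairs of nonempty sets is [((1 + q)^n - 1)^2], of order
    [(n q)^2]. *)
Lemma prob_not_pseudorandom (r al : R) :
  0 < r -> r < 1 -> 0 < n -> 0 < al -> al <= 1 -> 6 <= al * Num.sqrt n ->
  n * tail_bound r al <= 2^-1 ->
  subset_prob r (fun Rel : {set tri_word m} => ~~ `[< pseudorandom r al Rel >])
    <= 10 * (n * tail_bound r al).
Proof.
move=> r0 r1 n0 al0 al1 al_big nq; set q := tail_bound r al in nq *.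
set D := mean_degree m r.
have q0 : 0 <= q by apply: expR_ge0.
have r01 : 0 <= r <= 1 by rewrite !ltW.
have muP (S T : {set V}) : #|S|%:R * #|T|%:R = n -> r * #|pair_words S T|%:R <= D.
  move=> e; have /andP[up _] := mean_pair_words r0 n0 S T; apply: le_trans up _.
  by rewrite e divfK // gt_eqF.
have muL (c : V) : r * #|label_words c|%:R <= D.
  have := card_label_words_le c; rewrite -(ler_nat R) natrM => h.
  by rewrite /D /mean_degree expr2 ler_wpM2l // ltW.
pose b1 (x : V) := deviates r (pair_words [set x]%SET [set: V]%SET) (al / 2 * D).
pose b2 (y : V) := deviates r (pair_words [set: V]%SET [set y]%SET) (al / 2 * D).
pose b3 (c : V) := deviates r (label_words c) (al / 2 * D).
pose b4 (u : {set V} * {set V}) :=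
  deviates r (pair_words u.1 u.2) (al / 2 * D * Num.sqrt (#|u.1|%:R * #|u.2|%:R)).
apply: (@le_trans _ _ (subset_prob r (fun Rel =>
    [|| [exists x, predT x && b1 x Rel], [exists y, predT y && b2 y Rel],
        [exists c, predT c && b3 c Rel] |
        [exists u, balanced al u.1 u.2 && b4 u Rel]]))).
  apply: le_subset_prob => // Rel; apply: contraR; rewrite !negb_or => /and4P[n1 n2 n3 n4].
  apply/asboolP; apply: pseudorandom_of_no_deviation => //.
  - by move=> x; apply: contraNN n1 => h; apply/existsP; exists x.
  - by move=> x; apply: contraNN n2 => h; apply/existsP; exists x.
  - by move=> x; apply: contraNN n3 => h; apply/existsP; exists x.
  - by move=> S T bal; apply: contraNN n4 => h; apply/existsP; exists (S, T); rewrite bal.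
have deg (b : V -> pred {set tri_word m}) : (forall x, subset_prob r (b x) <= 2 * q) ->
    subset_prob r (fun Rel => [exists x, predT x && b x Rel]) <= 2 * (n * q).
  move=> hb; apply: le_trans (subset_prob_union r01 _ _) _.
  apply: (@le_trans _ _ (\sum_(x : V) 2 * q)); first by apply: ler_sum => x _.
  rewrite sumr_const -[_ *+ _]mulr_natl; lra.
have h1 : subset_prob r (fun Rel => [exists x, predT x && b1 x Rel]) <= 2 * (n * q).
  apply: deg => x; apply: prob_degree_deviates => //.
  by apply: muP; rewrite cards1 cardsT mul1r.
have h2 : subset_prob r (fun Rel => [exists x, predT x && b2 x Rel]) <= 2 * (n * q).
  apply: deg => x; apply: prob_degree_deviates => //.
  by apply: muP; rewrite cards1 cardsT mulr1.
have h3 : subset_prob r (fun Rel => [exists x, predT x && b3 x Rel]) <= 2 * (n * q).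
  by apply: deg => x; apply: prob_degree_deviates => //; exact: muL.
have h4 : subset_prob r (fun Rel => [exists u, balanced al u.1 u.2 && b4 u Rel]) <= 4 * (n * q).
  apply: le_trans (subset_prob_union r01 _ _) _.
  pose nz (S : {set V}) := (0 < #|S|)%N.
  apply: (@le_trans _ _ (\sum_(u | nz u.1 && nz u.2) 2 * (q ^+ #|u.1| * q ^+ #|u.2|))).
    rewrite [leLHS]big_mkcond [leRHS]big_mkcond; apply: ler_sum => -[S T] _ /=.
    have [bal|_] := boolP (balanced al S T).
      by have /and3P[s1 s2 _] := bal; rewrite /nz s1 s2; exact: prob_pair_deviates.
    by case: ifP => _ //; rewrite !mulr_ge0 ?exprn_ge0.
  have -> : \sum_(u | nz u.1 && nz u.2) 2 * (q ^+ #|u.1| * q ^+ #|u.2|)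
      = 2 * ((\sum_(S | nz S) q ^+ #|S|) * (\sum_(S | nz S) q ^+ #|S|)).
    rewrite -(pair_big nz nz (fun S T => 2 * (q ^+ #|S| * q ^+ #|T|))) /=.
    rewrite mulr_suml mulr_sumr; apply: eq_bigr => S _.
    by rewrite -!mulr_sumr.
  have sE : \sum_(S | nz S) q ^+ #|S| = (1 + q) ^+ #|{: V}| - 1.
    rewrite -sum_set_expn [in RHS](bigID nz) /= -addrA.
    rewrite [X in _ = _ + (X - 1)](big_pred1 finset.set0); last first.
      by move=> S; rewrite /nz -leqNgt leqn0 cards_eq0.
    by rewrite cards0 expr0 subrr addr0.
  have s0 : 0 <= \sum_(S | nz S) q ^+ #|S| by apply: sumr_ge0 => S _; apply: exprn_ge0.
  have sle : \sum_(S | nz S) q ^+ #|S| <= 2 * (n * q).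
    rewrite sE lerBlDr.
    apply: (@le_trans _ _ (expR q ^+ #|{: V}|)).
      by apply: lerXn2r; rewrite ?nnegrE ?expR_ge0 ?addr_ge0 // expR_ge1Dx.
    rewrite -expRM_natl; apply: le_trans (expR_le_quadratic nq) _.
    have nq0 : 0 <= n * q by rewrite mulr_ge0.
    have := ler_wpM2l nq0 nq; rewrite expr2; lra.
  have nq0 : 0 <= n * q by rewrite mulr_ge0.
  have : (\sum_(S | nz S) q ^+ #|S|) * (\sum_(S | nz S) q ^+ #|S|)
      <= 2 * (n * q) * (2 * (n * q)) by apply: ler_pM.
  have := ler_wpM2l nq0 nq; lra.
apply: le_trans (subset_prob_setU r01 _ _) _.
have := lerD h2 (lerD h3 h4).
have := subset_prob_setU r01 (fun Rel => [exists x, predT x && b3 x Rel])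
    (fun Rel => [exists u, balanced al u.1 u.2 && b4 u Rel]).
have := subset_prob_setU r01 (fun Rel => [exists x, predT x && b2 x Rel])
    (fun Rel => [exists x, predT x && b3 x Rel] || [exists u, balanced al u.1 u.2 && b4 u Rel]).
move: h1; lra.
Qed.

End UnionBound.

(** * Choice of parameters and conclusion *)

Section ParameterChoice.
Context (R : realType).

Lemma expR_half_le (t : R) : 0 <= t -> t <= 1 -> expR (t / 2) <= 1 + t.
Proof.
move=> t0 t1; have h : t / 2 <= 2^-1 by lra.
by apply: le_trans (expR_le_quadratic h) _; nra.
Qed.

Lemma le_powR2 (p : R) : 1 <= p -> p <= 2 `^ p.
Proof.
move=> p1; have h : -1 <= 1 :> R by lra.
by have := powR_bernoulli p1 h; rewrite (_ : 1 + 1 = 2 :> R) ?mulr1 //; lra.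
Qed.

(** With [y = log m] and [P] the upper end of the range of exponents, the grid has
    polynomially many points in [y]. The threshold [beta] has to beat the square of
    their number and the factor [p 2^p], so [beta ^ p] has the size
    [exp (- O (P log y + P^2))]. It must exceed the discrepancy [exp (- dlt y / 6)],
    which bounds [P log y] and [P^2] by small multiples of [y]. *)
Lemma parameters_exist (dlt eta y : R) :
  0 < dlt <= 1 -> 0 < eta <= 1 -> 289 <= y -> 256 / eta ^+ 4 <= y -> 3 / eta <= y ->
  exists (K : nat) (beta gamma : R),
    [/\ 0 < beta <= 1, 0 < gamma,
        2 * expR y <= gamma * (1 + gamma) ^+ K &
        forall p, 2 <= p <= dlt / 60 * Num.sqrt (y / ln y) ->
          [/\ expR (- (dlt * y / 6)) <= beta `^ p,
              16 * p * gamma <= eta ^+ 2 &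
              (2 * K%:R + 3) ^+ 2 * (p * 2 `^ p * (3 * beta)) <= eta]].
Proof.
move=> /andP[d0 d1] /andP[e0 e1] y289 yeta4 yeta.
have y0 : 0 < y by lra.
have y1 : 1 <= y by lra.
have lny1 : 1 <= ln y.
  rewrite -ler_expR lnK ?posrE //.
  have h : 1 <= 1 :> R by [].
  have := @expR_half_le 1 ler01 h.
  have -> : expR 1 = expR (1 / 2) ^+ 2 :> R by rewrite -expRM_natl; congr expR; field.
  have := expR_ge0 (1 / 2 : R); nra.
have lnyy : ln y <= y.
  by have := expR_ge1Dx (ln y); rewrite lnK ?posrE //; lra.
have lny0 : 0 < ln y by lra.
have q0 : 0 <= y / ln y by rewrite divr_ge0 // ltW.
have [P [PE P0 PP]] : exists P, [/\ P = dlt / 60 * Num.sqrt (y / ln y), 0 <= P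
    & P ^+ 2 * ln y = (dlt / 60) ^+ 2 * y].
  eexists; split; first by [].
    by rewrite mulr_ge0 ?sqrtr_ge0 //; lra.
  by rewrite exprMn sqr_sqrtr // -mulrA divfK // gt_eqF.
have c1 : (dlt / 60) ^+ 2 <= dlt / 60 by rewrite expr2 ler_piMl //; lra.
have c0 : 0 <= (dlt / 60) ^+ 2 by apply: sqr_ge0.
have P2 : P ^+ 2 <= dlt / 60 * y.
  apply: (@le_trans _ _ (P ^+ 2 * ln y)); first by rewrite ler_peMr // sqr_ge0.
  by rewrite PP ler_wpM2r // ltW.
have Pln : P * ln y <= dlt / 60 * y.
  have l0 : 0 <= dlt / 60 * y by rewrite mulr_ge0 ?ltW //; lra.
  rewrite -ler_sqr ?nnegrE //; last by rewrite mulr_ge0 // ltW.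
  have -> : (P * ln y) ^+ 2 = P ^+ 2 * ln y * ln y by ring.
  have -> : (dlt / 60 * y) ^+ 2 = (dlt / 60) ^+ 2 * (y * y) by ring.
  rewrite PP -mulrA ler_wpM2l //.
  by rewrite ler_wpM2l // ltW.
have Psqrt : P ^+ 2 <= y by nra.
(* with step [1 / y] the grid reaches down to [exp (- K / (2 y)) = exp (- 3 y)] *)
have [K [K1 K2]] : exists K : nat, 6 * y ^+ 2 <= K%:R /\ K%:R <= 6 * y ^+ 2 + 1.
  have z0 : 0 <= 6 * y ^+ 2 by rewrite mulr_ge0 ?sqr_ge0.
  exists (Num.truncn (6 * y ^+ 2)).+1; have /andP[h1 h2] := truncn_itv z0.
  have e : (Num.truncn (6 * y ^+ 2)).+1%:R = (Num.truncn (6 * y ^+ 2))%:R + 1 :> R by rewrite natr1.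
  by rewrite e in h2 *; split; [exact: ltW | lra].
(* [y^-6] against the [O (y^4)] pairs of levels, [expR (- 2 P)] against [p 2^p] *)
pose beta := expR (- (6 * ln y + P * 2)).
have b1 : beta <= 1.
  rewrite -[leRHS]expR0 ler_expR oppr_le0 addr_ge0 ?mulr_ge0 //; lra.
exists K, beta, y^-1; split.
- by rewrite expR_gt0.
- by rewrite invr_gt0.
- have yi1 : y^-1 <= 1 by rewrite invf_le1.
  have yi0 : 0 <= y^-1 by rewrite invr_ge0 ltW.
  have step : expR (3 * y) <= (1 + y^-1) ^+ K.
    apply: (@le_trans _ _ (expR (y^-1 / 2) ^+ K)); last first.
      by apply: lerXn2r; rewrite ?nnegrE ?expR_ge0 ?addr_ge0 // expR_half_le.
    rewrite -expRM_natl ler_expR.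
    have -> : 3 * y = 6 * y ^+ 2 * (y^-1 / 2) by field; rewrite gt_eqF.
    by rewrite ler_wpM2r // divr_ge0.
  rewrite [leRHS]mulrC ler_pdivlMr //; apply: le_trans step.
  have -> : expR (3 * y) = expR y * (expR y * expR y).
    by rewrite -!expRD; congr expR; ring.
  have ey := expR_ge1Dx y.
  have ey0 := expR_ge0 y.
  have -> : 2 * expR y * y = expR y * (2 * y) by ring.
  rewrite ler_wpM2l //; apply: ler_pM; lra.
- move=> p /andP[p2 pP]; rewrite -PE in pP.
  have p1 : 1 <= p by lra.
  have pln : p * ln y <= P * ln y by rewrite ler_wpM2r // ltW.
  have Pp : P * p <= P ^+ 2 by rewrite expr2 ler_wpM2l.
  split.
  + rewrite /beta -expRM ler_expR.
    have dy : 0 <= dlt * y by rewrite mulr_ge0 ?ltW.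
    lra.
  + have y'0 : 0 <= eta ^+ 2 * y by rewrite mulr_ge0 ?sqr_ge0 // ltW.
    rewrite ler_pdivrMr // -ler_sqr ?nnegrE //; last by lra.
    have h : 256 <= y * eta ^+ 4 by rewrite -ler_pdivrMr // exprn_gt0.
    have h' := ler_wpM2l (ltW y0) h.
    have pp : p ^+ 2 <= P ^+ 2 by apply: lerXn2r; rewrite ?nnegrE //; lra.
    have -> : (16 * p) ^+ 2 = 256 * p ^+ 2 by ring.
    have -> : (eta ^+ 2 * y) ^+ 2 = y * (y * eta ^+ 4) by ring.
    lra.
  + have y2 : 1 <= y ^+ 2 by apply: exprn_ege1.
    have K3 : (2 * K%:R + 3) ^+ 2 <= y ^+ 5.
      apply: (@le_trans _ _ ((17 * y ^+ 2) ^+ 2)).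
        by apply: lerXn2r; rewrite ?nnegrE ?addr_ge0 ?mulr_ge0 ?sqr_ge0 //; lra.
      have -> : (17 * y ^+ 2) ^+ 2 = 289 * y ^+ 4 by ring.
      by rewrite (exprS y 4) ler_wpM2r // exprn_ge0 // ltW.
    have e2 : 2 <= expR 1 :> R by have := expR_ge1Dx (1 : R); lra.
    have p2e : 2 `^ p <= expR p.
      rewrite -{2}[p]mul1r expRM; apply: ge0_ler_powR; rewrite ?nnegrE ?expR_ge0 //; lra.
    have pe : p * 2 `^ p <= expR (2 * P).
      apply: (@le_trans _ _ (expR p * expR p)).
        apply: ler_pM => //; rewrite ?powR_ge0 //; first lra.
        exact: le_trans (le_powR2 p1) p2e.
      by rewrite -expRD ler_expR; lra.
    have betaE : beta = (y ^+ 6)^-1 * expR (- (2 * P)).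
      have e6 : expR (- (6 * ln y)) = (y ^+ 6)^-1 by rewrite expRN expRM_natl lnK.
      by rewrite /beta opprD expRD e6 [P * 2]mulrC.
    have y60 : 0 <= (y ^+ 6)^-1 by rewrite invr_ge0 exprn_ge0 // ltW.
    have pb : p * 2 `^ p * (3 * beta) <= 3 * (y ^+ 6)^-1.
      rewrite betaE.
      have -> : 3 * (y ^+ 6)^-1 = expR (2 * P) * (3 * ((y ^+ 6)^-1 * expR (- (2 * P)))).
        rewrite expRN; field; rewrite gt_eqF ?expR_gt0 //= ?gt_eqF //.
      by rewrite ler_wpM2r // !mulr_ge0 // expR_ge0.
    apply: (@le_trans _ _ (y ^+ 5 * (3 * (y ^+ 6)^-1))).
      apply: ler_pM => //; rewrite ?sqr_ge0 // mulr_ge0 //.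
        by rewrite mulr_ge0 ?powR_ge0 //; lra.
      by rewrite mulr_ge0 ?expR_ge0.
    have -> : y ^+ 5 * (3 * (y ^+ 6)^-1) = 3 / y by field; rewrite gt_eqF.
    by rewrite ler_pdivrMr // mulrC -ler_pdivrMr.
Qed.

End ParameterChoice.

Lemma scalar_poincare_of_mixing (R : realType) (V : finType) (p eta alpha beta gamma D : R)
    (K : nat) (B : V -> V -> R) :
  2 <= p -> 0 < eta <= 12^-1 -> 0 <= D ->
  0 < beta <= 1 -> 0 <= alpha <= beta `^ p -> alpha <= eta ->
  0 < gamma -> 16 * p * gamma <= eta ^+ 2 ->
  #|V|%:R <= gamma * (1 + gamma) ^+ K ->
  (2 * K%:R + 3) ^+ 2 * (p * 2 `^ p * (3 * beta)) <= eta ->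
  mixing B D alpha -> scalar_poincare B D (2 - 9 * eta)^-1 p.
Proof.
move=> p2 /andP[e0 e1] D0 b01 al ale gam0 gamle Kbig bet mixB f.
have e01 : 0 < eta <= 1 by apply/andP; split=> //; lra.
pose g x := f x - mean (f : V -> R^o).
have g0 : \sum_x g x = 0.
  rewrite sumrB sumr_const -[_ *+ _]mulr_natl /mean.
  have [x _|V0] := pickP (fun _ : V => true).
    have nn : #|V|%:R != 0 :> R by rewrite pnatr_eq0 -lt0n; apply/card_gt0P; exists x.
    by rewrite -[X in _ - _ * X]/(#|V|%:R^-1 * \sum_y f y) mulrA mulfV // mul1r subrr.
  by rewrite (eq_bigl _ _ V0) big_pred0_eq (eq_card0 (A := V)) ?mul0r ?subrr // => x; have := V0 x.
have := mixing_poincare p2 e01 D0 b01 al ale gam0 gamle Kbig bet mixB g0.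
have -> : p_energy p B g = p_energy p B f.
  apply: eq_bigr => x _; apply: eq_bigr => y _; congr (_ * (`|_| `^ _)).
  by rewrite /g; ring.
have c0 : 0 < 2 - 9 * eta by lra.
by move=> h; rewrite [leRHS]mulrC ler_pdivlMr // mulrC.
Qed.

(** The bi-Lipschitz constant costs a factor [L^(2 p) = 2 - 2 eps], so the contraction
    factor is [(2 - 2 eps) (1 + al) / (2 - 9 eta)], less than [1] as [eta = eps / 6]. *)
Lemma FL_of_poincare (R : realType) (m : nat) (Rel : {set tri_word m})
    (p eps eta al D : R) :
  2 <= p -> 0 < eps <= 2^-1 -> eta = eps / 6 -> 0 <= al <= eta -> 0 < D ->
  (forall c, \sum_(w in Rel) (letter_at (@Ordinal 3 2 isT) w == c)%:R <= (1 + al) * D) ->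
  scalar_poincare (edge_weight R Rel) D (2 - 9 * eta)^-1 p ->
  FLpL p ((2 - 2 * eps) `^ (2 * p)^-1) (tri_group Rel) /\ FLp p (tri_group Rel).
Proof.
move=> p2 /andP[eps0 eps1] etaE /andP[al0 al1] D0 deg sp.
have p1 : 1 <= p by lra.
have B0 := @edge_weight_ge0 R m Rel.
have c0 : 0 < 2 - 9 * eta by lra.
have kap0 : 0 <= (2 - 9 * eta)^-1 by rewrite invr_ge0 ltW.
split.
  move=> E geo; set L := (2 - 2 * eps) `^ (2 * p)^-1 in geo.
  have e0 : 0 < 2 - 2 * eps by lra.
  have L0 : 0 < L by apply: powR_gt0.
  have LE : L `^ (2 * p) = 2 - 2 * eps.
    by rewrite /L -powRrM mulVf ?powRr1 ?ltW // gt_eqF //; lra.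
  have poin := poincare_Lp_geometry B0 (ltW D0) kap0 p1 L0 sp geo.
  rewrite LE in poin.
  apply: (fixed_point_of_poincare (banach_axioms_banach E) p1 D0 deg _ _ poin).
    by rewrite mulr_ge0 // ltW.
  rewrite -mulrA mulrC ltr_pdivrMr // mul1r.
  have : (2 - 2 * eps) * (1 + al) <= 2 - 2 * eps + 2 * eta by nra.
  lra.
move=> d X mu.
have poin := @poincare_Lp _ _ _ _ _ _ _ _ mu B0 (ltW D0) kap0 p1 sp.
apply: (fixed_point_of_poincare (banach_axioms_Lp mu p1) p1 D0 deg _ _ poin) => //.
by rewrite mulrC ltr_pdivrMr // mul1r; lra.
Qed.

Section Asymptotics.
Context (R : realType).

(** The expected degree is at least [4 m^dlt] while [al^3] is [m^(- dlt / 2)], so the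
    exponent of the tail bound is a positive power of [m] and beats the [2 m] vertices;
    and [al] stays far above the [1 / sqrt n] of the excluded words. *)
Lemma large_log_estimates (dlt eta y : R) (r : R) (m : nat) :
  0 < dlt <= 1 -> 0 < eta -> (0 < m)%N -> y = ln m%:R -> 15 <= y ->
  6 / (dlt * eta) <= y -> 1024 / dlt ^+ 2 <= y ->
  m%:R `^ dlt / m%:R ^+ 2 <= r ->
  let al := expR (- (dlt * y / 6)) in
  let n : R := #|{: 'I_m * bool}|%:R in
  [/\ n = 2 * expR y, al <= eta, 6 <= al * Num.sqrt n &
      n * tail_bound m r al <= 2 / m%:R].
Proof.
move=> /andP[d0 d1] e0 m0 yE y15 yeta ydlt hr al n.
have mR : 0 < m%:R :> R by rewrite ltr0n.
have mE : m%:R = expR y by rewrite yE lnK ?posrE.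
have nE : n = 2 * expR y by rewrite /n card_prod card_ord card_bool natrM mE mulrC.
have y0 : 0 < y by lra.
have dy0 : 0 < dlt * y by rewrite mulr_gt0.
split=> //.
- rewrite /al expRN -[eta]invrK lef_pV2 ?posrE ?expR_gt0 ?invr_gt0 //.
  apply: le_trans (expR_ge1Dx _).
  have : 6 / (dlt * eta) * (dlt / 6) <= y * (dlt / 6) by rewrite ler_wpM2r //; lra.
  have -> : 6 / (dlt * eta) * (dlt / 6) = eta^-1.
    by field; rewrite !gt_eqF.
  lra.
- have s : expR (y / 2) <= Num.sqrt n.
    rewrite -(ger0_norm (expR_ge0 (y / 2))) -sqrtr_sqr ler_sqrt ?nE ?mulr_ge0 ?expR_ge0 //.
    rewrite -expRM_natl (_ : 2%:R * (y / 2) = y); last by field.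
    by have := expR_ge0 y; lra.
  apply: (@le_trans _ _ (al * expR (y / 2))); last by rewrite ler_wpM2l ?expR_ge0.
  rewrite /al -expRD; apply: le_trans (expR_ge1Dx _).
  have : dlt * y <= y by rewrite ler_piMl // ltW.
  lra.
- have D4 : 4 * expR (dlt * y) <= mean_degree m r.
    rewrite /mean_degree -/n nE.
    have mp : m%:R `^ dlt = expR (dlt * y) by rewrite mE mulrC expRM.
    rewrite mp mE in hr.
    have e2 : 0 < expR y ^+ 2 by rewrite exprn_gt0 // expR_gt0.
    rewrite ler_pdivrMr // in hr.
    have -> : (2 * expR y) ^+ 2 = 4 * expR y ^+ 2 by ring.
    lra.
  have big : dlt ^+ 2 * y ^+ 2 / 8 <= expR (dlt * y / 2).
    have h : 0 <= dlt * y / 2 by lra.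
    have := expR_ge1Dxn 1 h; rewrite (_ : 2`!%:R = 2 :> R) //.
    have -> : dlt ^+ 2 * y ^+ 2 / 8 = (dlt * y / 2) ^+ 2 / 2 by field.
    lra.
  have al3 : al ^+ 3 * (4 * expR (dlt * y)) = 4 * expR (dlt * y / 2).
    by rewrite /al -expRM_natl mulrCA -expRD; congr (_ * expR _); field.
  have al30 : 0 <= al ^+ 3 by rewrite exprn_ge0 // expR_ge0.
  have low : 2 * y <= al ^+ 3 * mean_degree m r / 256.
    apply: (@le_trans _ _ (4 * expR (dlt * y / 2) / 256)); last first.
      by rewrite -al3 ler_wpM2r // ler_wpM2l.
    have d2 : 0 < dlt ^+ 2 by rewrite exprn_gt0.
    have h : 1024 <= y * dlt ^+ 2 by rewrite -ler_pdivrMr.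
    have := ler_wpM2l (ltW y0) h.
    have -> : y * (y * dlt ^+ 2) = dlt ^+ 2 * y ^+ 2 by ring.
    lra.
  rewrite nE mE /tail_bound -mulrA ler_wpM2l // -expRN -expRD ler_expR.
  lra.
Qed.

Lemma near_ln_ge (c : R) : \forall m \near \oo, c <= ln (m%:R : R).
Proof.
near=> m.
have h : expR c <= m%:R by near: m; exact: nbhs_infty_ger.
by rewrite -ler_expR lnK // posrE; apply: lt_le_trans h; exact: expR_gt0.
Unshelve. all: by end_near.
Qed.

Lemma aas_of_pseudorandom (rho al : nat -> R) (P : nat -> topologicalGroupType -> Prop) :
  (forall m, 0 < rho m < 1) ->
  (\forall m \near \oo,
     subset_prob (rho m) (fun Rel : {set tri_word m} => ~~ `[< pseudorandom (rho m) (al m) Rel >])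
       <= 20 / m%:R) ->
  (\forall m \near \oo, forall Rel : {set tri_word m},
     pseudorandom (rho m) (al m) Rel -> P m (tri_group Rel)) ->
  aas rho P.
Proof.
move=> rho01 bad pseudoP; rewrite /aas.
apply: (@squeeze_cvgr _ _ _ _ (fun m => 1 - 20 / m%:R) (fun=> 1)); last 2 first.
- rewrite -[X in _ --> X]subr0 -(mulr0 20); apply: cvgB; first exact: cvg_cst.
  apply: cvgM; first exact: cvg_cst.
  have pos : \forall k \near \oo, 0 < k%:R :> R by exists 1%N => // k /= k1; rewrite ltr0n.
  exact: (gtr0_cvgV0 pos).2 cvgr_idn.
- exact: cvg_cst.
near=> m.
have r01 : 0 <= rho m <= 1 by have /andP[h1 h2] := rho01 m; rewrite !ltW.
rewrite -[tri_prob _ _ _]/(subset_prob (rho m) (fun Rel => `[< P m (tri_group Rel) >])).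
rewrite subset_prob_le1 // andbT subset_prob_compl // lerD2l lerN2.
apply: (@le_trans _ _ (subset_prob (rho m)
   (fun Rel : {set tri_word m} => ~~ `[< pseudorandom (rho m) (al m) Rel >]))); last by near: m.
apply: le_subset_prob => // Rel; apply: contra => /asboolP h; apply/asboolP.
by move: Rel h; near: m.
Unshelve. all: by end_near.
Qed.

End Asymptotics.

Theorem theorem1p6 (R : realType) (delta : R) (hdelta : 0 < delta) :
  exists2 C : R, 0 < C &
    forall (rho : nat -> R) (eps : R),
      (forall m, 0 < rho m < 1) ->
      (\forall m \near \oo, m%:R `^ delta / m%:R ^+ 2 <= rho m) ->
      0 < eps <= 2^-1 ->
      aas rho (fun m G => forall p : R,
        2 <= p <= C * Num.sqrt (ln m%:R / ln (ln m%:R)) ->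
        FLpL p ((2 - 2 * eps) `^ (2 * p)^-1) G) /\
      aas rho (fun m G => forall p : R,
        2 <= p <= C * Num.sqrt (ln m%:R / ln (ln m%:R)) ->
        FLp p G).
Proof.
(* a density above [m^(delta - 2)] is above [m^(dlt - 2)] *)
pose dlt := Num.min delta 1.
have dlt0 : 0 < dlt by rewrite lt_min hdelta ltr01.
have dlt01 : 0 < dlt <= 1 by rewrite dlt0 ge_min lexx orbT.
exists (dlt / 60); first by rewrite divr_gt0.
move=> rho eps rho01 rho_ge eps01.
have /andP[eps0 eps1] := eps01.
pose eta := eps / 6.
have eta0 : 0 < eta by rewrite divr_gt0.
have eta1 : eta <= 12^-1 by rewrite /eta; lra.
have eta01 : 0 < eta <= 1 by rewrite eta0 /=; lra.
have eta012 : 0 < eta <= 12^-1 by rewrite eta0.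
pose al m : R := expR (- (dlt * ln m%:R / 6)).
have large (c : R) : \forall m \near \oo, c <= ln (m%:R : R) := near_ln_ge c.
have pos : \forall m \near \oo, (0 < m)%N by exists 1%N.
have al0 m : 0 < al m by apply: expR_gt0.
have est : \forall m \near \oo,
    let n : R := #|{: 'I_m * bool}|%:R in
    [/\ n = 2 * expR (ln m%:R), al m <= eta, 6 <= al m * Num.sqrt n &
        n * tail_bound m (rho m) (al m) <= 2 / m%:R].
  near=> m.
  have m0 : (0 < m)%N by near: m.
  apply: (large_log_estimates dlt01 eta0 m0 erefl).
  - by near: m; exact: large.
  - by near: m; exact: large.
  - by near: m; exact: large.
  have h : m%:R `^ delta / m%:R ^+ 2 <= rho m by near: m.
  apply: le_trans h; rewrite ler_wpM2r ?invr_ge0 ?exprn_ge0 //.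
  by apply: ler_powR; rewrite ?ler1n // ge_min lexx.
have bad : \forall m \near \oo,
    subset_prob (rho m) (fun Rel : {set tri_word m} => ~~ `[< pseudorandom (rho m) (al m) Rel >])
      <= 20 / m%:R.
  near=> m.
  have m4 : (4 <= m)%N by near: m; exists 4%N.
  have [nE ale sqn nq] : let n : R := #|{: 'I_m * bool}|%:R in
    [/\ n = 2 * expR (ln m%:R), al m <= eta, 6 <= al m * Num.sqrt n &
        n * tail_bound m (rho m) (al m) <= 2 / m%:R] by near: m.
  have /andP[r0 r1] := rho01 m.
  have m4R : 4 <= m%:R :> R by rewrite ler_nat.
  have m0R : 0 < m%:R :> R by lra.
  have n0 : 0 < #|{: 'I_m * bool}|%:R :> R by rewrite nE mulr_gt0 // expR_gt0.
  have nq' : #|{: 'I_m * bool}|%:R * tail_bound m (rho m) (al m) <= 2^-1.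
    by apply: le_trans nq _; rewrite ler_pdivrMr //; lra.
  have al1 : al m <= 1 by lra.
  apply: le_trans (prob_not_pseudorandom r0 r1 n0 (al0 m) al1 sqn nq') _.
  have -> : 20 / m%:R = 10 * (2 / m%:R) :> R by rewrite mulrA -natrM.
  by rewrite ler_wpM2l.
have pseudoFL : \forall m \near \oo, forall Rel : {set tri_word m},
    pseudorandom (rho m) (al m) Rel -> forall p : R,
    2 <= p <= dlt / 60 * Num.sqrt (ln m%:R / ln (ln m%:R)) ->
    FLpL p ((2 - 2 * eps) `^ (2 * p)^-1) (tri_group Rel) /\ FLp p (tri_group Rel).
  near=> m => Rel [mixB deg] p p_range; have /andP[p2 _] := p_range.
  have [nE ale _ _] : let n : R := #|{: 'I_m * bool}|%:R in
    [/\ n = 2 * expR (ln m%:R), al m <= eta, 6 <= al m * Num.sqrt n &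
        n * tail_bound m (rho m) (al m) <= 2 / m%:R] by near: m.
  have /andP[r0 r1] := rho01 m.
  have n0 : 0 < #|{: 'I_m * bool}|%:R :> R by rewrite nE mulr_gt0 // expR_gt0.
  have D0 : 0 < mean_degree m (rho m) by apply: mean_degree_gt0.
  have y1 : 289 <= ln m%:R :> R by near: m; exact: large.
  have y2 : 256 / eta ^+ 4 <= ln m%:R :> R by near: m; exact: large.
  have y3 : 3 / eta <= ln m%:R :> R by near: m; exact: large.
  have [K [beta [gamma [b01 gam0 nK params]]]] := parameters_exist dlt01 eta01 y1 y2 y3.
  have [albeta gamle bet] := params p p_range.
  have al_beta : 0 <= al m <= beta `^ p by rewrite (ltW (al0 m)) albeta.
  have al_eta : 0 <= al m <= eta by rewrite (ltW (al0 m)) ale.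
  apply: (FL_of_poincare p2 eps01 erefl al_eta D0 deg).
  apply: (scalar_poincare_of_mixing p2 eta012 (ltW D0) b01 al_beta ale gam0 gamle _ bet mixB).
  by rewrite nE.
split; apply: (aas_of_pseudorandom rho01 bad); move: pseudoFL; apply: filterS => m h Rel gRel p hp;
  by have [] := h Rel gRel p hp.
Unshelve. all: by end_near.
Qed.
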